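(* Let $V$ be a grading-restricted vertex superalgebra, $g$ an automorphism of $V$ and $W$ a lower-bounded generalized $g$-twisted $V$-module with twisted vertex operator map $Y_W^g$. Let $p\in\mathbb Z$. For $v_{1}\in V^{[\alpha_{1}]}, \dots, v_{k}\in V^{[\alpha_{k}]}$, $w\in W$ and $w'\in W'$, the series $$\langle w', (Y_{W}^{g})^{p}(v_{1}, z_{1})\cdots (Y_{W}^{g})^{p}(v_{k}, z_{k})w\rangle$$ is absolutely convergent in the region $|z_{1}|>\cdots>|z_{k}|>0$. Moreover, there exists a multivalued analytic function with preferred branch (the same for all $p$) of the form $$\sum_{n_{1}, \dots, n_{k}=0}^{N}f_{n_{1}\cdots n_{k}}(z_{1}, \dots,z_{k})\, z_{1}^{-\alpha_{1}}\cdots z_{k}^{-\alpha_{k}}(\log z_{1})^{n_{1}}\cdots (\log z_{k})^{n_{k}},$$ where $N\in\mathbb N$ and the $f_{n_{1}\cdots n_{k}}(z_{1}, \dots,z_{k})$ are rational functions of $z_{1}, \dots, z_{k}$ with the only possible poles $z_{i}=0$ for $i=1, \dots, k$ and $z_{i}-z_{j}=0$ for $i, j=1, \dots, k$, $i\ne j$, such that in the region $|z_{1}|>\cdots>|z_{k}|>0$ the sum of the series is equal to the branch $$\sum_{n_{1}, \dots, n_{k}=0}^{N}f_{n_{1}\cdots n_{k}}(z_{1}, \dots,z_{k})e^{-\alpha_{1}l_{p}(z_{1})}\cdots e^{-\alpha_{k}l_{p}(z_{k})}(l_{p}(z_{1}))^{n_{1}}\cdots (l_{p}(z_{k}))^{n_{k}}.$$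 In addition, the orders at $z_{i}=0$ of the rational functions $f_{n_{1}\cdots n_{k}}$ have a lower bound independent of $v_{q}$ for $q\ne i$ and of $w'$; the orders at $z_{i}=z_{j}$ of the rational functions $f_{n_{1}\cdots n_{k}}$ have a lower bound independent of $v_{q}$ for $q\ne i, j$, of $w$ and of $w'$.
   Context: Conventions: $\mathbb N=\{0,1,2,\dots\}$. For $z\in\mathbb C^\times$ and $p\in\mathbb Z$, $l_p(z)=\log|z|+i\arg z+2p\pi i$ with $0\le\arg z<2\pi$. $x$ and $\log x$ are formal variables; $W\{x\}$ denotes formal series $\sum_{n\in\mathbb C}w_nx^n$, $w_n\in W$. Elements of $V$, $W$ are taken of pure parity, so $|\cdot|$ is defined. The order of a rational function along a divisor is its valuation there, so a pole of multiplicity $m$ has order $-m$ (a lower bound on orders means an upper bound on pole multiplicities). A grading-restricted vertex superalgebra is a $\frac{\mathbb Z}{2}$-graded complex vector space $V=\coprod_{n\in\frac{\mathbb Z}{2}}V_{(n)}$ with a linear map $Y_V:V\otimes V\to V[[x,x^{-1}]]$ and a vacuum $\mathbf 1\in V_{(0)}$ such that: (i) $\dim V_{(n)}<\infty$ and $V_{(n)}=0$ for $n$ sufficiently negative; with $L_V(0)v=nv$ for $v\in V_{(n)}$, $[L_V(0),Y_V(v,x)]=x\frac{d}{dx}Y_V(v,x)+Y_V(L_V(0)v,x)$; (ii) $Y_V(\mathbf 1,x)=1_V$ and $\lim_{x\to0}Y_V(u,x)\mathbf 1=u$; (iii) with $L_V(-1)v=\lim_{x\to0}\frac{d}{dx}Y_V(v,x)\mathbf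 1$, $\frac{d}{dx}Y_V(v,x)=Y_V(L_V(-1)v,x)=[L_V(-1),Y_V(v,x)]$; (iv) duality: with $|u|=0$ for $u\in\coprod_{n\in\mathbb Z}V_{(n)}$ and $|u|=1$ for $u\in\coprod_{n\in\mathbb Z+\frac12}V_{(n)}$, for $v\in V$, $v'\in V'$ (graded dual) the series $\langle v',Y_V(u_1,z_1)Y_V(u_2,z_2)v\rangle$, $(-1)^{|u_1||u_2|}\langle v',Y_V(u_2,z_2)Y_V(u_1,z_1)v\rangle$, $\langle v',Y_V(Y_V(u_1,z_1-z_2)u_2,z_2)v\rangle$ converge absolutely in $|z_1|>|z_2|>0$, $|z_2|>|z_1|>0$, $|z_2|>|z_1-z_2|>0$, respectively, to a common rational function with only possible poles at $z_1=0,z_2=0,z_1=z_2$. An automorphism $g$ of $V$ is a weight-preserving invertible linear map with $gY_V(u,x)v=Y_V(gu,x)gv$. A generalized $g$-twisted $V$-module is a $\mathbb C\times\mathbb Z_2\times\mathbb C/\mathbb Z$-graded space $W=\coprod_{n\in\mathbb C,s\in\mathbb Z_2,\alpha\in P_W}W_{[n]}^{s;[\alpha]}$ (weight, fermion number, $g$-weight; $P_W\subset\{\alpha:0\le\Re(\alpha)<1\}$), $|w|=s$ for $w$ of fermion number $s$, with operators $L_W(0),L_W(-1)$, an action of $g$, and a linear map $Y_W^g:V\otimes W\to W\{x\}[\log x]$ such that, writing $(Y_W^g)^p(v,z)$ for the result of substituting $x^n=e^{nl_p(z)}$, $\log x=l_p(z)$: (1) $(Y_W^g)^{p+1}(gv,z)w=(Y_W^g)^p(v,z)w$;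 (2) $Y_W^g(\mathbf 1,x)w=w$; (3) duality: for $u,v\in V$, $w\in W$, $w'\in W'$ (graded dual) there is $f(z_1,z_2)=\sum_{i,j,k,l=0}^Na_{ijkl}z_1^{m_i}z_2^{n_j}(\log z_1)^k(\log z_2)^l(z_1-z_2)^{-t}$ ($m_i,n_j\in\mathbb C$, $t\in\mathbb Z_+$) such that for all $p\in\mathbb Z$ the series $\langle w',(Y_W^g)^p(u,z_1)(Y_W^g)^p(v,z_2)w\rangle$, $(-1)^{|u||v|}\langle w',(Y_W^g)^p(v,z_2)(Y_W^g)^p(u,z_1)w\rangle$, $\langle w',(Y_W^g)^p(Y_V(u,z_1-z_2)v,z_2)w\rangle$ converge absolutely in $|z_1|>|z_2|>0$, $|z_2|>|z_1|>0$, $|z_2|>|z_1-z_2|>0$, and their sums equal the branch $f^{p,p}$ (obtained with $z_i^{m}=e^{ml_p(z_i)}$, $\log z_i=l_p(z_i)$) in $|z_1|>|z_2|>0$, in $|z_2|>|z_1|>0$, and in $|z_2|>|z_1-z_2|>0$, $|\arg z_1-\arg z_2|<\frac\pi2$, respectively; (4) $L_W(0)-n$ is nilpotent on each element of $W_{[n]}$; $[L_W(0),Y_W^g(v,x)]=x\frac d{dx}Y_W^g(v,x)+Y_W^g(L_V(0)v,x)$; $g-e^{2\pi i\alpha}$ is nilpotent on each element of $W^{[\alpha]}$; $gY_W^g(u,x)w=Y_W^g(gu,x)gw$; $|Y_W^g(u,x)w|=|u|+|w|$; (5) $\frac d{dx}Y_W^g(v,x)=[L_W(-1),Y_W^g(v,x)]$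 (then also $=Y_W^g(L_V(-1)v,x)$). Here $W_{[n]}=\coprod_{s,\alpha}W_{[n]}^{s;[\alpha]}$ and $W^{[\alpha]}=\coprod_{n,s}W_{[n]}^{s;[\alpha]}$. It is lower-bounded if for some $B\in\mathbb R$, $W_{[n]}=0$ whenever $\Re(n)<B$. $V^{[\alpha]}$ is the generalized eigenspace of $g$ on $V$ with eigenvalue $e^{2\pi i\alpha}$, where $0\le\Re(\alpha)<1$. *)

(* Defs.v *)
From HB Require Import structures.
From mathcomp Require Import all_boot all_order all_algebra.
From mathcomp Require Import finmap.
From mathcomp Require Import all_classical all_reals all_analysis.
From mathcomp Require Export complex.
From mathcomp Require Import (canonicals, coercions) mpoly.

Set Implicit Arguments.
Unset Strict Implicit.
Unset Printing Implicit Defensive.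

Import Order.TTheory GRing.Theory Num.Theory ComplexField.Normc.

Local Open Scope classical_set_scope.
Local Open Scope ring_scope.
Local Open Scope complex_scope.

Section ComplexAnalysis.
Variable R : realType.
Implicit Types (z : R[i]) (p : int).

Definition cexp z : R[i] :=
  (expR (complex.Re z))%:C *
  (cos (complex.Im z) +i* sin (complex.Im z)).

(* The value for z = 0 is irrelevant. *)
Definition carg z : R :=
  xget 0 [set t : R | 0 <= t < 2 * pi /\ z = (normc z)%:C * cexp (0 +i* t)].

Definition lp p z : R[i] := ln (normc z) +i* (carg z + 2 * p%:~R * pi).

(* Unordered summation over an arbitrary index type; coefficients of series in
   complex powers of x are indexed by all of C. *)
Definition abs_convergent (I : choiceType) (a : I -> R[i]) : Prop :=
  summable [set: I] (fun i => (normc (a i))%:E).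

Definition sums_to (I : choiceType) (a : I -> R[i]) (S : R[i]) : Prop :=
  forall e : R, 0 < e -> exists A : {fset I}, forall B : {fset I},
    (A `<=` B)%fset -> normc (S - \sum_(i <- B) a i) < e.

Definition abs_sums_to (I : choiceType) (a : I -> R[i]) (S : R[i]) : Prop :=
  abs_convergent a /\ sums_to a S.

End ComplexAnalysis.

Section RationalFunctions.
Variables (R : realType) (k : nat).
Local Notation P := (mpoly.mpoly k R[i]).
Local Notation X i := (mpoly.mpolyX R[i] (mpoly.mnm1 i) : P).

(* Rational functions of z_1, ..., z_k whose only possible poles are z_i = 0
   and z_i = z_j. *)
Record ratfun := RatFun {
  rf_num : P;
  rf_exp0 : 'I_k -> nat;
  rf_exp : 'I_k -> 'I_k -> nat }.

Definition rf_den (f : ratfun) : P :=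
  (\prod_(i < k) X i ^+ rf_exp0 f i) *
  \prod_(i < k) \prod_(j < k | (i < j)%N) (X i - X j) ^+ rf_exp f i j.

Definition rf_eval (f : ratfun) (z : 'I_k -> R[i]) : R[i] :=
  mpoly.meval z (rf_num f) / mpoly.meval z (rf_den f).

Definition rf_frac (f : ratfun) : {fraction P} :=
  tofrac (rf_num f) / tofrac (rf_den f).

Definition pdivides (q a : P) : Prop := exists b : P, a = q * b.

(* The irreducible polynomial q defines the divisor; h <> 0 has valuation m
   along it. *)
Definition has_order (q : P) (h : {fraction P}) (m : int) : Prop :=
  exists a b : P, [/\ ~ pdivides q a, ~ pdivides q b &
    h = tofrac q ^ m * (tofrac a / tofrac b)].

(* The zero function has order +oo, hence satisfies this for every m. *)
Definition order_ge (q : P) (f : ratfun) (m : int) : Prop :=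
  forall m' : int, has_order q (rf_frac f) m' -> m <= m'.

Definition order_ge_at0 (i : 'I_k) := order_ge (X i).
Definition order_ge_at_diag (i j : 'I_k) := order_ge (X i - X j).

End RationalFunctions.

Section Gradings.
Variables (R : realType) (V : lmodType R[i]) (I : choiceType).
Implicit Type U : I -> set V.

Definition is_subspace (A : set V) : Prop :=
  A 0 /\ forall (a : R[i]) u v, A u -> A v -> A (a *: u + v).

(* The sum of the U i over the i satisfying Q. *)
Definition sum_of U (Q : I -> Prop) : set V :=
  [set v | exists (s : seq I) (x : I -> V),
    (forall i, i \in s -> Q i /\ U i (x i)) /\ v = \sum_(i <- s) x i].

Definition is_grading U : Prop :=
  [/\ forall i, is_subspace (U i),
      forall v, sum_of U (fun=> True) v &
      forall (s : seq I) (x : I -> V), uniq s ->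
        (forall i, i \in s -> U i (x i)) -> \sum_(i <- s) x i = 0 ->
        forall i, i \in s -> x i = 0].

Definition graded_dual U : set {scalar V} :=
  [set phi : {scalar V} | exists s : seq I,
    forall i, i \notin s -> forall v, U i v -> phi v = 0].

Definition findim (A : set V) : Prop :=
  exists (d : nat) (b : 'I_d -> V), forall v, A v ->
    exists c : 'I_d -> R[i], v = \sum_(i < d) c i *: b i.

End Gradings.

(* The generalized eigenspace. *)
Definition geneig (R : realType) (V : lmodType R[i]) (f : V -> V)
    (lambda : R[i]) : set V :=
  [set v | exists N : nat, iter N (fun u => f u - lambda *: u) v = 0].

Section FormalSeries.
Variables (R : realType) (V : lmodType R[i]).

(* The coefficient of x^n in a series in V[[x, x^{-1}]] is f n; d/dx and
   x d/dx act as follows. *)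
Definition zddx (f : int -> V) (n : int) : V := (n + 1)%:~R *: f (n + 1).
Definition zxddx (f : int -> V) (n : int) : V := n%:~R *: f n.

(* The coefficient of x^n (log x)^j in a series in V{x}[[log x]] is f n j;
   d/dx and x d/dx act as follows. *)
Definition cddx (f : R[i] -> nat -> V) (n : R[i]) (j : nat) : V :=
  (n + 1) *: f (n + 1) j + j.+1%:R *: f (n + 1) j.+1.
Definition cxddx (f : R[i] -> nat -> V) (n : R[i]) (j : nat) : V :=
  n *: f n j + j.+1%:R *: f n j.+1.

(* V{x}[log x]: the powers of log x are bounded. *)
Definition log_bounded (f : R[i] -> nat -> V) : Prop :=
  exists K : nat, forall n j, (K < j)%N -> f n j = 0.

(* The term of index n of the series obtained from f by x^n = e^{n l_p(z)},
   log x = l_p(z); the inner sum is finite when f is in V{x}[log x]. *)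
Definition subst_term (f : R[i] -> nat -> V) (p : int) (z : R[i]) (n : R[i]) :
    V :=
  \sum_(j \in [set: nat]) (cexp (n * lp p z) * lp p z ^+ j) *: f n j.

End FormalSeries.

(* V_(n), n in Z/2, is vgr (2n); YV u v n is the coefficient of x^n, not of
   x^{-n-1}, in Y_V(u,x)v. *)
Record gr_vertex_superalgebra (R : realType) := GRVertexSuperalgebra {
  vcar :> lmodType R[i];
  vgr : int -> set vcar;
  YV : vcar -> vcar -> int -> vcar;
  vac : vcar;
  LV0 : {linear vcar -> vcar};
  LVm1 : vcar -> vcar := fun v => zddx (YV v vac) 0;
  vparity : bool -> set vcar :=
    fun s => sum_of vgr (fun n => s = ~~ (2 %| n)%Z);

  vgr_grading : is_grading vgr;
  YV_linearl : forall v n, linear (fun u => YV u v n);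
  YV_linearr : forall u n, linear (fun v => YV u v n);
  vac_wt0 : vgr 0 vac;
  vgr_findim : forall n, findim (vgr n);
  vgr_bounded : exists B : int, forall n, n < B ->
    forall v, vgr n v -> v = 0;
  LV0_def : forall n v, vgr n v -> LV0 v = (n%:~R / 2) *: v;
  LV0_comm : forall u v n,
    LV0 (YV u v n) - YV u (LV0 v) n = zxddx (YV u v) n + YV (LV0 u) v n;
  YV_vacl : forall v n, YV vac v n = if n == 0 then v else 0;
  YV_vacr : forall u, YV u vac 0 = u /\ forall n, n < 0 -> YV u vac n = 0;
  YV_deriv : forall u v n, zddx (YV u v) n = YV (LVm1 u) v n;
  LVm1_comm : forall u v n,
    zddx (YV u v) n = LVm1 (YV u v n) - YV u (LVm1 v) n;
  YV_duality : forall (s1 s2 : bool) u1 u2 v (v' : {scalar vcar}),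
    vparity s1 u1 -> vparity s2 u2 -> graded_dual vgr v' ->
    exists f : ratfun R 2, forall z1 z2 : R[i],
      let fz := rf_eval f (fun i => if i == ord0 then z1 else z2) in
      [/\ 0 < normc z2 < normc z1 ->
            abs_sums_to (fun n : int * int =>
              v' (YV u1 (YV u2 v n.2) n.1) * z1 ^ n.1 * z2 ^ n.2) fz,
          0 < normc z1 < normc z2 ->
            abs_sums_to (fun n : int * int => (-1) ^+ (s1 && s2) *
              (v' (YV u2 (YV u1 v n.1) n.2) * z1 ^ n.1 * z2 ^ n.2)) fz &
          0 < normc (z1 - z2) < normc z2 ->
            abs_sums_to (fun n : int * int =>
              v' (YV (YV u1 u2 n.1) v n.2) * (z1 - z2) ^ n.1 * z2 ^ n.2) fz]
}.

Record vautomorphism (R : realType) (V : gr_vertex_superalgebra R) :=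
  VAutomorphism {
  vaut :> {linear V -> V};
  vaut_bij : bijective vaut;
  vaut_wt : forall n v, vgr n v -> vgr n (vaut v);
  vaut_Y : forall u v n, vaut (YV u v n) = YV (vaut u) (vaut v) n
}.

Definition alpha_range (R : realType) (alpha : R[i]) : Prop :=
  0 <= complex.Re alpha < 1.

Definition eigenval (R : realType) (alpha : R[i]) : R[i] :=
  cexp ((0 +i* (2 * pi)) * alpha).

(* The branch f^{p,p}(z1, z2) of
   \sum a_ijkl z1^{m_i} z2^{n_j} (log z1)^k (log z2)^l (z1 - z2)^{-t}. *)
Definition dual_branch (R : realType) (N : nat)
    (a : 'I_N.+1 -> 'I_N.+1 -> 'I_N.+1 -> 'I_N.+1 -> R[i])
    (m n : 'I_N.+1 -> R[i]) (t : nat) (p : int) (z1 z2 : R[i]) : R[i] :=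
  \sum_i \sum_j \sum_k \sum_l
    a i j k l * cexp (m i * lp p z1) * cexp (n j * lp p z2) *
    lp p z1 ^+ k * lp p z2 ^+ l * (z1 - z2) ^- t.

(* W_{[n]}^{s;[alpha]} is wgr (n, s, alpha), the class [alpha] in C/Z being
   represented by alpha with 0 <= Re alpha < 1; YW v w n j is the coefficient
   of x^n (log x)^j in Y_W^g(v,x)w. *)
Record gtwisted_module (R : realType) (V : gr_vertex_superalgebra R)
    (g : vautomorphism V) := GTwistedModule {
  wcar :> lmodType R[i];
  wgr : R[i] * bool * R[i] -> set wcar;
  YW : V -> wcar -> R[i] -> nat -> wcar;
  LW0 : {linear wcar -> wcar};
  LWm1 : {linear wcar -> wcar};
  gW : {linear wcar -> wcar};
  wweight : R[i] -> set wcar := fun n => sum_of wgr (fun x => x.1.1 = n);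
  wparity : bool -> set wcar := fun s => sum_of wgr (fun x => x.1.2 = s);
  wgweight : R[i] -> set wcar := fun alpha => sum_of wgr (fun x => x.2 = alpha);
  wdual : set {scalar wcar} := graded_dual wgr;

  wgr_grading : is_grading wgr;
  wgr_range : forall n s alpha, ~ alpha_range alpha ->
    forall w, wgr (n, s, alpha) w -> w = 0;
  gW_bij : bijective gW;
  YW_linearl : forall w n j, linear (fun v => YW v w n j);
  YW_linearr : forall v n j, linear (fun w => YW v w n j);
  YW_log : forall v w, log_bounded (YW v w);

  (* An equality in the completion of W, tested against W'; each sum has
     finite support by the grading axioms. *)
  YW_equivariance : forall p v z w w', z != 0 -> wdual w' ->
    \sum_(n \in [set: R[i]]) w' (subst_term (YW (g v) w) (p + 1) z n) =
    \sum_(n \in [set: R[i]]) w' (subst_term (YW v w) p z n);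
  YW_vac : forall w n j,
    YW (vac V) w n j = if (n == 0) && (j == 0)%N then w else 0;
  YW_duality : forall (s1 s2 : bool) (u v : V) w w',
    vparity s1 u -> vparity s2 v -> wdual w' ->
    exists N (a : 'I_N.+1 -> 'I_N.+1 -> 'I_N.+1 -> 'I_N.+1 -> R[i])
      (m n : 'I_N.+1 -> R[i]) (t : nat), (0 < t)%N /\
    forall (p : int) (z1 z2 : R[i]),
      let fz := dual_branch a m n t p z1 z2 in
      let iterate (x : int * R[i]) :=
        w' (subst_term (YW (YV u v x.1) w) p z2 x.2) * (z1 - z2) ^ x.1 in
      [/\ 0 < normc z2 < normc z1 ->
            abs_sums_to (fun x : R[i] * R[i] =>
              w' (subst_term (YW u (subst_term (YW v w) p z2 x.2)) p z1 x.1))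
              fz,
          0 < normc z1 < normc z2 ->
            abs_sums_to (fun x : R[i] * R[i] => (-1) ^+ (s1 && s2) *
              w' (subst_term (YW v (subst_term (YW u w) p z1 x.1)) p z2 x.2))
              fz,
          0 < normc (z1 - z2) < normc z2 -> abs_convergent iterate &
          0 < normc (z1 - z2) < normc z2 ->
            `|carg z1 - carg z2| < pi / 2 -> sums_to iterate fz];
  LW0_nilp : forall n w, wweight n w -> geneig LW0 n w;
  LW0_comm : forall v w n j,
    LW0 (YW v w n j) - YW v (LW0 w) n j =
    cxddx (YW v w) n j + YW (LV0 V v) w n j;
  gW_nilp : forall alpha w, wgweight alpha w -> geneig gW (eigenval alpha) w;
  gW_Y : forall u w n j, gW (YW u w n j) = YW (g u) (gW w) n j;
  YW_parity : forall s t u w n j, vparity s u -> wparity t w ->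
    wparity (s (+) t) (YW u w n j);
  LWm1_comm : forall v w n j,
    cddx (YW v w) n j = LWm1 (YW v w n j) - YW v (LWm1 w) n j
}.

Definition lower_bounded (R : realType) (V : gr_vertex_superalgebra R)
    (g : vautomorphism V) (W : gtwisted_module g) : Prop :=
  exists B : R, forall n : R[i], complex.Re n < B ->
    forall w : W, wweight n w -> w = 0.

Section Products.
Variables (R : realType) (V : gr_vertex_superalgebra R).
Variables (g : vautomorphism V) (W : gtwisted_module g) (k : nat).

(* V^{[alpha]}, for 0 <= Re alpha < 1. *)
Definition vgweight (alpha : R[i]) : set V := geneig g (eigenval alpha).

Definition product_region (z : 'I_k -> R[i]) : Prop :=
  (forall i, z i != 0) /\
  forall i j : 'I_k, (i < j)%N -> normc (z j) < normc (z i).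

(* The term of <w', Y^p(v_1, z_1) ... Y^p(v_k, z_k) w> in which the power of
   x_i is n_i. *)
Definition product_term (w' : {scalar W}) (p : int) (v : 'I_k -> V)
    (z : 'I_k -> R[i]) (w : W) (n : {ffun 'I_k -> R[i]}) : R[i] :=
  w' (foldr (fun i u => subst_term (YW (v i) u) p (z i) (n i)) w (enum 'I_k)).

Definition product_branch (N : nat) (f : {ffun 'I_k -> 'I_N.+1} -> ratfun R k)
    (alpha : 'I_k -> R[i]) (p : int) (z : 'I_k -> R[i]) : R[i] :=
  \sum_(n : {ffun 'I_k -> 'I_N.+1})
    rf_eval (f n) z * (\prod_(i < k) cexp (- alpha i * lp p (z i))) *
    \prod_(i < k) lp p (z i) ^+ n i.

End Products.

(* Main.v *)
Require Import Defs.
From HB Require Import structures.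
From mathcomp Require Import all_boot all_order all_algebra.
From mathcomp Require Import finmap.
From mathcomp Require Import all_classical all_reals all_analysis.
From mathcomp Require Import (canonicals, coercions) mpoly.
From mathcomp Require Import ring lra zify.

Set Implicit Arguments.
Unset Strict Implicit.
Unset Printing Implicit Defensive.

Import Order.TTheory GRing.Theory Num.Theory ComplexField.Normc.

Local Open Scope classical_set_scope.
Local Open Scope ring_scope.
Local Open Scope complex_scope.

(** Write Y for the twisted vertex operator map.  Expand every factor Y(v_i,x_i)
into modes, the coefficients of x_i^n (log x_i)^j.

Equivariance says that one turn of x around the origin acts on the modes of v as
the inverse of g acts on v.  Since g - e^{2 pi i alpha} is nilpotent on v, only
exponents in -alpha + Z and boundedly many powers of log x occur ([YW_class],
[YW_logdeg]).  Hence for each choice of powers of the logarithms the product is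
z_1^{-alpha_1} ... z_k^{-alpha_k} times a series in integral powers, and it is
enough to show that this series expands a rational function.

The main step is weak commutativity: a power (x_1 - x_2)^M depending only on u
and v annihilates the supercommutator of Y(u,x_1) and Y(v,x_2)
([weak_commutation]).  A functional supported on one graded piece sees a single
antidiagonal of modes, so that one may put z_2 = 1 and z_1 = e^r with r real.
Duality then provides a function G(r), an exponential polynomial divided by a
power of e^r - 1, with one order of the operators as its expansion for r > 0 and
the other as its expansion for r < 0.  The asymptotics of an exponential
polynomial determine its coefficients ([epoly_decay]); thus the two expansions
agree after multiplication by a large power of e^r - 1 ([two_sided_unique]).  The
power can be lowered one by one as long as it exceeds the order of the pole of G
at r = 0 ([expansion_comparison]), and the expansion of the iterate
Y(Y_V(u,z_1-z_2)v,z_2) bounds that order by the truncation of Y_V(u,x)v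
([diagonal_bound]).  Near z_1 = z_2 duality only gives the branch in which both
logarithms agree, which would not control products of powers of two different
logarithms.  This is why modes with logarithms are first written as modes without
logarithms of other vectors, combinations of the g^q u ([log_mode]).

Multiply the product of all the factors by the (x_a - x_b)^{N_ab}, a < b.  Then
each factor Y(v_i,x_i) can be moved next to w, so that the exponents of x_i are
bounded below in terms of v_i and w only ([lowb_Yprod]); the total degree is
bounded above because w' sees finitely many weights ([Yprod_filt]).  What remains
is a Laurent polynomial.  Dividing by one factor x_a - x_b at a time amounts to a
geometric series in z_b / z_a, which gives absolute convergence and the sum in
|z_1| > ... > |z_k| > 0 ([abs_conv_div], [sums_foldmul]).  The orders at z_i = 0
and z_i = z_j are read off from the exponents of the Laurent polynomial and from
the N_ij ([laurent_order0], [laurent_order_diag]). *)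

(** * Complex exponentials and logarithms *)

Section ComplexExp.
Variable R : realType.
Implicit Types (z w : R[i]) (p : int) (x y : R).

Lemma cexpE x y : cexp (x +i* y) = (expR x * cos y) +i* (expR x * sin y).
Proof. by rewrite /cexp /=; simpc. Qed.

Lemma cexpD z w : cexp (z + w) = cexp z * cexp w.
Proof.
case: z w => [a b] [c d]; rewrite [(_ +i* _) + _]/= !cexpE; simpc.
rewrite expRD cosD sinD; congr (_ +i* _); ring.
Qed.

Lemma cexp0 : cexp 0 = 1 :> R[i].
Proof.
have -> : 0 = (0 : R) +i* 0 :> R[i] by [].
by rewrite cexpE expR0 cos0 sin0 mulr1 mulr0.
Qed.

Lemma cexp_real x : cexp x%:C = (expR x)%:C.
Proof. by rewrite cexpE cos0 sin0 mulr1 mulr0. Qed.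

Lemma normc_cexp z : normc (cexp z) = expR (complex.Re z).
Proof.
case: z => a b; rewrite cexpE /= !exprMn -mulrDr cos2Dsin2 mulr1 sqrtr_sqr.
by rewrite ger0_norm ?expR_ge0.
Qed.

Lemma cexp_neq0 z : cexp z != 0.
Proof.
apply/eqP => /(congr1 (@normc R)); rewrite normc_cexp normc0 => /eqP.
by rewrite expR_eq0.
Qed.

Lemma cexpN z : cexp (- z) = (cexp z)^-1.
Proof. by apply: (mulfI (cexp_neq0 z)); rewrite -cexpD subrr cexp0 divff ?cexp_neq0. Qed.

Lemma cexpMn z n : cexp (n%:R * z) = cexp z ^+ n.
Proof.
elim: n => [|n IH]; first by rewrite mul0r cexp0.
by rewrite -add1n natrD mulrDl mul1r cexpD IH exprS.
Qed.

Lemma cexpMz z p : cexp (p%:~R * z) = cexp z ^ p.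
Proof.
case: p => n; first by rewrite cexpMn.
by rewrite NegzE mulrNz mulNr cexpN cexpMn -exprnN.
Qed.

Lemma cos_eq1 (t : R) : 0 <= t < 2 * pi -> cos t = 1 -> t = 0.
Proof.
move=> /andP[t0 t2] c1; apply/eqP/negPn/negP => tn0.
have tE : t = (t / 2) *+ 2 by rewrite -mulr_natr divfK.
have := c1; rewrite tE cos_mulr2n.
have : 0 < sin (t / 2).
  have t1 : 0 < t by rewrite lt_neqAle eq_sym tn0.
  by apply: sin_gt0_pi; rewrite divr_gt0 //= ltr_pdivrMr // mulrC.
have := cos2Dsin2 (t / 2).
set c := cos _; set s := sin _ => h s0; nra.
Qed.

Lemma cexp_2pi p : cexp (p%:~R * (0 +i* (2 * pi))) = 1 :> R[i].
Proof.
rewrite cexpMz cexpE expR0 !mul1r mulr_natl cos2pi sin2pi.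
by rewrite exp1rz.
Qed.

Lemma cexp_eq1 z : cexp z = 1 -> exists p : int, z = p%:~R * (0 +i* (2 * pi)).
Proof.
case: z => a b h.
have a0 : a = 0.
  by have := normc_cexp (a +i* b); rewrite h normc1 /= => /esym/eqP; rewrite -expR0 => /eqP/expR_inj.
have pi2 : 0 < 2 * pi :> R by rewrite mulr_gt0 ?pi_gt0.
pose n := Num.floor (b / (2 * pi)); exists n.
have hb : 0 <= b - n%:~R * (2 * pi) < 2 * pi.
  have := Num.Theory.floor_itv (b / (2 * pi)); rewrite -/n => /andP[h1 h2].
  rewrite subr_ge0 -ler_pdivlMr // h1 /= ltrBlDr -[X in X + _]mul1r -mulrDl -ltr_pdivrMr //.
  by rewrite addrC -[1]/(1%:~R) -intrD.
have := cexpD (a +i* b) (- (n%:~R * (0 +i* (2 * pi)))).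
rewrite h mul1r cexpN cexp_2pi invr1 a0.
have -> : (n%:~R : R[i]) = (n%:~R : R)%:C by rewrite rmorph_int.
simpc; rewrite cexpE expR0 !mul1r => -[/cos_eq1 c1 _].
by move/eqP: (c1 hb); rewrite subr_eq0 => /eqP ->.
Qed.

Lemma unit_circle_angle x y : x ^+ 2 + y ^+ 2 = 1 ->
  exists t, [/\ 0 <= t < 2 * pi, cos t = x & sin t = y].
Proof.
move=> h; have hx : -1 <= x <= 1 by apply/andP; split; nra.
have ac0 := acos_ge0 hx; have acpi := acos_lepi hx; have p0 := pi_gt0 R.
have ca : cos (acos x) = x by apply: acosK; rewrite in_itv.
have sa : sin (acos x) = `|y|.
  by rewrite sin_acos // -sqrtr_sqr; congr Num.sqrt; rewrite -h addrC addKr.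
have [y0|y0] := leP 0 y.
  exists (acos x); rewrite ca sa ger0_norm //; split=> //; lra.
exists (pi *+ 2 - acos x); rewrite cosB sinB cos2pi sin2pi ca sa ltr0_norm //.
split; [|ring|ring].
have : acos x != 0.
  by apply/eqP => a0; move: sa; rewrite a0 sin0 => /esym/eqP; rewrite normr_eq0 lt_eqF.
rewrite neq_lt ltNge ac0 /= => a0; rewrite mulr2n; lra.
Qed.

Lemma normc_eq0 z : (normc z == 0) = (z == 0).
Proof. by apply/eqP/eqP => [/eq0_normc //|->]; rewrite normc0. Qed.

Lemma normc_ge0 z : 0 <= normc z.
Proof. by case: z => a b; rewrite /= sqrtr_ge0. Qed.

Lemma normc_gt0 z : (0 < normc z) = (z != 0).
Proof. by rewrite lt_def normc_eq0 normc_ge0 andbT. Qed.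

Lemma normc_real x : normc x%:C = `|x|.
Proof. by rewrite /= expr0n addr0 sqrtr_sqr. Qed.

Lemma cargP z : z != 0 ->
  0 <= carg z < 2 * pi /\ z = (normc z)%:C * cexp (0 +i* carg z).
Proof.
move=> z0; rewrite /carg; case: xgetP => [t -> []//|] /(_ _)/not_andP H; exfalso.
have n0 : normc z != 0 by rewrite normc_eq0.
case: z z0 n0 H => a b z0 n0 H.
have sq : (normc (a +i* b)) ^+ 2 = a ^+ 2 + b ^+ 2.
  by rewrite /= sqr_sqrtr // addr_ge0 ?sqr_ge0.
have [|t [t1 ct st]] := @unit_circle_angle (a / normc (a +i* b)) (b / normc (a +i* b)).
  by rewrite !exprMn -mulrDl -sq exprVn divff // expf_neq0.
case: (H t) => [//|]; apply.
rewrite cexpE expR0 ct st !mul1r; simpc.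
by rewrite mulrCA divff // mulr1 mulrCA divff // mulr1.
Qed.

Lemma cexp_lp p z : z != 0 -> cexp (lp p z) = z.
Proof.
move=> z0; have [_ {2}->] := cargP z0.
have -> : lp p z = (ln (normc z))%:C + (0 +i* carg z) + p%:~R * (0 +i* (2 * pi)).
  rewrite /lp; have -> : (p%:~R : R[i]) = (p%:~R : R)%:C by rewrite rmorph_int.
  simpc; congr (_ +i* _); ring.
rewrite !cexpD cexp_2pi mulr1 cexp_real lnK // posrE.
by rewrite normc_gt0.
Qed.

Lemma carg_pos x : 0 < x -> carg x%:C = 0.
Proof.
move=> x0; have [|t1] := @cargP x%:C; first by rewrite eq_complex /= eqxx andbT gt_eqF.
rewrite normc_real gtr0_norm // cexpE expR0 !mul1r; simpc => -[c1 _].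
apply: cos_eq1 => //; apply: (mulfI (lt0r_neq0 x0)); by rewrite mulr1.
Qed.

Lemma lp_pos p x : 0 < x -> lp p x%:C = (ln x)%:C + p%:~R * (0 +i* (2 * pi)).
Proof.
move=> x0; rewrite /lp carg_pos // normc_real gtr0_norm //.
have -> : (p%:~R : R[i]) = (p%:~R : R)%:C by rewrite rmorph_int.
simpc; congr (_ +i* _); ring.
Qed.

Lemma normcX z n : normc (z ^+ n) = normc z ^+ n.
Proof. by elim: n => [|n IH]; rewrite ?normc1 // !exprS normcM IH. Qed.

Lemma normcXz z p : normc (z ^ p) = normc z ^ p.
Proof. by case: p => n; rewrite ?NegzE -?exprnN ?normcV ?normcX // -exprnP normcX. Qed.

Lemma normc_sum (I : Type) (s : seq I) (P : pred I) (F : I -> R[i]) :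
  normc (\sum_(i <- s | P i) F i) <= \sum_(i <- s | P i) normc (F i).
Proof.
elim/big_rec2: _ => [|i y1 y2 _ h]; first by rewrite normc0.
by apply: (le_trans (le_normcD _ _)); rewrite lerD2l.
Qed.

Lemma normc_distC z w : normc (z - w) = normc (w - z).
Proof. by rewrite -normcN opprB. Qed.

End ComplexExp.

(** * Unordered sums *)

Section UnorderedSums.
Variables (R : realType).
Implicit Types (I J : choiceType).

(** All estimates are made on finite sums; this is the form of absolute convergence
that they use. *)
Lemma abs_convP I (a : I -> R[i]) : abs_convergent a <->
  exists C : R, forall A : {fset I}, \sum_(i <- A) normc (a i) <= C.
Proof.
have key (A : {fset I}) : (\sum_(i \in [set` A]) `|(normc (a i))%:E|)%E =
    (\sum_(i <- A) normc (a i))%:E.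
  rewrite -sumEFin -fsbig_seq ?fset_uniq //.
  by apply: eq_bigr => i _; rewrite gee0_abs // lee_fin normc_ge0.
split=> [|[C hC]].
  rewrite /abs_convergent summableE => /fineK h.
  exists (fine (\esum_(x in [set: I]) `|(normc (a x))%:E|)%E) => A.
  rewrite -lee_fin h -key; apply: ereal_sup_ubound; exists [set` A] => //.
suff h : (\esum_(x in [set: I]) `|(normc (a x))%:E| <= C%:E)%E by exact: le_lt_trans h (ltry C).
apply: ge_ereal_sup => _ [A [finA _] <-].
have /finite_fsetP[B ->] := finA.
by rewrite key lee_fin.
Qed.

Lemma sums_to_ext I (a b : I -> R[i]) S : (forall i, a i = b i) -> sums_to a S -> sums_to b S.
Proof. by move=> /funext ->. Qed.

Lemma abs_conv_ext I (a b : I -> R[i]) : (forall i, a i = b i) ->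
  abs_convergent a -> abs_convergent b.
Proof. by move=> /funext ->. Qed.

Lemma fsum_le I (f : I -> R) (A B : {fset I}) : (forall i, 0 <= f i) ->
  (A `<=` B)%fset -> \sum_(i <- A) f i <= \sum_(i <- B) f i.
Proof.
move=> f0 AB; rewrite [leRHS](big_fsetID _ (mem A)) /=.
have -> : [fset x in B | x \in A]%fset = A.
  by apply/fsetP => x; rewrite !inE andbC; have [/(fsubsetP AB)->|//] := boolP (x \in A).
by rewrite lerDl sumr_ge0.
Qed.

Lemma abs_conv_le I (a b : I -> R[i]) (K : R) :
  (forall i, normc (a i) <= K * normc (b i)) -> abs_convergent b -> abs_convergent a.
Proof.
move=> ab /abs_convP[C hC]; apply/abs_convP; exists (`|K| * C) => A.
apply: (le_trans (ler_sum _ (fun i _ => ab i))).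
rewrite -mulr_sumr; apply: (@le_trans _ _ (`|K| * \sum_(i <- A) normc (b i))).
  by apply: ler_wpM2r; rewrite ?ler_norm // sumr_ge0 // => i _; apply: normc_ge0.
exact: ler_wpM2l.
Qed.

Lemma abs_convD I (a b : I -> R[i]) : abs_convergent a -> abs_convergent b ->
  abs_convergent (fun i => a i + b i).
Proof.
move=> /abs_convP[C hC] /abs_convP[D hD]; apply/abs_convP; exists (C + D) => A.
apply: (le_trans (ler_sum _ (fun i _ => le_normcD _ _))).
by rewrite big_split lerD.
Qed.

Lemma abs_convZ I (a : I -> R[i]) (k : R[i]) : abs_convergent a ->
  abs_convergent (fun i => k * a i).
Proof. by apply: (@abs_conv_le _ _ _ (normc k)) => i; rewrite normcM. Qed.

Lemma abs_conv0 I : abs_convergent (fun _ : I => 0 : R[i]).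
Proof. by apply/abs_convP; exists 0 => A; rewrite big1 // => i _; rewrite normc0. Qed.

Lemma abs_conv_sum I (T : Type) (s : seq T) (P : pred T) (a : T -> I -> R[i]) :
  (forall t, P t -> abs_convergent (a t)) -> abs_convergent (fun i => \sum_(t <- s | P t) a t i).
Proof.
move=> h; elim: s => [|t s IH].
  by apply: abs_conv_ext (@abs_conv0 I) => i; rewrite big_nil.
have [Pt|Pt] := boolP (P t).
  by apply: abs_conv_ext (abs_convD (h _ Pt) IH) => i; rewrite big_cons Pt.
by apply: abs_conv_ext IH => i; rewrite big_cons (negPf Pt).
Qed.

Lemma sums_to_uniq I (a : I -> R[i]) S T : sums_to a S -> sums_to a T -> S = T.
Proof.
move=> hS hT; apply/eqP; rewrite -subr_eq0 -normc_eq0 eq_le normc_ge0 andbT.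
apply/ler_addgt0Pr => e e0; have e2 : 0 < e / 2 by lra.
have [A hA] := hS _ e2; have [B hB] := hT _ e2.
have {hA} := hA _ (fsubsetUl A B); have {hB} := hB _ (fsubsetUr A B).
set X := \sum_(i <- _) _ => h1 h2.
have -> : S - T = (S - X) + (X - T) by ring.
rewrite add0r; apply: (le_trans (le_normcD _ _)).
rewrite [normc (X - T)]normc_distC; lra.
Qed.

Lemma sums_toD I (a b : I -> R[i]) S T : sums_to a S -> sums_to b T ->
  sums_to (fun i => a i + b i) (S + T).
Proof.
move=> hS hT e e0; have e2 : 0 < e / 2 by lra.
have [A hA] := hS _ e2; have [B hB] := hT _ e2.
exists (A `|` B)%fset => D; rewrite fsubUset => /andP[AD BD].
rewrite big_split /=; have {hA} := hA _ AD; have {hB} := hB _ BD.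
set X := \sum_(i <- _) _; set Y := \sum_(i <- _) _ => h1 h2.
have -> : S + T - (Y + X) = (S - Y) + (T - X) by ring.
apply: (le_lt_trans (le_normcD _ _)); lra.
Qed.

Lemma sums_toZ I (a : I -> R[i]) S k : sums_to a S ->
  sums_to (fun i => k * a i) (k * S).
Proof.
move=> hS e e0; have k1 : 0 < normc k + 1 by rewrite ltr_wpDl ?normc_ge0.
have [A hA] := hS _ (divr_gt0 e0 k1).
exists A => B /hA; rewrite -mulr_sumr -mulrBr normcM ltr_pdivlMr // => h.
apply: le_lt_trans h; rewrite mulrC; apply: ler_wpM2l; rewrite ?normc_ge0 //; lra.
Qed.

Lemma sums_to0 I : sums_to (fun _ : I => 0 : R[i]) 0.
Proof. by move=> e e0; exists fset0 => B _; rewrite big1 // subrr normc0. Qed.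

Lemma sums_to_sum I (T : Type) (s : seq T) (P : pred T) (a : T -> I -> R[i]) (S : T -> R[i]) :
  (forall t, P t -> sums_to (a t) (S t)) ->
  sums_to (fun i => \sum_(t <- s | P t) a t i) (\sum_(t <- s | P t) S t).
Proof.
move=> h; elim: s => [|t s IH].
  by rewrite big_nil; apply: sums_to_ext (@sums_to0 I) => i; rewrite big_nil.
rewrite big_cons; have [Pt|Pt] := boolP (P t).
  by apply: sums_to_ext (sums_toD (h _ Pt) IH) => i; rewrite big_cons Pt.
by apply: sums_to_ext IH => i; rewrite big_cons (negPf Pt).
Qed.

Lemma sums_to_bound I (a : I -> R[i]) S C : sums_to a S ->
  (forall A : {fset I}, \sum_(i <- A) normc (a i) <= C) -> normc S <= C.
Proof.
move=> hS hC; apply/ler_addgt0Pr => e e0; have [A /(_ A (fsubset_refl A)) hA] := hS _ e0.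
have -> : S = \sum_(i <- A) a i + (S - \sum_(i <- A) a i) by ring.
apply: (le_trans (le_normcD _ _)); apply: lerD (ltW hA).
exact: le_trans (normc_sum _ _ _) (hC A).
Qed.

Lemma nonneg_sums_to I (f : I -> R) C : (forall i, 0 <= f i) ->
  (forall A : {fset I}, \sum_(i <- A) f i <= C) ->
  exists S, sums_to (fun i => (f i)%:C) S.
Proof.
move=> f0 hC; pose E := [set \sum_(i <- A) f i | A in [set: {fset I}]].
have supE : has_sup E.
  split; first by exists (\sum_(i <- (fset0 : {fset I})) f i); exists fset0.
  by exists C => _ [A _ <-].
exists (sup E)%:C => e e0.
have [_ [A _ <-] hA] := sup_adherent e0 supE.
exists A => B AB; rewrite -rmorph_sum -rmorphB normc_real.
have h1 := fsum_le f0 AB.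
have h2 : \sum_(i <- B) f i <= sup E by apply: ub_le_sup; [exact: supE.2|exists B].
rewrite ger0_norm; lra.
Qed.

Lemma Im_le_normc (z : R[i]) : `|complex.Im z| <= normc z.
Proof. by case: z => a b /=; rewrite -sqrtr_sqr ler_wsqrtr // lerDr sqr_ge0. Qed.

Lemma Re_le_normc (z : R[i]) : `|complex.Re z| <= normc z.
Proof. by case: z => a b /=; rewrite -sqrtr_sqr ler_wsqrtr // lerDl sqr_ge0. Qed.

(** The real and imaginary parts are differences of nonnegative families, whose sums
are suprema of finite sums. *)
Lemma abs_conv_sums_to I (a : I -> R[i]) : abs_convergent a -> exists S, sums_to a S.
Proof.
move=> /abs_convP[C hC].
have real (f : I -> R) : (forall i, `|f i| <= normc (a i)) ->
    exists S, sums_to (fun i => (f i)%:C) S.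
  move=> fa.
  have [||S hS] := @nonneg_sums_to I (fun i => normc (a i) + f i) (C + C).
  - by move=> i; have := fa i; rewrite ler_norml => /andP[]; lra.
  - move=> A; rewrite big_split lerD //; apply: le_trans (hC A).
    by apply: ler_sum => i _; apply: le_trans (fa i); apply: ler_norm.
  have [|T hT] := @nonneg_sums_to I (fun i => normc (a i)) C _ hC.
    by move=> i; apply: normc_ge0.
  exists (S + (-1) * T); apply: sums_to_ext (sums_toD hS (sums_toZ _ hT)) => i.
  by rewrite rmorphD /=; ring.
have [S hS] := real _ (fun i => Re_le_normc (a i)).
have [T hT] := real _ (fun i => Im_le_normc (a i)).
exists (S + 'i%C * T); apply: sums_to_ext (sums_toD hS (sums_toZ _ hT)) => i.
by rewrite -complexE.
Qed.

Lemma sum_preim I J (h : J -> I) (a : I -> R[i]) (B : {fset I}) (hB : {fset J}) :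
  injective h -> (forall i, (forall j, i <> h j) -> a i = 0) ->
  (forall j, (j \in hB) = (h j \in B)) ->
  \sum_(i <- B) a i = \sum_(j <- hB) a (h j).
Proof.
move=> hi a0 hBE.
rewrite -(@big_fset_incl _ _ _ _ [fset h j | j in hB]%fset B).
- by rewrite big_imfset //= => j1 j2 _ _ /hi.
- by apply/fsubsetP => _ /imfsetP[j /= jB ->]; rewrite -hBE.
move=> i iB /negP iN; apply: a0 => j ij; apply: iN.
by apply/imfsetP; exists j => //=; rewrite hBE -ij.
Qed.

Lemma preim_fset I J (h : J -> I) (B : {fset I}) : injective h ->
  exists hB : {fset J}, forall j, (j \in hB) = (h j \in B).
Proof.
move=> hi; pose k i := if pselect (exists j, h j = i) is left e then Some (xget (projT1 (cid e)) [set j | h j = i]) else None.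
have kE j : k (h j) = Some j.
  rewrite /k; case: pselect => [e|[]]; last by exists j.
  case: xgetP => [x -> /= /hi -> //|/(_ j)]; by case.
exists [fset j in pmap k B]%fset => j; rewrite !inE mem_pmap.
apply/mapP/idP => [[i iB]|jB]; last by exists (h j); rewrite // kE.
rewrite /k; case: pselect => // e [].
case: xgetP => [x -> /= hx ->|/(_ (projT1 (cid e)))]; first by rewrite hx.
by case; case: (cid e).
Qed.

(** The passage from exponents in C to exponents in Z: h lists the exponents that can
occur. *)
Lemma sums_to_preim I J (h : J -> I) (a : I -> R[i]) S :
  injective h -> (forall i, (forall j, i <> h j) -> a i = 0) ->
  sums_to a S <-> sums_to (fun j => a (h j)) S.
Proof.
move=> hi a0; split=> H e e0; have [A hA] := H _ e0.
  have [hAA hAE] := preim_fset A hi; exists hAA => B AB.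
  rewrite -(@sum_preim _ _ h a (A `|` [fset h j | j in B])%fset) ?hA ?fsubsetUl //.
  move=> j; rewrite inE -hAE; apply/idP/orP => [jB|[/(fsubsetP AB)//|]].
    by right; apply/imfsetP; exists j.
  by move=> /imfsetP[x /= xB /hi ->].
exists [fset h j | j in A]%fset => B AB; have [hB hBE] := preim_fset B hi.
rewrite (sum_preim hi a0 hBE); apply: hA; apply/fsubsetP => j jA.
by rewrite hBE (fsubsetP AB) //; apply/imfsetP; exists j.
Qed.

Lemma abs_conv_preim I J (h : J -> I) (a : I -> R[i]) :
  injective h -> (forall i, (forall j, i <> h j) -> a i = 0) ->
  abs_convergent a <-> abs_convergent (fun j => a (h j)).
Proof.
move=> hi a0; have a0' i : (forall j, i <> h j) -> (normc (a i))%:C = 0.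
  by move=> /a0 ->; rewrite normc0.
split=> /abs_convP[C hC]; apply/abs_convP; exists C => B.
  apply: le_trans (hC [fset h j | j in B]%fset).
  by rewrite big_imfset //= => j1 j2 _ _ /hi.
have [hB hBE] := preim_fset B hi.
apply: le_trans (hC hB).
rewrite -lecR !rmorph_sum.
by rewrite (sum_preim hi a0' hBE).
Qed.

Lemma fin_sums_to I (a : I -> R[i]) (A : {fset I}) : (forall i, i \notin A -> a i = 0) ->
  sums_to a (\sum_(i <- A) a i).
Proof.
move=> a0 e e0; exists A => B AB; rewrite (big_fset_incl _ AB) ?subrr ?normc0 //.
by move=> i _; apply: a0.
Qed.

Lemma fin_abs_conv I (a : I -> R[i]) (A : {fset I}) : (forall i, i \notin A -> a i = 0) ->
  abs_convergent a.
Proof.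
move=> a0; apply/abs_convP; exists (\sum_(i <- A) normc (a i)) => B.
apply: (@le_trans _ _ (\sum_(i <- (A `|` B)%fset) normc (a i))).
  by apply: fsum_le; rewrite ?fsubsetUr // => i; apply: normc_ge0.
rewrite -(@big_fset_incl _ _ _ _ A) ?fsubsetUl // => i _ /a0 ->.
by rewrite normc0.
Qed.

Lemma sums_to_shift I (a : I -> R[i]) S (h h' : I -> I) : cancel h h' -> cancel h' h ->
  sums_to a S -> sums_to (fun i => a (h i)) S.
Proof.
move=> hK h'K; apply: (iffLR (sums_to_preim _ (can_inj hK) _)) => i H.
by have := H (h' i); rewrite h'K.
Qed.

Lemma abs_conv_shift I (a : I -> R[i]) (h h' : I -> I) : cancel h h' -> cancel h' h ->
  abs_convergent a -> abs_convergent (fun i => a (h i)).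
Proof.
move=> hK h'K; apply: (iffLR (abs_conv_preim (can_inj hK) _)) => i H.
by have := H (h' i); rewrite h'K.
Qed.

End UnorderedSums.

(** * Exponential polynomials on the real line *)

Section ExpPolynomials.
Variables (R : realType).
Local Notation C := (R[i]).
Implicit Types (ms : seq C) (P : C -> {poly C}) (r : R).

Definition shiftp (s : C) (p : {poly C}) : {poly C} := p \Po ('X + s%:P).

Lemma horner_shiftp s p x : (shiftp s p).[x] = p.[x + s].
Proof. by rewrite horner_comp !hornerE. Qed.

Lemma size_shiftp s p : size (shiftp s p) = size p.
Proof. by apply: size_comp_poly2; rewrite size_XaddC. Qed.

Lemma lead_coef_shiftp s p : lead_coef (shiftp s p) = lead_coef p.
Proof.
by rewrite lead_coef_comp ?size_XaddC // lead_coefXaddC expr1n mulr1.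
Qed.

(** The leading terms cancel and the next coefficient is (deg p) * s times the leading
one, which is nonzero in characteristic 0. *)
Lemma size_diffp s p : s != 0 -> size (shiftp s p - p) = (size p).-1.
Proof.
move=> s0; case qn : (size p) => [|n].
  move/eqP: qn; rewrite size_poly_eq0 => /eqP ->.
  by rewrite /shiftp comp_poly0 subr0 size_poly0.
move: p qn => q qn.
have top i : (n <= i)%N -> (shiftp s q - q)`_i = 0.
  move=> ni; rewrite coefB; have [->|ne] := eqVneq i n.
    have -> : n = (size q).-1 by rewrite qn.
    by rewrite -[X in _ - X]/(lead_coef q) -{1}(size_shiftp s q) -/(lead_coef _)
      lead_coef_shiftp subrr.
  have iq : (size q <= i)%N by rewrite qn; lia.
  by rewrite !nth_default ?size_shiftp // subrr.
case: n qn top => [|n] qn top /=.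
  apply/eqP; rewrite size_poly_eq0; apply/eqP/polyP => i; rewrite coef0; exact: top.
apply/eqP; rewrite eqn_leq; apply/andP; split; first by apply/leq_sizeP.
rewrite ltnNge; apply/negP => /leq_sizeP/(_ n (leqnn n)).
rewrite coefB /shiftp comp_polyE coef_sum qn 2!big_ord_recr /= !coefZ big1 => [|i _]; last first.
  rewrite coefZ [X in _ * X]nth_default ?mulr0 //.
  by rewrite (leq_trans (size_poly_exp_leq _ _)) // size_XaddC /= mul1n.
have lead1 : (('X + s%:P) ^+ n)`_n = 1.
  have := lead_coef_exp ('X + s%:P) n.
  by rewrite lead_coefXaddC expr1n /lead_coef size_exp size_XaddC mul1n.
have lead2 : (('X + s%:P) ^+ n.+1)`_n = n.+1%:R * s.
  have := @coefPn_prod_XsubC _ (nseq n.+1 (- s)); rewrite size_nseq => /(_ isT).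
  by rewrite !big_nseq iter_mulr_1 /= iter_addr_0 -mulrS mulNrn opprK polyCN (opprK s%:P) mulr_natl.
rewrite lead1 lead2 mulr1 add0r addrAC subrr add0r => /eqP.
rewrite !mulf_eq0 pnatr_eq0 (negPf s0) !orbF.
have := lead_coef_eq0 q; rewrite /lead_coef qn /= => ->.
by rewrite -size_poly_eq0 qn.
Qed.

Definition epoly ms P r : C := \sum_(m <- ms) (P m).[r%:C] * cexp (m * r%:C).

(** e^{ms} = e^{m's} forces (m - m') s to be a multiple of 2 pi i, so any s with
|m - m'| s < 2 pi for all pairs will do. *)
Lemma small_step ms : exists2 s : R, 0 < s & forall m m' : C, m \in ms -> m' \in ms ->
  cexp (m * s%:C) = cexp (m' * s%:C) -> m = m'.
Proof.
pose K := \sum_(m <- ms) normc m.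
have hK m : m \in ms -> normc m <= K.
  move=> mm; rewrite /K (big_rem m) //= lerDl sumr_ge0 // => i _; exact: normc_ge0.
have K0 : 0 <= K by rewrite sumr_ge0 // => i _; exact: normc_ge0.
have s0 : 0 < (1 + K)^-1 by rewrite invr_gt0; lra.
exists (1 + K)^-1 => // m m' mm mm' h.
have := cexpD (m * ((1 + K)^-1)%:C) (- (m' * ((1 + K)^-1)%:C)).
rewrite cexpN h divff ?cexp_neq0 // -mulrBl => /cexp_eq1[p hp].
have : normc (m - m') * (1 + K)^-1 = `|p%:~R| * (2 * pi).
  rewrite -{1}[(1 + K)^-1]gtr0_norm // -normc_real -normcM hp normcM.
  have -> : (p%:~R : C) = (p%:~R : R)%:C by rewrite rmorph_int.
  rewrite normc_real; congr (_ * _) => /=.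
  by rewrite expr0n add0r sqrtr_sqr gtr0_norm // mulr_gt0 // pi_gt0.
have [p0 _|p0 e] := eqVneq p 0.
  move: hp; rewrite p0 mul0r => /eqP; rewrite mulf_eq0 subr_eq0 => /orP[/eqP//|].
  by rewrite eq_complex /= eqxx andbT gt_eqF.
have p1 : 1 <= `|p%:~R : R|.
  by rewrite -intr_norm -[1]/(1%:~R) ler_int; lia.
have : normc (m - m') * (1 + K)^-1 < 2.
  have K1 : 0 < 1 + K by lra.
  clear hp h; rewrite ltr_pdivrMr //.
  have := le_normcD m (- m'); rewrite normcN; have := hK _ mm; have := hK _ mm'; lra.
by rewrite e => lt2; exfalso; have := pi_ge2 R; nra.
Qed.

Lemma epoly_shift ms P (s : R) m' r :
  epoly ms P (r + s) - cexp (m' * s%:C) * epoly ms P r =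
  epoly ms (fun m => cexp (m * s%:C) *: shiftp s%:C (P m) - cexp (m' * s%:C) *: P m) r.
Proof.
rewrite /epoly mulr_sumr -sumrB; apply: eq_bigr => m _.
rewrite hornerD hornerN !hornerZ horner_shiftp rmorphD /= mulrDr cexpD; ring.
Qed.

Lemma expR_unbounded (d c K r0 : R) : 0 < d -> 0 < c ->
  exists2 r, r0 <= r & K < c * expR (d * r).
Proof.
move=> d0 c0; exists (Num.max r0 (`|K| / (c * d))); first by rewrite le_max lexx.
set r := Num.max _ _.
have hr : `|K| / (c * d) <= r by rewrite le_max lexx orbT.
have := expR_ge1Dx (d * r).
rewrite ler_pdivrMr ?mulr_gt0 // in hr.
move=> h; have : c * (1 + d * r) <= c * expR (d * r) by rewrite ler_pM2l.
have := ler_norm K; nra.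
Qed.

(** The operators E(r) |-> E(r+s) - e^{m's} E(r) preserve such a bound, lower the degree
of the coefficient of e^{m'r} and keep those of the other exponentials.  Applying
them isolates a single c e^{mr}, which breaks the bound when sg < Re m. *)
Lemma epoly_decay ms P (sg K r0 : R) : uniq ms ->
  (forall r, r0 <= r -> normc (epoly ms P r) <= K * expR (sg * r)) ->
  forall m, m \in ms -> sg < complex.Re m -> P m = 0.
Proof.
move=> ums; have [s s0 hs] := small_step ms.
have [N] := ubnP (\sum_(m <- ms) size (P m)).
elim: N P K r0 => // N IH P K r0 hN bd m mm sgm.
have sC0 : s%:C != 0 :> C by rewrite eq_complex /= eqxx andbT gt_eqF.
apply/eqP/negPn/negP => Pm0.
have step (m' : C) (Q : {poly C}) : (m' \in ms) -> (size (cexp (m' * s%:C) *: shiftp s%:C (P m') - cexp (m' * s%:C) *: P m')%R < size (P m'))%N ->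
    Q = cexp (m * s%:C) *: shiftp s%:C (P m) - cexp (m' * s%:C) *: P m -> Q = 0.
  move=> mm' sz ->.
  pose P' x := cexp (x * s%:C) *: shiftp s%:C (P x) - cexp (m' * s%:C) *: P x.
  rewrite -/(P' m).
  apply: (IH P' (`|K| * expR (`|sg| * s) + expR (complex.Re m' * s) * `|K|) r0) => //.
    rewrite -ltnS; apply: leq_trans hN; rewrite ltnS (big_rem m') //= [X in (_ < X)%N](big_rem m') //=.
    rewrite -addSn leq_add //; apply: leq_sum => x _.
    rewrite /P' (leq_trans (size_polyD _ _)) // size_polyN geq_max.
    by rewrite (leq_trans (size_scale_leq _ _)) ?size_shiftp //= size_scale_leq.
  move=> r hr; rewrite -epoly_shift.
  apply: (le_trans (le_normcD _ _)); rewrite normcN normcM normc_cexp mulrDl lerD //.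
    apply: (le_trans (bd _ _)); first by rewrite ler_wpDr // ltW.
    rewrite mulrDr expRD mulrA -mulrA -[X in _ <= X]mulrA.
    apply: (@le_trans _ _ (`|K| * (expR (sg * r) * expR (sg * s)))).
      by rewrite ler_wpM2r ?mulr_ge0 ?expR_ge0 ?ler_norm.
    rewrite ler_wpM2l // mulrC ler_wpM2r ?expR_ge0 // ler_expR.
    by rewrite ler_wpM2r ?ler_norm // ltW.
  have -> : complex.Re (m' * s%:C) = complex.Re m' * s.
    by case: (m') => a b /=; rewrite mulr0 subr0.
  rewrite -mulrA ler_wpM2l ?expR_ge0 //; apply: (le_trans (bd _ hr)).
  by rewrite ler_wpM2r ?expR_ge0 ?ler_norm.
have dsz (m' : C) : P m' != 0 -> (size (cexp (m' * s%:C) *: shiftp s%:C (P m') - cexp (m' * s%:C) *: P m')%R < size (P m'))%N.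
  by move=> Pm'; rewrite -scalerBr size_scale ?cexp_neq0 // size_diffp // prednK ?size_poly_gt0.
have [/hasP[m' mm' /andP[m'm Pm']]|/hasPn none] := boolP (has (fun m' => (m' != m) && (P m' != 0)) ms).
  have /esym/eqP := step m' _ mm' (dsz _ Pm') erefl.
  rewrite eq_sym subr_eq0 => /eqP/(congr1 lead_coef).
  rewrite !lead_coefZ lead_coef_shiftp => /mulIf.
  by rewrite lead_coef_eq0 => /(_ Pm0)/(hs _ _ mm mm')/esym/eqP; rewrite (negPf m'm).
have E r : epoly ms P r = (P m).[r%:C] * cexp (m * r%:C).
  rewrite /epoly (big_rem m) //= big_seq big1 ?addr0 // => x.
  rewrite mem_rem_uniq // inE => /andP[xm xms].
  by move: (none _ xms); rewrite /= xm negbK => /eqP ->; rewrite horner0 mul0r.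
have := step m _ mm (dsz _ Pm0) erefl.
move/(congr1 (fun q : {poly C} => size q)); rewrite -scalerBr size_scale ?cexp_neq0 // size_diffp // size_poly0.
move=> sz1; have /size_poly1P[c c0 Pc] : size (P m) == 1%N.
  by move: Pm0; rewrite -size_poly_gt0; move: sz1; case: (size _) => [|[]].
have nc0 : 0 < normc c by rewrite normc_gt0.
have d0 : 0 < complex.Re m - sg by lra.
have [r hr] := expR_unbounded K r0 d0 nc0.
have := bd r hr; rewrite E Pc hornerC normcM normc_cexp.
have -> : complex.Re (m * r%:C) = complex.Re m * r.
  by case: (m) => a b /=; rewrite mulr0 subr0.
have -> : complex.Re m * r = (complex.Re m - sg) * r + sg * r by ring.
by rewrite expRD mulrA ler_pM2r ?expR_gt0 // leNgt => /negPf ->.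
Qed.

Definition eterm (t : C * C * nat) r : C := t.1.1 * cexp (t.1.2 * r%:C) * r%:C ^+ t.2.

Definition exppoly (E : R -> C) : Prop :=
  exists l : seq (C * C * nat), forall r, E r = \sum_(t <- l) eterm t r.

Lemma exppolyD E F : exppoly E -> exppoly F -> exppoly (fun r => E r + F r).
Proof. by move=> [l hl] [k hk]; exists (l ++ k) => r; rewrite big_cat hl hk. Qed.

Lemma exppolyM E F : exppoly E -> exppoly F -> exppoly (fun r => E r * F r).
Proof.
move=> [l hl] [k hk].
exists [seq (t.1.1 * u.1.1, t.1.2 + u.1.2, (t.2 + u.2)%N) | t <- l, u <- k] => r.
rewrite hl hk big_allpairs_dep mulr_suml; apply: eq_bigr => t _.
rewrite mulr_sumr; apply: eq_bigr => u _.
rewrite /eterm /= mulrDl cexpD exprD; ring.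
Qed.

Lemma exppoly_ext E F : (forall r, E r = F r) -> exppoly E -> exppoly F.
Proof. by move=> /funext ->. Qed.

Lemma exppoly_term c m k : exppoly (fun r => c * cexp (m * r%:C) * r%:C ^+ k).
Proof. by exists [:: (c, m, k)] => r; rewrite big_seq1. Qed.

Lemma exppolyC c : exppoly (fun=> c).
Proof. by apply: exppoly_ext (exppoly_term c 0 0) => r; rewrite mul0r cexp0 !mulr1. Qed.

Lemma exppoly_exp m : exppoly (fun r => cexp (m * r%:C)).
Proof. by apply: exppoly_ext (exppoly_term 1 m 0) => r; rewrite mul1r mulr1. Qed.

Lemma exppoly_var : exppoly (fun r => r%:C).
Proof. by apply: exppoly_ext (exppoly_term 1 0 1) => r; rewrite mul0r cexp0 !mul1r. Qed.

Lemma exppolyX E n : exppoly E -> exppoly (fun r => E r ^+ n).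
Proof.
move=> hE; elim: n => [|n IH]; first exact: exppolyC.
by apply: exppoly_ext (exppolyM hE IH) => r; rewrite exprS.
Qed.

Lemma exppoly_sum (T : Type) (s : seq T) (E : T -> R -> C) :
  (forall t, exppoly (E t)) -> exppoly (fun r => \sum_(t <- s) E t r).
Proof.
move=> h; elim: s => [|t s IH].
  by apply: exppoly_ext (exppolyC 0) => r; rewrite big_nil.
by apply: exppoly_ext (exppolyD (h t) IH) => r; rewrite big_cons.
Qed.

Lemma exppoly_epoly E : exppoly E -> exists ms P,
  [/\ uniq ms, forall m, m \notin ms -> P m = 0 & forall r, E r = epoly ms P r].
Proof.
move=> [l hl]; exists (undup [seq t.1.2 | t <- l]).
exists (fun m => \sum_(t <- l | t.1.2 == m) t.1.1 *: 'X^(t.2)); split.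
- exact: undup_uniq.
- move=> m; rewrite mem_undup => /mapP hm; rewrite big_seq_cond big1 // => t /andP[tl /eqP tm].
  by case: hm; exists t.
move=> r; rewrite hl /epoly.
rewrite (eq_bigr (fun m => \sum_(t <- l | t.1.2 == m) eterm t r)) => [|m _]; last first.
  rewrite horner_sum mulr_suml; apply: eq_bigr => t /eqP <-.
  by rewrite /eterm hornerZ hornerXn mulrAC.
rewrite (exchange_big_dep xpredT) //= big_seq [RHS]big_seq; apply: eq_bigr => t tl.
rewrite [RHS]big_mkcond (bigD1_seq t.1.2) ?undup_uniq //= ?mem_undup.
  by rewrite eqxx big1 ?addr0 // => m; rewrite eq_sym => /negPf ->.
by apply/mapP; exists t.
Qed.

Lemma epolyN ms P r : epoly ms P (- r) =
  epoly [seq - m | m <- ms] (fun m => P (- m) \Po (- 'X)) r.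
Proof.
rewrite /epoly big_map; apply: eq_bigr => m _.
by rewrite opprK horner_comp !hornerE rmorphN /= mulrN mulNr.
Qed.

End ExpPolynomials.

(** * Two expansions of one function *)

Section ExpansionComparison.
Variables (R : realType).
Local Notation C := (R[i]).
Implicit Types (c : int -> C) (r : R) (G : R -> C).

Definition intr_seq (a : int) (K : nat) : seq int := [seq a + i%:Z | i <- iota 0 K].

Lemma intr_seqP a K n : reflect (a <= n < a + K%:Z) (n \in intr_seq a K).
Proof.
apply: (iffP mapP) => [[j]|h]; first by rewrite mem_iota => h ->; lia.
by exists `|n - a|%N; rewrite ?mem_iota; lia.
Qed.

Lemma intr_seq_uniq a K : uniq (intr_seq a K).
Proof. by rewrite map_inj_uniq ?iota_uniq // => i j; lia. Qed.

Definition zterm c r (n : int) : C := c n * cexp (n%:~R * r%:C).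

Lemma Re_intM n r : complex.Re (n%:~R * r%:C : C) = n%:~R * r.
Proof.
have -> : (n%:~R : C) = (n%:~R : R)%:C by rewrite rmorph_int.
by rewrite -rmorphM.
Qed.

Lemma cexp_realB1 r : cexp r%:C - 1 = (expR r - 1)%:C.
Proof. by rewrite cexp_real rmorphB rmorph1. Qed.

Lemma normc_zterm c r n : normc (zterm c r n) = normc (c n) * expR (n%:~R * r).
Proof. by rewrite normcM normc_cexp Re_intM. Qed.

(** The terms of index below a are at most e^{a(r-1)} times their values at r = 1, where
the series converges absolutely. *)
Lemma series_tail c G a K : (forall n, a + K%:Z <= n -> c n = 0) ->
  (forall r, 0 < r -> abs_sums_to (zterm c r) (G r)) ->
  exists B, forall r, 1 <= r ->
    normc (G r - \sum_(n <- intr_seq a K) zterm c r n) <= B * expR (a%:~R * r).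
Proof.
move=> c0 hG; have [/abs_convP[B hB] _] := hG 1 ltr01.
exists (B * expR (- a%:~R)) => r r1; have r0 : 0 < r by lra.
pose A : {fset int} := [fset n in intr_seq a K]%fset.
have AE n : (n \in A) = (n \in intr_seq a K) by rewrite inE.
pose b n := if n \in A then zterm c r n else 0.
have bE : \sum_(n <- intr_seq a K) zterm c r n = \sum_(n <- A) b n.
  transitivity (\sum_(n <- A) zterm c r n); last first.
    by apply: eq_big_seq => n nA; rewrite /b nA.
  by apply: perm_big; apply: uniq_perm; rewrite ?intr_seq_uniq ?fset_uniq // => n; rewrite AE.
have hb : sums_to b (\sum_(n <- A) b n).
  by apply: fin_sums_to => n nA; rewrite /b (negPf nA).
rewrite bE -[- _]mulN1r.
apply: (sums_to_bound (sums_toD (hG _ r0).2 (sums_toZ (-1) hb))) => S.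
apply: (@le_trans _ _ (\sum_(n <- S) normc (zterm c 1 n) * (expR (- a%:~R) * expR (a%:~R * r)))); last first.
  by rewrite -mulr_suml -mulrA ler_wpM2r // mulr_ge0 ?expR_ge0.
apply: ler_sum => n _; rewrite /b AE; case: intr_seqP => [h|h].
  by rewrite mulN1r subrr normc0 !mulr_ge0 ?normc_ge0 ?expR_ge0.
rewrite mulr0 addr0 !normc_zterm -mulrA.
have [/c0 ->|n0] := leP (a + K%:Z) n; first by rewrite normc0 !mul0r.
rewrite ler_wpM2l ?normc_ge0 // -!expRD ler_expR.
have na : n%:~R <= a%:~R :> R by rewrite ler_int; lia.
nra.
Qed.


(** After subtraction of the terms of index at least n - 1 the rest is O(e^{(n-1)r}), so
that the coefficients of e^{nr} on the two sides have to agree. *)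
Lemma expansion_unique c (E : R -> C) ms P n1 :
  uniq ms -> (forall m, m \notin ms -> P m = 0) -> (forall n, n1 <= n -> c n = 0) ->
  (forall r, 0 < r -> abs_sums_to (zterm c r) (epoly ms P r)) ->
  forall n, c n = (P n%:~R)`_0.
Proof.
move=> ums P0 c0 hc n; pose K := (`|n - 1| + `|n1|).+2%N.
have c0K k : n - 1 + K%:Z <= k -> c k = 0 by move=> h; apply: c0; rewrite /K in h; lia.
have [B hB] := series_tail c0K hc.
pose s := intr_seq (n - 1) K.
pose ms' := undup (ms ++ [seq k%:~R | k <- s]).
pose P' m := P m - (\sum_(k <- s | k%:~R == m) c k)%:P.
have P'E r : epoly ms P r - \sum_(k <- s) zterm c r k = epoly ms' P' r.
  rewrite /epoly; under [RHS]eq_bigr do rewrite hornerD hornerN hornerC mulrBl.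
  rewrite sumrB; congr (_ - _).
    rewrite [RHS](bigID (mem ms)) /= [X in _ + X]big1 ?addr0 => [|m /P0 ->]; last first.
      by rewrite horner0 mul0r.
    rewrite -[RHS]big_filter; apply: perm_big; apply: uniq_perm => //.
      by rewrite filter_uniq // undup_uniq.
    by move=> m; rewrite mem_filter mem_undup mem_cat; case: (m \in ms).
  under [RHS]eq_bigr do rewrite mulr_suml.
  rewrite (exchange_big_dep xpredT) //= big_seq [RHS]big_seq; apply: eq_bigr => k ks.
  rewrite [RHS]big_mkcond (bigD1_seq (k%:~R : C)) ?undup_uniq //= ?mem_undup.
    by rewrite eqxx big1 ?addr0 // => m; rewrite eq_sym => /negPf ->.
  by rewrite mem_cat map_f ?orbT.
have P'0 : P' n%:~R = 0.
  have [nms|nms] := boolP ((n%:~R : C) \in ms'); last first.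
    rewrite /P' P0; last by apply: contra nms; rewrite mem_undup mem_cat => ->.
    rewrite big_seq_cond big1 ?subrr // => k /andP[ks /eqP kn].
    by move: nms; rewrite mem_undup mem_cat -kn map_f ?orbT.
  apply: (@epoly_decay _ ms' P' (n - 1)%:~R B 1) nms _ => [|r r1|].
  - exact: undup_uniq.
  - by rewrite -P'E; exact: hB.
  have -> : (n%:~R : C) = (n%:~R : R)%:C by rewrite rmorph_int.
  by rewrite /= ltr_int; lia.
move/eqP: P'0; rewrite subr_eq0 => /eqP ->; rewrite coefC eqxx.
rewrite big_mkcond (bigD1_seq n) ?intr_seq_uniq //=; last by apply/intr_seqP; rewrite /K; lia.
by rewrite eqxx big1 ?addr0 // => k kn; rewrite eqr_int (negPf kn).
Qed.

Lemma zterm_neg c r n : zterm (fun n => c (- n)) r n = zterm c (- r) (- n).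
Proof. by rewrite /zterm !rmorphN /= mulrNN. Qed.

(** Both c and c' are read off from the same exponential polynomial, at +oo and -oo. *)
Lemma two_sided_unique c c' (E : R -> C) n0 n1 : exppoly E ->
  (forall n, n1 <= n -> c n = 0) -> (forall n, n <= n0 -> c' n = 0) ->
  (forall r, 0 < r -> abs_sums_to (zterm c r) (E r)) ->
  (forall r, r < 0 -> abs_sums_to (zterm c' r) (E r)) ->
  c =1 c'.
Proof.
move=> /exppoly_epoly[ms [P [ums P0 hE]]] c0 c'0 hc hc' n.
rewrite (@expansion_unique c (epoly ms P) ms P n1) // => [|r r0]; last first.
  by rewrite -hE; exact: hc.
pose c'' k := c' (- k); rewrite -[n in RHS]opprK -/(c'' (- n)).
rewrite (@expansion_unique c'' (epoly [seq - m | m <- ms] (fun m => P (- m) \Po (- 'X)))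
   [seq - m | m <- ms] (fun m => P (- m) \Po (- 'X)) (- n0)) //.
- by rewrite rmorphN /= opprK -[RHS]horner_coef0 horner_comp !hornerE oppr0 horner_coef0.
- by rewrite map_inj_uniq //; exact: oppr_inj.
- move=> m hm; rewrite P0 ?comp_poly0 //; apply: contra hm => hm.
  by apply/mapP; exists (- m); rewrite ?opprK.
- by move=> k hk; apply: c'0; lia.
move=> r r0; rewrite -epolyN -hE.
have /hc' [h1 h2] : - r < 0 by lra.
split.
  apply: (abs_conv_ext _ (abs_conv_shift opprK opprK h1)) => k; by rewrite zterm_neg.
apply: (sums_to_ext _ (sums_to_shift opprK opprK h2)) => k; by rewrite zterm_neg.
Qed.

(** The coefficients of (y - 1) S(y) when c gives those of S(y). *)
Definition mul1 c (n : int) : C := c (n - 1) - c n.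

Lemma abs_sums_mul1 c r S : abs_sums_to (zterm c r) S ->
  abs_sums_to (zterm (mul1 c) r) ((cexp r%:C - 1) * S).
Proof.
move=> [h1 h2].
have hs : cancel (fun n : int => n - 1) (fun n => n + 1) by move=> n; lia.
have sh : cancel (fun n : int => n + 1) (fun n => n - 1) by move=> n; lia.
have e n : cexp r%:C * zterm c r (n - 1) + (-1) * zterm c r n = zterm (mul1 c) r n.
  have ce : cexp (n%:~R * r%:C) = cexp r%:C * cexp ((n - 1)%:~R * r%:C) :> C.
    by rewrite -cexpD; congr cexp; rewrite rmorphB /=; ring.
  by rewrite /zterm /mul1 ce; ring.
split.
  apply: (abs_conv_ext e); apply: abs_convD (abs_convZ _ _) (abs_convZ _ h1).
  exact: abs_conv_shift hs sh h1.
rewrite mulrBl mul1r -mulN1r.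
apply: (sums_to_ext e); apply: sums_toD (sums_toZ _ _) (sums_toZ _ h2).
exact: sums_to_shift hs sh h2.
Qed.

Lemma abs_sums_mul1X c r S T : abs_sums_to (zterm c r) S ->
  abs_sums_to (zterm (iter T mul1 c) r) ((cexp r%:C - 1) ^+ T * S).
Proof.
move=> h; elim: T => [|T IH]; first by rewrite mul1r.
by rewrite exprS -mulrA; apply: abs_sums_mul1.
Qed.

Lemma iter_mul1_hi c n1 T : (forall n, n1 <= n -> c n = 0) ->
  forall n, n1 + T%:Z <= n -> iter T mul1 c n = 0.
Proof.
move=> c0; elim: T => [|T IH] n hn; first by apply: c0; lia.
by rewrite /= /mul1 !IH ?subrr //; lia.
Qed.

Lemma iter_mul1_lo c n0 T : (forall n, n <= n0 -> c n = 0) ->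
  forall n, n <= n0 -> iter T mul1 c n = 0.
Proof.
move=> c0; elim: T => [|T IH] n hn; first exact: c0.
by rewrite /= /mul1 !IH ?subrr //; lia.
Qed.

Lemma mul1_const c : (forall n, mul1 c n = 0) -> forall n m, c n = c m.
Proof.
move=> h; have c1 n : c (n - 1) = c n by apply/eqP; rewrite -subr_eq0; apply/eqP/h.
have cN k n : c (n + k%:Z) = c n.
  elim: k n => [|k IH] n; first by rewrite addr0.
  by rewrite -[LHS]c1 -[RHS](IH n); congr c; lia.
move=> n m; have [h1|h1] := leP n m.
  have -> : m = n + `|m - n|%N%:Z by lia.
  by rewrite cN.
have -> : n = m + `|m - n|%N%:Z by lia.
by rewrite cN.
Qed.

Lemma sum_mul1 c a K : \sum_(n <- intr_seq a K) mul1 c n = c (a - 1) - c (a + K%:Z - 1).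
Proof.
rewrite big_map; elim: K => [|K IH]; first by rewrite big_nil addr0 subrr.
rewrite -[iota 0 K.+1]/(iota 0 (K.+1)) -addn1 iotaD big_cat big_seq1 /= IH /mul1 add0n.
have -> : a + (K + 1)%N%:Z - 1 = a + K by lia.
by rewrite addrA subrK.
Qed.

Lemma expR_near1 (n : int) r : 0 < r <= 1 ->
  `|expR (n%:~R * r) - 1| <= `|n%:~R| * expR `|n%:~R| * r.
Proof.
move=> /andP[r0 r1]; set x := n%:~R; have h1 := expR_ge1Dx (x * r).
have h2 := expR_ge1Dx (- (x * r)).
have e1 : 1 <= expR `|x| by rewrite -expR0 ler_expR.
have xr : `|x| * r <= `|x| * expR `|x| * r by apply: ler_wpM2r; [exact: ltW|rewrite ler_peMr].
have [x0|x0] := leP 0 x.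
  have ex : expR (x * r) <= expR x by rewrite ler_expR ler_piMr.
  have inv : expR (x * r) * expR (- (x * r)) = 1 by rewrite -expRD subrr expR0.
  have ep := expR_gt0 (x * r).
  rewrite ger0_norm; last by nra.
  rewrite ger0_norm //.
  have i1 : expR (x * r) * (1 - x * r) <= 1 by rewrite -[leRHS]inv ler_wpM2l ?expR_ge0.
  have i2 : 0 <= x * r by rewrite mulr_ge0 // ltW.
  have i3 : x * r * expR (x * r) <= x * r * expR x by rewrite ler_wpM2l.
  nra.
have xl : x * r <= 0 by rewrite mulr_le0_ge0 // ltW.
have : expR (x * r) <= 1 by rewrite -expR0 ler_expR.
move=> h3; rewrite ler0_norm; last lra.
apply: le_trans xr; rewrite ltr0_norm //; nra.
Qed.

(** For large exponents T in place of M this is [two_sided_unique].  If it holds for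
T + 1, then the two sequences for T differ by a constant, and this constant is the
value at r = 0 of (e^r - 1)^{T+1} G.  It vanishes when T >= M, since
(e^r - 1)^M G is bounded near 0. *)
Lemma expansion_comparison c c' G n0 n1 M :
  (forall n, n1 <= n -> c n = 0) -> (forall n, n <= n0 -> c' n = 0) ->
  (forall r, 0 < r -> abs_sums_to (zterm c r) (G r)) ->
  (forall r, r < 0 -> abs_sums_to (zterm c' r) (G r)) ->
  (exists T E, exppoly E /\ forall r, r != 0 -> (cexp r%:C - 1) ^+ T * G r = E r) ->
  (exists (d B : R), 0 < d /\ forall r, 0 < r < d -> normc ((cexp r%:C - 1) ^+ M * G r) <= B) ->
  iter M mul1 c =1 iter M mul1 c'.
Proof.
move=> c0 c'0 hc hc' [T [E [expE hE]]] [d [B [d0 hB]]].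
have start : iter (T + M) mul1 c =1 iter (T + M) mul1 c'.
  have expE' : exppoly (fun r => (cexp r%:C - 1) ^+ M * E r).
    apply: exppolyM expE; apply: exppolyX; apply: exppolyD (exppolyC _).
    by apply: exppoly_ext (exppoly_exp 1) => r; rewrite mul1r.
  apply: (two_sided_unique expE' (@iter_mul1_hi _ _ (T + M) c0)
    (@iter_mul1_lo _ _ (T + M) c'0)) => r r0.
    rewrite -hE ?gt_eqF // mulrA -exprD addnC; apply: abs_sums_mul1X; exact: hc.
  rewrite -hE ?lt_eqF // mulrA -exprD addnC; apply: abs_sums_mul1X; exact: hc'.
elim: T start {expE hE} => // T IH start; apply: IH => n.
set c1 := iter (T + M) mul1 c; set c1' := iter (T + M) mul1 c'.
have mulE k : mul1 c1 k = mul1 c1' k by have := start k; rewrite addSn.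
have cst := @mul1_const (fun k => c1 k - c1' k).
have {}cst k m : c1 k - c1' k = c1 m - c1' m.
  apply: cst => {}k; rewrite /mul1; have := mulE k; rewrite /mul1 => h.
  have -> : c1 (k - 1) - c1' (k - 1) - (c1 k - c1' k) =
    (c1 (k - 1) - c1 k) - (c1' (k - 1) - c1' k) by ring.
  by rewrite h subrr.
have lo := @iter_mul1_lo _ _ (T + M) c'0; have hi := @iter_mul1_hi _ _ (T + M) c0.
pose a := - (`|n0| + 1)%N%:Z; pose K := (`|n0| + `|n1| + T + M + 3)%N.
have c1lo k : k <= a -> c1' k = 0 by move=> ka; apply: lo; rewrite /a in ka; lia.
have c1hi k : a + K%:Z - 1 <= k -> c1 k = 0 by move=> ka; apply: hi; rewrite /a /K in ka; lia.
(* H is the value at r = 0, and by telescoping it is also the constant difference. *)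
pose H := \sum_(k <- intr_seq a K) mul1 c1 k.
suff H0 : H = 0.
  apply/eqP; rewrite -subr_eq0 (cst n (a - 1)) c1lo ?subr0; last by lia.
  by move/eqP: H0; rewrite /H sum_mul1 (c1hi (a + K%:Z - 1)) ?subr0.
have supp k : k \notin intr_seq a K -> mul1 c1 k = 0.
  move=> /intr_seqP hk; have [ka|ka] := ltP k a.
    by rewrite mulE /mul1 !c1lo ?subrr //; lia.
  by rewrite /mul1 !c1hi ?subrr //; lia.
pose L := \sum_(k <- intr_seq a K) normc (mul1 c1 k) * (`|k%:~R| * expR `|k%:~R|).
have B0 : 0 <= B.
  apply: (le_trans _ (hB (d / 2) _)); [exact: normc_ge0|lra].
have bound r : 0 < r <= 1 -> r < d -> normc H <= (L + B * (expR 1 * expR 1 ^+ T)) * r.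
  move=> /andP[r0 r1] rd.
  have hs : \sum_(k <- intr_seq a K) zterm (mul1 c1) r k = (cexp r%:C - 1) ^+ (T + M).+1 * G r.
    pose A : {fset int} := [fset k in intr_seq a K]%fset.
    have -> : \sum_(k <- intr_seq a K) zterm (mul1 c1) r k = \sum_(k <- A) zterm (mul1 c1) r k.
      by apply: perm_big; apply: uniq_perm; rewrite ?intr_seq_uniq ?fset_uniq // => k; rewrite inE.
    apply: (sums_to_uniq (fin_sums_to _)).
      by move=> k; rewrite inE => /supp h; rewrite /zterm h mul0r.
    have [_ h] := abs_sums_mul1X (T + M).+1 (hc r r0); exact: h.
  have -> : H = \sum_(k <- intr_seq a K) mul1 c1 k * (1 - cexp (k%:~R * r%:C))
                + \sum_(k <- intr_seq a K) zterm (mul1 c1) r k.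
    by rewrite -big_split; apply: eq_bigr => k _; rewrite /= /zterm; ring.
  apply: (le_trans (le_normcD _ _)); rewrite mulrDl lerD //.
    rewrite mulr_suml; apply: (le_trans (normc_sum _ _ _)); apply: ler_sum => k _.
    rewrite normcM -mulrA ler_wpM2l ?normc_ge0 // normc_distC.
    have -> : (k%:~R * r%:C : C) = (k%:~R * r : R)%:C by rewrite rmorphM rmorph_int.
    rewrite cexp_realB1 normc_real.
    by apply: expR_near1; rewrite r0.
  have w : normc (cexp r%:C - 1) <= expR 1 * r.
    rewrite cexp_realB1 normc_real.
    have := @expR_near1 1 r; rewrite !mul1r normr1 mul1r; apply; by rewrite r0.
  have w3 : normc (cexp r%:C - 1) <= expR 1.
    by apply: (le_trans w); rewrite ler_piMr ?expR_ge0.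
  rewrite hs -addSn exprD -mulrA normcM mulrC.
  rewrite -mulrA ler_pM ?normc_ge0 //; first by apply: hB; rewrite r0.
  rewrite exprS normcM mulrAC ler_pM ?normc_ge0 // normcX lerXn2r ?nnegrE ?normc_ge0 //.
apply/eqP; rewrite -normc_eq0 eq_le normc_ge0 andbT.
apply/ler_addgt0Pr => e e0; rewrite add0r.
set Q := L + _ in bound.
pose r := Num.min (Num.min 1 (d / 2)) (e / (`|Q| + 1)).
have Q1 : 0 < `|Q| + 1 by have := normr_ge0 Q; lra.
have r0 : 0 < r by rewrite !lt_min ltr01 divr_gt0 //=; rewrite divr_gt0.
apply: (le_trans (bound r _ _)).
- by rewrite r0 !ge_min lexx.
- by rewrite !gt_min; apply/orP; left; apply/orP; right; lra.
have : r <= e / (`|Q| + 1) by rewrite ge_min lexx orbT.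
rewrite ler_pdivlMr // => h; have := ler_norm Q; nra.
Qed.

End ExpansionComparison.

(** * Generalized eigenspaces and gradings *)

Section GeneralizedEigenspaces.
Variables (R : realType) (V : lmodType R[i]) (f : {linear V -> V}).
Implicit Types (a b : R[i]) (u v : V).

Definition eigdiff a v : V := f v - a *: v.

Fact eigdiff_linear a : linear (eigdiff a).
Proof.
move=> k u v; rewrite /eigdiff linearP !scalerDr !scalerA mulrC opprD scalerN scalerA.
by rewrite addrACA.
Qed.
HB.instance Definition _ a := GRing.isLinear.Build R[i] V V _ (eigdiff a) (eigdiff_linear a).

Fact iter_eigdiff_linear N a : linear (iter N (eigdiff a)).
Proof. by elim: N => [|N IH] k u v //=; rewrite IH linearP. Qed.
HB.instance Definition _ N a :=
  GRing.isLinear.Build R[i] V V _ (iter N (eigdiff a)) (iter_eigdiff_linear N a).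

Lemma iter_eigdiff_le N M a v : (N <= M)%N -> iter N (eigdiff a) v = 0 -> iter M (eigdiff a) v = 0.
Proof. by move=> /subnK <- h; rewrite iterD h linear0. Qed.

Lemma geneig0 a : geneig f a 0.
Proof. by exists 0%N. Qed.

Lemma geneig_lin a k u v : geneig f a u -> geneig f a v -> geneig f a (k *: u + v).
Proof.
move=> [N hN] [M hM]; exists (N + M)%N; apply: etrans (iter_eigdiff_linear (N + M) a k u v) _.
by rewrite (iter_eigdiff_le _ hN) ?leq_addr // (iter_eigdiff_le _ hM) ?leq_addl // scaler0 addr0.
Qed.

Lemma geneigD a u v : geneig f a u -> geneig f a v -> geneig f a (u + v).
Proof. by move=> hu hv; rewrite -[u]scale1r; apply: geneig_lin. Qed.

Lemma geneigZ a k u : geneig f a u -> geneig f a (k *: u).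
Proof. by move=> hu; rewrite -[X in geneig f a X]addr0; apply: geneig_lin (geneig0 a). Qed.

Lemma geneigN a u : geneig f a u -> geneig f a (- u).
Proof. by rewrite -scaleN1r; apply: geneigZ. Qed.

Lemma geneig_sum a (T : eqType) (s : seq T) (P : pred T) (x : T -> V) :
  (forall i, i \in s -> P i -> geneig f a (x i)) -> geneig f a (\sum_(i <- s | P i) x i).
Proof.
move=> h; rewrite big_seq_cond; elim/big_rec: _ => [|i y /andP[si Pi] hy]; first exact: geneig0.
by apply: geneigD => //; apply: h.
Qed.

Lemma eigdiffC a b v : eigdiff a (eigdiff b v) = eigdiff b (eigdiff a v).
Proof.
have E c d : eigdiff c (eigdiff d v) = f (f v) - (c + d) *: f v + (c * d) *: v.
  rewrite /eigdiff linearB linearZ /= scalerBr scalerA scalerDl opprB opprD.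
  by rewrite -!addrA; congr (_ + _); rewrite [LHS]addrA [LHS]addrC.
by rewrite !E addrC [a * b]mulrC [a + b]addrC addrC.
Qed.

Lemma iter_eigdiffC N a b v : iter N (eigdiff a) (eigdiff b v) = eigdiff b (iter N (eigdiff a) v).
Proof. by elim: N => //= N ->; rewrite eigdiffC. Qed.

Lemma geneig_eigdiff a b v : geneig f b v -> geneig f b (eigdiff a v).
Proof. by move=> [N hN]; exists N; rewrite -/(eigdiff b) iter_eigdiffC hN linear0. Qed.

Lemma geneig_iter N a b v : geneig f b v -> geneig f b (iter N (eigdiff a) v).
Proof. by move=> h; elim: N => //= N IH; apply: geneig_eigdiff. Qed.

Lemma geneig_disjoint a b v : a != b -> geneig f a v -> geneig f b v -> v = 0.
Proof.
move=> ab [N]; elim: N v => [//|N IH] v hN hb.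
have ev0 u : eigdiff a u = 0 -> geneig f b u -> u = 0.
  move=> /eqP; rewrite subr_eq0 => /eqP fu [M].
  have eu K : iter K (eigdiff b) u = (a - b) ^+ K *: u.
    elim: K => [|K IHK]; first by rewrite scale1r.
    by rewrite iterS IHK /eigdiff linearZ /= fu !scalerA -scalerBl exprSr mulrBr [b * _]mulrC.
  rewrite -/(eigdiff b) eu => /eqP; rewrite scaler_eq0 expf_eq0 subr_eq0 (negPf ab) andbF.
  by move/eqP.
apply: IH => //; apply: ev0; first exact: hN.
exact: geneig_iter.
Qed.

(** A power of f - a kills y a, and it is injective on the other generalized
eigenspaces. *)
Lemma geneig_indep (s : seq R[i]) (y : R[i] -> V) : uniq s ->
  (forall a, a \in s -> geneig f a (y a)) -> \sum_(a <- s) y a = 0 ->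
  forall a, a \in s -> y a = 0.
Proof.
elim: s y => [//|a s IH] y /= /andP[nas us] hy.
rewrite big_cons => sum0.
have [N hN] := hy a (mem_head _ _).
have rest b : b \in s -> y b = 0.
  move=> bs; have ab : a != b by apply: contraNneq nas => ->.
  apply: (@geneig_disjoint a b) => //; last by apply: hy; rewrite inE bs orbT.
  exists N; apply: (IH (fun b => iter N (eigdiff a) (y b))) => // [c cs|].
    by apply: geneig_iter; apply: hy; rewrite inE cs orbT.
  have := congr1 (iter N (eigdiff a)) sum0.
  rewrite linearD /= linear_sum hN add0r => ->; exact: linear0.
move=> b; rewrite inE => /orP[/eqP ->|/rest //].
by move: sum0; rewrite big_seq big1 ?addr0 // => c cs; apply: rest.
Qed.

End GeneralizedEigenspaces.

Section GradedSpaces.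
Variables (R : realType) (V : lmodType R[i]) (I : choiceType) (U : I -> set V).
Hypothesis hU : is_grading U.

Lemma grading0 i : U i 0. Proof. by have [/(_ i)[]] := hU. Qed.

Lemma grading_lin i k u v : U i u -> U i v -> U i (k *: u + v).
Proof. by have [/(_ i)[_ h] _ _] := hU; apply: h. Qed.

Lemma gradingD i u v : U i u -> U i v -> U i (u + v).
Proof. by move=> hu hv; rewrite -[u]scale1r; apply: grading_lin. Qed.

Lemma gradingZ i k u : U i u -> U i (k *: u).
Proof. by move=> hu; rewrite -[X in U i X]addr0; apply: grading_lin => //; exact: grading0. Qed.

Lemma gradingMn i n u : U i u -> U i (u *+ n).
Proof. by move=> hu; rewrite -scaler_nat; apply: gradingZ. Qed.

Lemma grading_decomp v : exists (s : seq I) (x : I -> V),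
  [/\ uniq s, forall i, U i (x i) & v = \sum_(i <- s) x i].
Proof.
have [_ /(_ v)[s [x [hx ->]]] _] := hU.
exists (undup s), (fun i => if i \in s then x i *+ count_mem i s else 0); split.
- exact: undup_uniq.
- move=> i; case: ifP => [/hx[_ xi]|_]; last exact: grading0.
  by apply: gradingMn.
rewrite -big_undup_iterop_count /= big_seq [RHS]big_seq; apply: eq_bigr => i.
by rewrite mem_undup => ->.
Qed.

Lemma grading_indep s (x : I -> V) : uniq s -> (forall i, U i (x i)) ->
  \sum_(i <- s) x i = 0 -> forall i, i \in s -> x i = 0.
Proof. by move=> us hx; have [_ _ h] := hU; apply: h => // i _; apply: hx. Qed.

(** The components with a common eigenvalue sum up to a generalized eigenvector; the
independence of generalized eigenspaces applies to these sums, then that of the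
grading to each of them. *)
Lemma graded_component (f : {linear V -> V}) (phi : I -> R[i]) s (x : I -> V) c y :
  (forall i v, U i v -> geneig f (phi i) v) -> geneig f c y ->
  uniq s -> (forall i, U i (x i)) -> y = \sum_(i <- s) x i ->
  forall i, i \in s -> phi i != c -> x i = 0.
Proof.
move=> hphi hc us hx yE i si ic.
pose ms := undup (c :: [seq phi i | i <- s]).
pose Y m := \sum_(j <- s | phi j == m) x j.
pose Z m := Y m - (if m == c then y else 0).
have YE : \sum_(m <- ms) Y m = y.
  rewrite /Y (exchange_big_dep xpredT) //= yE big_seq [RHS]big_seq; apply: eq_bigr => j js.
  rewrite big_mkcond (bigD1_seq (phi j)) ?undup_uniq //= ?mem_undup.
    by rewrite eqxx big1 ?addr0 // => m; rewrite eq_sym => /negPf ->.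
  by rewrite inE map_f ?orbT.
have Z0 : \sum_(m <- ms) Z m = 0.
  rewrite sumrB YE (bigD1_seq c) ?undup_uniq ?mem_undup ?mem_head //=.
  by rewrite eqxx big1 ?addr0 ?subrr // => m /negPf ->.
have Zi : Z (phi i) = 0.
  apply: (geneig_indep (undup_uniq _) _ Z0); last by rewrite mem_undup inE map_f ?orbT.
  move=> m _; apply: geneigD.
    by apply: geneig_sum => j _ /eqP <-; apply: hphi.
  by apply: geneigN; case: eqP => [->|_] //; exact: geneig0.
have : \sum_(j <- s | phi j == phi i) x j = 0.
  by move: Zi; rewrite /Z (negPf ic) subr0.
rewrite -big_filter => h; apply: (grading_indep _ hx h).
  exact: filter_uniq.
by rewrite mem_filter eqxx.
Qed.

Lemma sum_of_subspace (Q : I -> Prop) : is_subspace (sum_of U Q).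
Proof.
split; first by exists [::], (fun=> 0); split => //; rewrite big_nil.
move=> a _ _ [s [x [hx ->]]] [t [y [hy ->]]].
pose X i := if i \in s then x i else 0; pose Y i := if i \in t then y i else 0.
have hX i : U i (X i) by rewrite /X; case: ifP => [/hx[]//|_]; exact: grading0.
have hY i : U i (Y i) by rewrite /Y; case: ifP => [/hy[]//|_]; exact: grading0.
exists (undup (s ++ t)),
  (fun i => a *: (X i *+ count_mem i s) + Y i *+ count_mem i t); split.
  move=> i; rewrite mem_undup mem_cat => ist; split.
    by case/orP: ist => [/hx[]|/hy[]].
  by apply: gradingD; [apply: gradingZ|]; exact: gradingMn.
have expand (r : seq I) (z Z : I -> V) : {subset r <= s ++ t} -> (forall i, i \in r -> Z i = z i) ->
   \sum_(i <- r) z i = \sum_(i <- undup (s ++ t)) Z i *+ count_mem i r.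
  move=> sub zZ; rewrite -big_undup_iterop_count /=.
  rewrite [RHS](bigID (mem r)) /= [X in _ = _ + X]big1 ?addr0 => [|i nr]; last first.
    by rewrite (count_memPn nr).
  have -> : \sum_(i <- undup (s ++ t) | mem r i) Z i *+ count_mem i r =
      \sum_(i <- undup r) Z i *+ count_mem i r.
    rewrite -big_filter; apply: perm_big; apply: uniq_perm; rewrite ?filter_uniq ?undup_uniq //.
    by move=> i; rewrite mem_filter !mem_undup /=; have [/sub ->|//] := boolP (i \in r).
  by rewrite big_seq [RHS]big_seq; apply: eq_bigr => i; rewrite mem_undup => ir; rewrite zZ.
rewrite big_split /= -scaler_sumr; congr (_ *: _ + _); apply: expand => i ir.
- by rewrite mem_cat ir.
- by rewrite /X ir.
- by rewrite mem_cat ir orbT.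
by rewrite /Y ir.
Qed.

Lemma sum_of_mem (Q : I -> Prop) i v : Q i -> U i v -> sum_of U Q v.
Proof.
move=> Qi Uv; exists [:: i], (fun=> v); split; last by rewrite big_seq1.
by move=> j; rewrite inE => /eqP ->.
Qed.

(** A maximal subspace that contains the other graded pieces and avoids a nonzero
component of v is a hyperplane; phi is the coordinate along this component. *)
Lemma separating_functional v : v != 0 -> exists i (phi : {scalar V}),
  (forall j u, j != i -> U j u -> phi u = 0) /\ phi v != 0.
Proof.
move=> v0; have [s [x [us hx vE]]] := grading_decomp v.
have /hasP[k ks xk0] : has (fun k => x k != 0) s.
  apply: contraNT v0 => /hasPn h; rewrite vE big_seq big1 // => k /h.
  by rewrite negbK => /eqP.
pose A := sum_of U (fun j => j != k); have Asub : is_subspace A := sum_of_subspace _.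
have Ae : ~ A (x k).
  move=> [t [y [hy xE]]].
  have [_ _ indep] := hU.
  pose z j := if j == k then x k else - (if j \in t then y j *+ count_mem j t else 0).
  have ksn : k \notin undup t by rewrite mem_undup; apply/negP => /hy[]; rewrite eqxx.
  have hz : \sum_(j <- k :: undup t) z j = 0.
    rewrite big_cons /z eqxx xE -big_undup_iterop_count /=.
    rewrite [X in X + _]big_seq [X in _ + X]big_seq -big_split big1 // => j /=.
    rewrite mem_undup => jt; rewrite jt; have [jk|_] := eqVneq j k.
      by move: ksn; rewrite mem_undup -jk jt.
    by rewrite subrr.
  have := indep (k :: undup t) z; rewrite /= ksn undup_uniq => /(_ isT).
  move=> /(_ _ hz k); rewrite mem_head /z eqxx => zk.
  move/eqP: xk0; apply; apply: zk => // j.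
  rewrite inE mem_undup; have [-> _|jk /= jt] := eqVneq j k; first exact: hx.
  by rewrite jt -scaleN1r; apply: gradingZ; apply: gradingMn; have [] := hy _ jt.
pose P (X : set V) := is_subspace (X `|` A) /\ ~ (X `|` A) (x k).
have [H [[Hsub He] Hmax]] : exists H, P H /\ forall B, (H `<` B)%classic -> ~ P B.
  apply: Zorn_bigcup => F FP tot; split; last first.
    by move=> [[X FX Xe]|//]; have [_ []] := FP _ FX; left.
  split; first by right; have [] := Asub.
  move=> a u w.
  have main X : F X -> (X `|` A) u -> (X `|` A) w -> (\bigcup_(X in F) X `|` A) (a *: u + w).
    move=> FX hu hw; have [[_ h] _] := FP _ FX.
    by have [hh|hh] := h a _ _ hu hw; [left; exists X|right].
  move=> [[X FX Xu]|Au] [[Y FY Yw]|Aw].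
  - have [XY|YX] := tot _ _ FX FY; first by apply: (main Y) => //; left => //; apply: XY.
    by apply: (main X) => //; left => //; apply: YX.
  - by apply: (main X) => //; [left|right].
  - by apply: (main Y) => //; [right|left].
  by right; have [_ h] := Asub; apply: h.
pose K := H `|` A; have [K0 Klin] := Hsub.
have KB u w : K u -> K w -> K (u - w).
  by move=> Ku Kw; rewrite addrC -scaleN1r; apply: Klin.
have KZ a u : K u -> K (a *: u) by move=> Ku; rewrite -[X in K X]addr0; apply: Klin.
have ex u : exists c, K (u - c *: x k).
  apply: contrapT => none.
  pose B := [set w | exists c h, K h /\ w = c *: u + h].
  have Bsub : is_subspace B.
    split; first by exists 0, 0; rewrite scale0r addr0.
    move=> a _ _ [c [h [Kh ->]]] [c' [h' [Kh' ->]]].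
    exists (a * c + c'), (a *: h + h'); split; first exact: Klin.
    by rewrite scalerDl scalerDr scalerA addrACA.
  have KBs : K `<=` B by move=> w Kw; exists 0, w; rewrite scale0r add0r.
  have BA : B `|` A = B by apply/setUidPl => w Aw; apply: KBs; right.
  apply: (Hmax B).
    split; first by move=> h Hh; apply: KBs; left.
    move=> /(_ u) h; apply: none; exists 0; rewrite scale0r subr0; left; apply: h.
    by exists 1, 0; rewrite scale1r addr0.
  split; rewrite BA // => -[c [h [Kh xkE]]].
  have [c0|c0] := eqVneq c 0.
    by apply: He; rewrite xkE c0 scale0r add0r.
  apply: none; exists c^-1; rewrite xkE scalerDr scalerA mulVf // scale1r opprD addrA subrr add0r.
  by rewrite -scaleNr; apply: KZ.
have uniqc u c d : K (u - c *: x k) -> K (u - d *: x k) -> c = d.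
  move=> h1 h2; apply/eqP; rewrite -subr_eq0; apply/negPn/negP => cd; apply: He.
  have -> : x k = (c - d)^-1 *: ((u - d *: x k) - (u - c *: x k)).
    have -> : (u - d *: x k) - (u - c *: x k) = (c - d) *: x k.
      by rewrite scalerBl opprB addrC addrA subrK.
    by rewrite scalerA mulVf // scale1r.
  by apply: KZ; apply: KB.
pose phi u := projT1 (cid (ex u)).
have phiP u : K (u - phi u *: x k) by rewrite /phi; case: cid.
have lin : scalar phi.
  move=> a u w; apply: (uniqc (a *: u + w)); first exact: phiP.
  rewrite scalerDl -scalerA opprD addrACA -scalerBr.
  by apply: Klin; exact: phiP.
have [Phi PhiE] : exists Phi : {scalar V}, forall u, Phi u = phi u.
  pose F : {scalar V} := HB.pack phi (GRing.isLinear.Build R[i] V R[i] _ phi lin).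
  by exists F.
exists k, Phi; split.
  move=> j u jk Uu; rewrite PhiE; apply: (uniqc u); first exact: phiP.
  by rewrite scale0r subr0; right; apply: (sum_of_mem jk).
have phik : Phi (x k) = 1.
  by rewrite PhiE; apply: (uniqc (x k)); [exact: phiP|rewrite scale1r subrr].
rewrite vE (bigD1_seq k) // linearD phik linear_sum big1 ?addr0 ?oner_neq0 // => j jk.
rewrite PhiE; apply: (uniqc (x j)); first exact: phiP.
by rewrite scale0r subr0; right; apply: (sum_of_mem jk).
Qed.

End GradedSpaces.

(** * Weights and truncation *)

Section LinearMaps.
Variables (K : pzRingType) (U V : lmodType K) (f : U -> V).
Hypothesis hf : linear f.

Lemma lin0 : f 0 = 0.
Proof. by have := hf (-1) 0 0; rewrite scaler0 addr0 scaleN1r addNr. Qed.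
Lemma linD u v : f (u + v) = f u + f v.
Proof. by have := hf 1 u v; rewrite !scale1r. Qed.
Lemma linZ k u : f (k *: u) = k *: f u.
Proof. by have := hf k u 0; rewrite lin0 !addr0. Qed.
Lemma linN u : f (- u) = - f u.
Proof. by rewrite -scaleN1r linZ scaleN1r. Qed.
Lemma linB u v : f (u - v) = f u - f v.
Proof. by rewrite linD linN. Qed.
Lemma lin_sum (T : Type) (s : seq T) (P : pred T) (x : T -> U) :
  f (\sum_(i <- s | P i) x i) = \sum_(i <- s | P i) f (x i).
Proof. by apply: (big_morph f linD lin0). Qed.
Lemma linMn n u : f (u *+ n) = f u *+ n.
Proof. by rewrite -scaler_nat linZ scaler_nat. Qed.
End LinearMaps.

Section VertexSuperalgebra.
Variables (R : realType) (V : gr_vertex_superalgebra R) (g : vautomorphism V).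
Implicit Types (u v : V).

(** L(0) has eigenvalue n + a/2 + b/2 on the coefficient, which is below all weights
of V. *)
Lemma YV_trunc : exists B : int, forall (a b n : int) u v, vgr a u -> vgr b v ->
  2 * n + a + b < B -> YV u v n = 0.
Proof.
have [B hB] := vgr_bounded V; exists B => a b n u v ua vb lt.
have hV := vgr_grading V.
have eig : geneig (LV0 V) ((2 * n + a + b)%:~R / 2) (YV u v n).
  exists 1%N => /=; apply/eqP; rewrite subr_eq0; apply/eqP.
  have /eqP := LV0_comm u v n; rewrite subr_eq => /eqP ->.
  rewrite (LV0_def ua) (LV0_def vb) (linZ (YV_linearl v n)) (linZ (YV_linearr u n)).
  rewrite /zxddx -!scalerDl; congr (_ *: _).
  by rewrite !rmorphD rmorphM /=; field.
have wt i x : vgr i x -> geneig (LV0 V) (i%:~R / 2) x.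
  by move=> xi; exists 1%N => /=; rewrite (LV0_def xi) subrr.
have [s [x [us hx e]]] := grading_decomp hV (YV u v n).
rewrite e big_seq big1 // => i si.
have [iE|iE] := eqVneq i (2 * n + a + b); first by apply: (hB i); [rewrite iE|exact: hx].
apply: (graded_component hV wt eig us hx e si).
by apply: contra iE => /eqP/(divIf _)/eqP; rewrite pnatr_eq0 eqr_int => /(_ isT).
Qed.

Lemma iter_vaut_wt N (lam : R[i]) n v : vgr n v -> vgr n (iter N (eigdiff g lam) v).
Proof.
move=> vn; elim: N => //= N IH; have hV := vgr_grading V.
rewrite /eigdiff addrC -scaleNr; apply: grading_lin => //.
exact: vaut_wt.
Qed.

Lemma geneig_component (lam : R[i]) v s (x : int -> V) : geneig g lam v ->
  uniq s -> (forall i, vgr i (x i)) -> v = \sum_(i <- s) x i ->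
  forall i, i \in s -> geneig g lam (x i).
Proof.
move=> [N hN] us hx vE i si; exists N.
have hV := vgr_grading V.
apply: (grading_indep hV (x := fun i => iter N (eigdiff g lam) (x i)) us) => //.
  by move=> j; apply: iter_vaut_wt.
by move: hN; rewrite -/(eigdiff g lam) vE linear_sum.
Qed.

Lemma geneig_vaut (lam : R[i]) v : geneig g lam v -> geneig g lam (g v).
Proof.
have -> : g v = eigdiff g 0 v by rewrite /eigdiff scale0r subr0.
exact: geneig_eigdiff.
Qed.

Lemma vgr_parity i v : vgr i v -> vparity (~~ (2 %| i)%Z) v.
Proof. by move=> vi; apply: (sum_of_mem (i := i)). Qed.

End VertexSuperalgebra.

Section TwistedModule.
Variables (R : realType) (V : gr_vertex_superalgebra R) (g : vautomorphism V)
  (W : gtwisted_module g).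
Local Notation C := (R[i]).
Implicit Types (u v : V) (w : W) (n m : C).
Local Notation G := (geneig (LW0 W)).
Local Notation YWl := (@YW_linearl R V g W).
Local Notation YWr := (@YW_linearr R V g W).

Lemma wgr_geneig (x : C * bool * C) w : wgr x w -> G x.1.1 w.
Proof. by move=> wx; apply: LW0_nilp; apply: (sum_of_mem (i := x)). Qed.

Lemma geneig_wt_decomp m w : G m w -> exists s (x : C * bool * C -> W),
  [/\ uniq s, forall i, wgr i (x i), w = \sum_(i <- s) x i &
   forall i, i \in s -> i.1.1 != m -> x i = 0].
Proof.
move=> hw; have hg := wgr_grading W; have [s [x [us hx wE]]] := grading_decomp hg w.
exists s, x; split=> // i si; apply: (graded_component hg (phi := fun i => i.1.1) _ hw us hx wE) => //.
exact: wgr_geneig.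
Qed.

(** By the commutator formula with L(0), L(0) - c maps the mode of power j of log x to
a mode applied to (L(0) - m)w plus a multiple of the mode of power j + 1.  Induction
on the nilpotency index for w, and downwards on j from a power above all those that
occur. *)
Lemma YW_wt (a : int) u m w n j : vgr a u -> G m w -> G (m + a%:~R / 2 + n) (YW u w n j).
Proof.
move=> ua [N]; set c := m + _ + n.
have key w1 j1 : eigdiff (LW0 W) c (YW u w1 n j1) =
    YW u (eigdiff (LW0 W) m w1) n j1 + j1.+1%:R *: YW u w1 n j1.+1.
  have /eqP := LW0_comm u w1 n j1; rewrite subr_eq => /eqP e.
  rewrite /eigdiff e (LV0_def ua) (linZ (YWl w1 n j1)) (linB (YWr u n j1)) (linZ (YWr u n j1)).
  rewrite /cxddx /c !scalerDl !opprD.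
  set A := YW u _ n j1; set B := _ *: YW u w1 n j1.+1; set D := YW u w1 n j1.
  rewrite [LHS](AC (4*3) ((1*7)*(3*6)*(4*5)*2))/=.
  by rewrite !subrr !add0r.
elim: N w j => [|N IH] w j.
  by move=> /= ->; rewrite (lin0 (YWr u n j)); exact: geneig0.
rewrite iterSr => hN.
have [K hK] := YW_log u w.
have step i : G c (YW u w n i.+1) -> G c (YW u w n i).
  move=> h; have [M hM] : G c (eigdiff (LW0 W) c (YW u w n i)).
    by rewrite key; apply: geneigD; [exact: IH|exact: geneigZ].
  by exists M.+1; rewrite iterSr.
have top : G c (YW u w n (K.+1 + j)) by rewrite hK ?addSn ?ltnS ?leq_addr //; exact: geneig0.
have down k : G c (YW u w n (k + j)) -> G c (YW u w n j).
  elim: k => [|k IHk] h; first by rewrite -[j]add0n.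
  by apply: IHk; apply: step; rewrite -addSn.
exact: down top.
Qed.

(** Unlike the weight spaces, these subspaces are respected, up to a shift, by the modes
of vectors that are not homogeneous. *)
Definition filt (c1 c2 : R) w : Prop := exists2 s : seq (C * W),
  w = \sum_(t <- s) t.2 & forall t, t \in s -> G t.1 t.2 /\ c1 <= complex.Re t.1 <= c2.

Lemma filtD c1 c2 w w1 : filt c1 c2 w -> filt c1 c2 w1 -> filt c1 c2 (w + w1).
Proof.
move=> [s -> hs] [t -> ht]; exists (s ++ t); first by rewrite big_cat.
by move=> x; rewrite mem_cat => /orP[/hs|/ht].
Qed.

Lemma filt0 c1 c2 : filt c1 c2 0.
Proof. by exists [::]; rewrite ?big_nil. Qed.

Lemma filt_sum c1 c2 (T : eqType) (s : seq T) (x : T -> W) :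
  (forall i, i \in s -> filt c1 c2 (x i)) -> filt c1 c2 (\sum_(i <- s) x i).
Proof.
move=> h; rewrite big_seq; elim/big_rec: _ => [|i y si hy]; first exact: filt0.
by apply: filtD => //; apply: h.
Qed.

Lemma filt_geneig c1 c2 m w : G m w -> c1 <= complex.Re m <= c2 -> filt c1 c2 w.
Proof. by move=> hw hm; exists [:: (m, w)]; rewrite ?big_seq1 // => t; rewrite inE => /eqP ->. Qed.

Lemma sum_norm_bound (T : eqType) (s : seq T) (F : T -> R) t : t \in s ->
  `|F t| <= \sum_(i <- s) `|F i|.
Proof. by move=> ts; rewrite (big_rem t) //= lerDl sumr_ge0. Qed.

Lemma filt_exists w : exists K : R, filt (- K) K w.
Proof.
have [s [x [us hx ->]]] := grading_decomp (wgr_grading W) w.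
exists (\sum_(i <- s) `|complex.Re i.1.1|); apply: filt_sum => i si.
apply: filt_geneig (wgr_geneig (hx i)) _.
by rewrite -ler_norml; exact: (sum_norm_bound (fun i : C * bool * C => complex.Re i.1.1)).
Qed.

Lemma filt_YW u : exists K : R, forall c1 c2 w n j, filt c1 c2 w ->
  filt (c1 - K + complex.Re n) (c2 + K + complex.Re n) (YW u w n j).
Proof.
have [s [x [us hx uE]]] := grading_decomp (vgr_grading V) u.
exists (\sum_(i <- s) `|i%:~R / 2 : R|) => c1 c2 _ n j [l -> hl].
rewrite (lin_sum (YWr u n j)); apply: filt_sum => t /hl[tG /andP[t1 t2]].
rewrite uE (lin_sum (YWl t.2 n j)); apply: filt_sum => i si.
apply: filt_geneig (YW_wt n j (hx i) tG) _.
have -> : complex.Re (t.1 + i%:~R / 2 + n) = complex.Re t.1 + i%:~R / 2 + complex.Re n.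
  have -> : (i%:~R / 2 : C) = (i%:~R / 2 : R)%:C by rewrite rmorphM rmorph_int fmorphV rmorph_nat.
  by case: (t.1) (n) => [? ?] [? ?].
have := sum_norm_bound (fun i : int => i%:~R / 2 : R) si.
rewrite ler_norml; move: (\sum_(i <- s) _) => K; lra.
Qed.

Lemma wdual_geneig (w' : {scalar W}) : wdual w' ->
  exists T : seq C, forall m w, G m w -> m \notin T -> w' w = 0.
Proof.
move=> [T hT]; exists [seq i.1.1 | i <- T] => m w /geneig_wt_decomp[s [x [us hx -> x0]]] mT.
rewrite linear_sum big_seq big1 // => i si.
have [e|ne] := eqVneq i.1.1 m; last by rewrite x0 // linear0.
apply: (hT i) => //; apply: contra mT => iT; rewrite -e.
exact: (map_f (fun i : C * bool * C => i.1.1)).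
Qed.

Lemma wdual_filt (w' : {scalar W}) : wdual w' ->
  exists K : R, forall c1 c2 w, filt c1 c2 w -> K < c1 \/ c2 < - K -> w' w = 0.
Proof.
move=> /wdual_geneig[T hT]; exists (\sum_(m <- T) `|complex.Re m|) => c1 c2 _ [l -> hl] hK.
rewrite linear_sum big_seq big1 // => t /hl[tG /andP[t1 t2]].
apply: (hT t.1) => //; apply/negP => tT.
have := sum_norm_bound (fun m : C => complex.Re m) tT.
rewrite ler_norml => /andP[]; move: (\sum_(i <- T) _) hK => K; lra.
Qed.

Lemma separation w : (forall i (w' : {scalar W}),
  (forall j y, j != i -> wgr j y -> w' y = 0) -> w' w = 0) -> w = 0.
Proof.
move=> h; apply/eqP/negPn/negP => /(separating_functional (wgr_grading W))[i [w' [h1 /negP h2]]].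
by apply: h2; apply/eqP; apply: (h i).
Qed.

Lemma single_wdual i (w' : {scalar W}) :
  (forall j y, j != i -> wgr j y -> w' y = 0) -> wdual w'.
Proof. by move=> h; exists [:: i] => j; rewrite inE => ji y; exact: h. Qed.

Lemma single_geneig i (w' : {scalar W}) m w :
  (forall j y, j != i -> wgr j y -> w' y = 0) -> G m w -> m != i.1.1 -> w' w = 0.
Proof.
move=> h /geneig_wt_decomp[s [x [us hx -> x0]]] mi.
rewrite linear_sum big_seq big1 // => j sj.
have [ji|ji] := eqVneq j i; last exact: (h j).
by rewrite x0 ?linear0 // ji eq_sym.
Qed.

(** Makes finite the sums over exponents in which equivariance is expressed. *)
Lemma wdual_supp (w' : {scalar W}) u w : wdual w' ->
  exists s : seq C, forall n j, n \notin s -> w' (YW u w n j) = 0.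
Proof.
move=> /wdual_geneig[T hT].
have [s [x [us hx uE]]] := grading_decomp (vgr_grading V) u.
have [t [y [ut hy wE]]] := grading_decomp (wgr_grading W) w.
exists [seq p.1 - (p.2.1.1 + i%:~R / 2) | p <- [seq (a, k) | a <- T, k <- t], i <- s] => n j hn.
rewrite wE (lin_sum (YWr u n j)) linear_sum big_seq big1 // => k kt.
rewrite uE (lin_sum (YWl _ n j)) linear_sum big_seq big1 // => i si.
apply: (hT (k.1.1 + i%:~R / 2 + n)); first exact: YW_wt (wgr_geneig (hy k)).
apply: contra hn => hm.
apply/allpairsP; exists ((k.1.1 + i%:~R / 2 + n, k), i); split=> //=.
  by apply/allpairsP; exists (k.1.1 + i%:~R / 2 + n, k).
by rewrite addrAC subrr add0r.
Qed.

Section LowerBounded.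
Hypothesis hW : lower_bounded W.

Lemma filt_eq0 : exists B : R, forall c1 c2 w, filt c1 c2 w -> c2 < B -> w = 0.
Proof.
have [B hB] := hW; exists B => c1 c2 _ [l -> hl] c2B.
rewrite big_seq big1 // => t /hl[tG /andP[t1 t2]].
have [s [x [us hx -> x0]]] := geneig_wt_decomp tG.
rewrite big_seq big1 // => i si.
have [e|ne] := eqVneq i.1.1 t.1; last exact: x0.
apply: (hB i.1.1); first by rewrite e; lra.
exact: (sum_of_mem (i := i)).
Qed.

Lemma YW_trunc u w : exists b : int, forall n j, complex.Re n < b%:~R -> YW u w n j = 0.
Proof.
have [B hB] := filt_eq0; have [K hK] := filt_YW u; have [L hL] := filt_exists w.
exists (Num.floor (B - L - K)) => n j hn.
apply: (hB _ _ _ (hK _ _ w n j hL)).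
have := Num.Theory.floor_le (B - L - K); lra.
Qed.

End LowerBounded.
End TwistedModule.

(** * Monodromy and powers of the logarithm *)

Lemma fsbigT_seq (U : nmodType) (T : choiceType) (r : seq T) (f : T -> U) :
  uniq r -> (forall i, i \notin r -> f i = 0) ->
  \sum_(i \in [set: T]) f i = \sum_(i <- r) f i.
Proof.
move=> ur h; rewrite (fsbigE r) // => [|i _]; last exact: h.
by apply: eq_bigl => i; rewrite in_setT.
Qed.

Section Monodromy.
Variables (R : realType) (V : gr_vertex_superalgebra R) (g : vautomorphism V)
  (W : gtwisted_module g).
Local Notation C := (R[i]).
Implicit Types (u v : V) (n m : C).
Local Notation YWl := (@YW_linearl R V g W).
Local Notation YWr := (@YW_linearr R V g W).

Lemma subst_termE (U : lmodType C) (f : C -> nat -> U) p z n K :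
  (forall j, (K <= j)%N -> f n j = 0) ->
  subst_term f p z n = \sum_(j < K) (cexp (n * lp p z) * lp p z ^+ j) *: f n j.
Proof.
move=> f0; rewrite /subst_term -(big_mkord xpredT (fun j => (cexp (n * lp p z) * lp p z ^+ j) *: f n j)).
apply: fsbigT_seq; first exact: iota_uniq.
move=> j; rewrite /index_iota subn0 mem_iota add0n /= -leqNgt => /f0 ->.
exact: scaler0.
Qed.

(** The polynomial in log x that multiplies x^n in the matrix coefficient of Y(u,x). *)
Definition logpoly (w' : {scalar W}) u w n : {poly C} :=
  \poly_(j < (projT1 (cid (YW_log u w))).+1) w' (YW u w n j).

Lemma coef_logpoly (w' : {scalar W}) u w n j : (logpoly w' u w n)`_j = w' (YW u w n j).
Proof.
rewrite coef_poly; case: cid => K hK /=; case: ltnP => // Kj.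
by rewrite hK // linear0.
Qed.

Lemma subst_term_logpoly (w' : {scalar W}) u w p z n :
  w' (subst_term (YW u w) p z n) = cexp (n * lp p z) * (logpoly w' u w n).[lp p z].
Proof.
rewrite /logpoly; case: cid => K hK /=; rewrite (@subst_termE _ _ _ _ _ K.+1); last first.
  by move=> j; exact: hK.
rewrite linear_sum horner_poly mulr_sumr; apply: eq_bigr => j _.
by rewrite linearZ /=; ring.
Qed.

Definition twopii : C := 0 +i* (2 * pi).

Lemma twopii_neq0 : twopii != 0.
Proof. by rewrite eq_complex /= eqxx /= mulf_neq0 // gt_eqF ?pi_gt0. Qed.

(** On the positive real axis, equivariance equates two exponential polynomials in
log x; their coefficients agree by [epoly_decay] with the zero bound. *)
Lemma logpoly_vaut (w' : {scalar W}) u w n : wdual w' ->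
  logpoly w' u w n = cexp (n * twopii) *: shiftp twopii (logpoly w' (g u) w n).
Proof.
move=> hw'; have [s hs] := wdual_supp u w hw'; have [t ht] := wdual_supp (g u) w hw'.
have lp0 v m : (forall j, w' (YW v w m j) = 0) -> logpoly w' v w m = 0.
  by move=> h; apply/polyP => j; rewrite coef_logpoly h coef0.
pose S := undup (s ++ t).
pose P m := cexp (m * twopii) *: shiftp twopii (logpoly w' (g u) w m) - logpoly w' u w m.
have P0 m : m \notin S -> P m = 0.
  rewrite mem_undup mem_cat negb_or => /andP[ms mt].
  rewrite /P !lp0 //; first by rewrite /shiftp comp_poly0 scaler0 subr0.
  - by move=> j; exact: hs.
  - by move=> j; exact: ht.
apply/eqP; rewrite eq_sym -subr_eq0 -/(P n); apply/eqP.
have [nS|/P0 //] := boolP (n \in S).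
apply: (@epoly_decay _ S P (complex.Re n - 1) 0 0) => //; last by lra.
  exact: undup_uniq.
move=> r _; rewrite mul0r.
have y0 : 0 < expR r := expR_gt0 r.
have z0 : (expR r)%:C != 0 :> C by rewrite eq_complex /= eqxx andbT gt_eqF.
have e := @YW_equivariance _ _ _ W 0 u _ w w' z0 hw'.
have fsE v p (S' : seq C) : (forall m, m \notin S' -> forall j, w' (YW v w m j) = 0) -> uniq S' ->
    \sum_(m \in [set: C]) w' (subst_term (YW v w) p (expR r)%:C m) =
    \sum_(m <- S') w' (subst_term (YW v w) p (expR r)%:C m).
  move=> h uS; apply: fsbigT_seq => // m mS.
  by rewrite subst_term_logpoly lp0 ?horner0 ?mulr0 //; exact: h.
move: e; rewrite !(fsE _ _ S) ?undup_uniq //; last 2 first.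
- by move=> m; rewrite mem_undup mem_cat negb_or => /andP[/hs h _] j; exact: h.
- by move=> m; rewrite mem_undup mem_cat negb_or => /andP[_ /ht h] j; exact: h.
move=> e.
suff -> : epoly S P r = 0 by rewrite normc0.
rewrite /epoly /P; under eq_bigr do rewrite hornerD hornerN hornerZ horner_shiftp mulrBl.
rewrite sumrB; apply/eqP; rewrite subr_eq0; apply/eqP.
have -> : \sum_(m <- S) (logpoly w' u w m).[r%:C] * cexp (m * r%:C) =
  \sum_(m <- S) w' (subst_term (YW u w) 0 (expR r)%:C m).
  apply: eq_bigr => m _; rewrite subst_term_logpoly lp_pos // expRK mul0r addr0; ring.
rewrite -e; apply: eq_bigr => m _; rewrite subst_term_logpoly lp_pos // expRK mul1r -/twopii.
by rewrite mulrDr cexpD; ring.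
Qed.

Lemma logpoly_gu (w' : {scalar W}) u w n : wdual w' ->
  logpoly w' (g u) w n = cexp (- (n * twopii)) *: shiftp (- twopii) (logpoly w' u w n).
Proof.
move=> hw'; rewrite (logpoly_vaut u w n hw') /shiftp comp_polyZ scalerA -cexpD addNr cexp0 scale1r.
rewrite -comp_polyA comp_polyD comp_polyX comp_polyC -addrA -polyCD addNr addr0.
by rewrite comp_polyXr.
Qed.

Lemma logpoly_lin (w' : {scalar W}) w n k u v :
  logpoly w' (k *: u + v) w n = k *: logpoly w' u w n + logpoly w' v w n.
Proof.
apply/polyP => j; rewrite coefD coefZ !coef_logpoly YWl.
by rewrite linearP.
Qed.

(** With c = e^{-2 pi i n}, the effect on [logpoly] of replacing u by (g - lam)u. *)
Definition twist_step (c lam : C) (p : {poly C}) : {poly C} :=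
  c *: shiftp (- twopii) p - lam *: p.

Lemma logpoly_eigdiff (w' : {scalar W}) (lam : C) u w n N : wdual w' ->
  logpoly w' (iter N (eigdiff g lam) u) w n =
  iter N (twist_step (cexp (- (n * twopii))) lam) (logpoly w' u w n).
Proof.
move=> hw'; elim: N => //= N <-; move: (iter N _ u) => v.
by rewrite /eigdiff addrC -scaleNr logpoly_lin logpoly_gu // scaleNr addrC.
Qed.

Lemma twist_step_size c lam p : c != lam -> size (twist_step c lam p) = size p.
Proof.
move=> clam; have [->|p0] := eqVneq p 0.
  by rewrite /twist_step /shiftp comp_poly0 !scaler0 subrr.
apply/eqP; rewrite eqn_leq; apply/andP; split.
  rewrite (leq_trans (size_polyD _ _)) // size_polyN geq_max.
  by rewrite !(leq_trans (size_scale_leq _ _)) ?size_shiftp.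
rewrite leqNgt; apply/negP => lt.
have : (twist_step c lam p)`_(size p).-1 = 0.
  by apply/leq_sizeP: (leqnn (size p).-1); rewrite -ltnS prednK ?size_poly_gt0.
rewrite coefB !coefZ -{1}(size_shiftp (- twopii) p) -!/(lead_coef _) lead_coef_shiftp -mulrBl.
by move/eqP; rewrite mulf_eq0 subr_eq0 (negPf clam) lead_coef_eq0 (negPf p0).
Qed.

Lemma twist_step_size_eq lam p : lam != 0 -> size (twist_step lam lam p) = (size p).-1.
Proof.
move=> l0; rewrite /twist_step -scalerBr size_scale // size_diffp // oppr_eq0.
exact: twopii_neq0.
Qed.

Lemma wdual_eq0 (w : W) : (forall w' : {scalar W}, wdual w' -> w' w = 0) -> w = 0.
Proof. by move=> h; apply: separation => i w' hi; apply: h; exact: single_wdual hi. Qed.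

Lemma eigenvalE (alpha : C) : eigenval alpha = cexp (alpha * twopii).
Proof. by rewrite /eigenval mulrC. Qed.

(** For the other exponents n, e^{-2 pi i n} differs from the eigenvalue, so [twist_step]
keeps degrees; but g - e^{2 pi i alpha} is nilpotent on u. *)
Lemma YW_class (alpha : C) u (w : W) n j : vgweight g alpha u ->
  (forall k : int, n != k%:~R - alpha) -> YW u w n j = 0.
Proof.
move=> [N hN] hn; apply: wdual_eq0 => w' hw'; rewrite -coef_logpoly.
have neq : cexp (- (n * twopii)) != eigenval alpha.
  apply/eqP => e; have := cexpD (n * twopii) (alpha * twopii).
  rewrite -(eigenvalE alpha) -e cexpN divff ?cexp_neq0 // -mulrDl => /cexp_eq1[k].
  move/(mulIf twopii_neq0) => nk; have /eqP := hn k; apply.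
  by rewrite -nk addrK.
have sz M : size (iter M (twist_step (cexp (- (n * twopii))) (eigenval alpha)) (logpoly w' u w n))
    = size (logpoly w' u w n).
  by elim: M => //= M <-; rewrite twist_step_size.
have := sz N; rewrite -logpoly_eigdiff // hN.
have -> : logpoly w' 0 w n = 0.
  by apply/polyP => i; rewrite coef_logpoly (lin0 (YWl w n i)) linear0 coef0.
by rewrite size_poly0 => /esym/eqP; rewrite size_poly_eq0 => /eqP ->; rewrite coef0.
Qed.

Lemma cexp_class (alpha : C) (k : int) : cexp (- ((k%:~R - alpha) * twopii)) = eigenval alpha.
Proof. by rewrite eigenvalE mulrBl opprB cexpD cexpN cexp_2pi invr1 mulr1. Qed.

(** For n in -alpha + Z each [twist_step] lowers the degree by exactly one, so the
nilpotency index of u bounds the size of [logpoly]. *)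
Lemma YW_logdeg (alpha : C) u : vgweight g alpha u ->
  exists d, forall (w : W) n j, (d <= j)%N -> YW u w n j = 0.
Proof.
move=> hu; have [N hN] := hu; exists N => w n j Nj.
have [[k nk]|/forallNP h] := pselect (exists k : int, n = k%:~R - alpha); last first.
  by apply: (YW_class (alpha := alpha)) => // k; apply/eqP/h.
apply: wdual_eq0 => w' hw'; rewrite -coef_logpoly.
have sz M : size (iter M (twist_step (cexp (- (n * twopii))) (eigenval alpha)) (logpoly w' u w n))
    = (size (logpoly w' u w n) - M)%N.
  rewrite nk cexp_class; elim: M => [|M IH]; first by rewrite subn0.
  by rewrite /= twist_step_size_eq ?cexp_neq0 // IH -subnS.
have := sz N; rewrite -logpoly_eigdiff // hN.
have -> : logpoly w' 0 w n = 0.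
  by apply/polyP => i; rewrite coef_logpoly (lin0 (YWl w n i)) linear0 coef0.
rewrite size_poly0 => /esym/eqP; rewrite subn_eq0 => h.
by rewrite nth_default // (leq_trans h).
Qed.

Lemma coef_shiftp (s : C) (p : {poly C}) d j : (size p <= d)%N ->
  (shiftp s p)`_j = \sum_(m < d) p`_m * (s ^+ (m - j) *+ 'C(m, j)).
Proof.
move=> pd; rewrite /shiftp comp_polyE coef_sum.
rewrite (big_ord_widen_cond d xpredT (fun i => (p`_i *: ('X + s%:P) ^+ i)`_j) pd).
rewrite big_mkcond; apply: eq_bigr => m _; case: ifPn => [_|/= ms]; last first.
  by rewrite nth_default ?mul0r // leqNgt.
rewrite coefZ; congr (_ * _); rewrite [X in X ^+ _]addrC exprDn coef_sum.
have E (i : 'I_m.+1) : (s%:P ^+ (m - i) * 'X^i *+ 'C(m, i))`_j =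
    if (i : nat) == j then s ^+ (m - j) *+ 'C(m, j) else 0.
  rewrite coefMn -polyC_exp coefCM coefXn [j == _]eq_sym; case: eqP => [->|_].
    by rewrite mulr1.
  by rewrite mulr0 mul0rn.
under eq_bigr do rewrite E.
rewrite -big_mkcond /=.
have [jm|mj] := ltnP j m.+1; last first.
  rewrite bin_small // mulr0n big1 // => i /eqP ij.
by rewrite (big_pred1 (Ordinal jm)).
Qed.

(** The Vandermonde matrix of the nodes s q is invertible. *)
Lemma interpolation d k (kd : (k < d)%N) (s : nat -> C) : injective s ->
  exists mu : 'I_d -> C, forall i, (i < d)%N -> \sum_(q < d) mu q * s q ^+ i = (i == k)%:R.
Proof.
move=> sinj; pose a : 'rV[C]_d := \row_q s q.
have uV : Vandermonde d a \in unitmx.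
  rewrite unitmxE det_Vandermonde unitfE prodf_seq_neq0; apply/allP => i _ /=.
  rewrite prodf_seq_neq0; apply/allP => j _ /=; apply/implyP => ij.
  by rewrite !mxE subr_eq0; apply: contraTneq ij => /sinj ->; rewrite ltnn.
pose col := invmx (Vandermonde d a) *m (delta_mx (Ordinal kd) (0 : 'I_1)).
exists (fun q => col q 0) => i id.
have := congr1 (fun M : 'cV_d => M (Ordinal id) 0) (mulKVmx uV (delta_mx (Ordinal kd) (0 : 'I_1))).
rewrite -/col !mxE => e; transitivity (((Ordinal id == Ordinal kd) && (0 == 0 :> 'I_1))%:R : C); last first.
  by rewrite andbT.
rewrite -e; apply: eq_bigr => q _; by rewrite !mxE mulrC.
Qed.

Lemma geneig_iter_vaut (alpha : C) q u : vgweight g alpha u -> vgweight g alpha (iter q g u).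
Proof. by move=> h; elim: q => //= q; apply: geneig_vaut. Qed.

(** The k-th Taylor coefficient of a polynomial of bounded degree is a fixed combination
of its translates by the -2 pi i q.  Translating [logpoly] in this way amounts, up to
scalars, to replacing u by g^q u; the combination does not depend on n, w or w'. *)
Lemma log_mode (alpha : C) u k : vgweight g alpha u -> exists u',
  [/\ vgweight g alpha u', forall a, vgr a u -> vgr a u' &
   forall (w : W) n j, YW u' w n j = YW u w n (j + k) *+ 'C(j + k, k)].
Proof.
move=> hu; have [d hd] := YW_logdeg hu; have hV := vgr_grading V.
have [kd|dk] := ltnP k d; last first.
  exists 0; split; first exact: geneig0.
    by move=> a _; exact: grading0.
  by move=> w n j; rewrite (lin0 (YWl w n j)) hd ?mul0rn // (leq_trans dk) // leq_addl.
pose s (q : nat) : C := - twopii *+ q.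
have sinj : injective s.
  move=> q q'; rewrite /s -(mulr_natl _ q) -(mulr_natl _ q') => /mulIf.
  by rewrite oppr_eq0 twopii_neq0 => /(_ isT)/eqP; rewrite eqr_nat => /eqP.
have [mu hmu] := interpolation kd sinj.
pose lam := eigenval alpha; have lam0 : lam != 0 := cexp_neq0 _.
pose u' := \sum_(q < d) (mu q * lam ^- q) *: iter q g u.
have hu' : vgweight g alpha u'.
  by apply: geneig_sum => q _ _; apply: geneigZ; exact: geneig_iter_vaut.
exists u'; split=> // [a ua|w n j].
  rewrite /u'; elim/big_rec: _ => [|q y _ hy]; first exact: grading0.
  apply: grading_lin => //; elim: (q : nat) => //= i; exact: vaut_wt.
have [[i nE]|/forallNP h] := pselect (exists i : int, n = i%:~R - alpha); last first.
  have h' i : n != i%:~R - alpha by apply/eqP/h.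
  by rewrite (YW_class w j hu' h') (YW_class w (j + k) hu h') mul0rn.
apply/eqP; rewrite -subr_eq0; apply/eqP; apply: wdual_eq0 => w' hw'.
apply/eqP; rewrite linearB subr_eq0 linearMn /= -!coef_logpoly; apply/eqP.
set P := logpoly w' u w n.
have Pd : (size P <= d)%N.
  by apply/leq_sizeP => m dm; rewrite coef_logpoly hd // linear0.
have gE q : logpoly w' (iter q g u) w n = lam ^+ q *: shiftp (s q) P.
  elim: q => [|q IH].
    by rewrite scale1r /s mulr0n /shiftp addr0 comp_polyXr.
  rewrite iterS logpoly_gu // IH nE cexp_class -/lam /shiftp comp_polyZ scalerA -exprS.
  by rewrite -comp_polyA comp_polyD comp_polyX comp_polyC -addrA -polyCD /s -mulrS.
have -> : logpoly w' u' w n = \sum_(q < d) mu q *: shiftp (s q) P.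
  have lpl : {morph (fun v => logpoly w' v w n) : x y / x + y}.
    by move=> x y; rewrite -[x]scale1r logpoly_lin !scale1r.
  have lp0 : logpoly w' 0 w n = 0.
    by apply/polyP => m; rewrite coef_logpoly (lin0 (YWl w n m)) linear0 coef0.
  rewrite (big_morph _ lpl lp0); apply: eq_bigr => q _.
  rewrite -[_ *: _]addr0 logpoly_lin lp0 addr0 gE scalerA divfK //.
  by rewrite expf_neq0.
rewrite coef_sum; under eq_bigr do rewrite coefZ (coef_shiftp _ _ Pd) mulr_sumr.
rewrite exchange_big /=.
have E (m : 'I_d) : \sum_(q < d) mu q * (P`_m * (s q ^+ (m - j) *+ 'C(m, j))) =
   P`_m *+ 'C(m, j) * ((m - j)%N == k)%:R.
  rewrite -hmu; last by rewrite (leq_ltn_trans (leq_subr _ _)).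
  rewrite mulr_sumr; apply: eq_bigr => q _.
  by rewrite !mulrnAr mulrnAl; congr (_ *+ _); ring.
under eq_bigr do rewrite E.
have [jkd|djk] := ltnP (j + k) d; last first.
  rewrite nth_default ?mul0rn; last exact: leq_trans djk.
  apply: big1 => m _; case: eqP => [e|_]; last by rewrite mulr0.
  have [jm|mj] := leqP j m; last by rewrite bin_small // mulr0n mul0r.
  by move: (ltn_ord m); rewrite -(subnKC jm) e ltnNge djk.
rewrite (bigD1 (Ordinal jkd)) //= addKn eqxx mulr1 big1 ?addr0.
  by rewrite -(bin_sub (leq_addr k j)) addKn.
move=> m mjk; case: eqP => [e|_]; last by rewrite mulr0.
have [jm|mj] := leqP j m; last by rewrite bin_small // mulr0n mul0r.
by case/eqP: mjk; apply: val_inj; rewrite /= -e subnKC.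
Qed.

End Monodromy.

(** * Weak commutativity *)

Section WeakCommutativity.
Variables (R : realType) (V : gr_vertex_superalgebra R) (g : vautomorphism V)
  (W : gtwisted_module g).
Local Notation C := (R[i]).
Implicit Types (u v : V) (n m : C) (r : R).
Local Notation G := (geneig (LW0 W)).
Local Notation YWl := (@YW_linearl R V g W).
Local Notation YWr := (@YW_linearr R V g W).

Lemma lp0_1 : lp 0 (1 : C) = 0.
Proof.
have := @lp_pos R 0 1 ltr01; rewrite ln1 mul0r addr0; exact.
Qed.

Lemma lp0_expR r : lp 0 (expR r)%:C = r%:C.
Proof. by rewrite lp_pos ?expR_gt0 // expRK mul0r addr0. Qed.

Lemma subst_term_at1 u (w : W) n : subst_term (YW u w) 0 1 n = YW u w n 0.
Proof.
have [K hK] := YW_log u w; rewrite (@subst_termE _ _ _ _ _ _ K.+1); last by move=> j; exact: hK.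
rewrite big_ord_recl lp0_1 mulr0 cexp0 expr0 mulr1 scale1r big1 ?addr0 // => j _.
by rewrite expr0n mulr0 scale0r.
Qed.

Definition parity_sign (a b : int) : C := (-1) ^+ (~~ (2 %| a)%Z && ~~ (2 %| b)%Z).

(** The analogue of [logpoly] for the opposite order of the operators, with sign sg. *)
Definition swapped_logpoly (sg : C) (w' : {scalar W}) u v (w : W) n1 n2 : {poly C} :=
  \poly_(j < (projT1 (cid (YW_log u w))).+1) (sg * w' (YW v (YW u w n1 j) n2 0)).

Lemma coef_swapped_logpoly sg w' u v (w : W) n1 n2 j :
  (swapped_logpoly sg w' u v w n1 n2)`_j = sg * w' (YW v (YW u w n1 j) n2 0).
Proof.
rewrite coef_poly; case: cid => K hK /=; case: ltnP => // Kj.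
by rewrite (hK _ _ Kj) (lin0 (YWr v n2 0)) linear0 mulr0.
Qed.

Lemma swapped_subst sg (w' : {scalar W}) u v (w : W) r n1 n2 :
  sg * w' (subst_term (YW v (subst_term (YW u w) 0 (expR r)%:C n1)) 0 1 n2) =
  cexp (n1 * r%:C) * (swapped_logpoly sg w' u v w n1 n2).[r%:C].
Proof.
rewrite subst_term_at1 /swapped_logpoly; case: cid => K hK /=.
rewrite (@subst_termE _ _ _ _ _ _ K.+1); last by move=> j; exact: hK.
rewrite lp0_expR (lin_sum (YWr v n2 0)) linear_sum horner_poly !mulr_sumr.
apply: eq_bigr => j _; rewrite (linZ (YWr v n2 0)) linearZ /=; ring.
Qed.

Section OneAntidiagonal.
Variables (alpha : C) (a b : int) (v : V) (m : C) (w : W) (i0 : C * bool * C) (w' : {scalar W}).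
Hypothesis vb : vgr b v.
Hypothesis hm : G m w.
Hypothesis hw' : forall j y, j != i0 -> wgr j y -> w' y = 0.
Let kap : C := i0.1.1 - m - a%:~R / 2 - b%:~R / 2.
Let sg := parity_sign a b.
Let h (n : int) : C * C := (n%:~R - alpha, kap - (n%:~R - alpha)).

Lemma antidiagonal_inj : injective h.
Proof. by move=> n k [/addIr/eqP]; rewrite eqr_int => /eqP. Qed.

(** The functional w' lives on the graded piece i0, and weights add up; hence the total
exponent is fixed. *)
Lemma wt_zero u n1 n2 j k : vgr a u -> n1 + n2 != kap ->
  w' (YW u (YW v w n2 j) n1 k) = 0 /\ w' (YW v (YW u w n1 j) n2 k) = 0.
Proof.
move=> ua ne; split.
  apply: (single_geneig hw' (YW_wt n1 k ua (YW_wt n2 j vb hm))).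
  apply: contra ne => /eqP e; rewrite /kap -e; apply/eqP; ring.
apply: (single_geneig hw' (YW_wt n2 k vb (YW_wt n1 j ua hm))).
apply: contra ne => /eqP e; rewrite /kap -e; apply/eqP; ring.
Qed.

Lemma off_antidiagonal u (x : C * C) : vgr a u -> vgweight g alpha u ->
  (forall n : int, x <> h n) -> (forall j, w' (YW u (YW v w x.2 0) x.1 j) = 0) /\
  (forall j, w' (YW v (YW u w x.1 j) x.2 0) = 0).
Proof.
move=> ua hu hx; have [e|ne] := eqVneq (x.1 + x.2) kap; last first.
  by split=> j; [have [-> ?] := wt_zero 0 j ua ne | have [? ->] := wt_zero j 0 ua ne].
have cl (n : int) : x.1 != n%:~R - alpha.
  apply/eqP => xn; apply: (hx n); rewrite /h -xn -e; case: (x) => x1 x2 /=.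
  by rewrite addrAC subrr add0r.
split=> j; first by rewrite (YW_class _ _ hu cl) linear0.
by rewrite (YW_class _ _ hu cl) (lin0 (YWr v _ _)) linear0.
Qed.

(** Duality at z_2 = 1 and z_1 = e^r, summed over the only antidiagonal that w' sees. *)
Lemma dual_series u : vgr a u -> vgweight g alpha u ->
  exists (f : R -> C) (t : nat),
  [/\ forall r, 0 < r -> abs_sums_to (fun n : int =>
        cexp ((n%:~R - alpha) * r%:C) * (logpoly w' u (YW v w (h n).2 0) (h n).1).[r%:C]) (f r),
      forall r, r < 0 -> abs_sums_to (fun n : int =>
        cexp ((n%:~R - alpha) * r%:C) * (swapped_logpoly sg w' u v w (h n).1 (h n).2).[r%:C]) (f r),
      forall r, 0 < expR r - 1 < 1 -> abs_sums_to (fun x : int * C =>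
        w' (YW (YV u v x.1) w x.2 0) * (expR r - 1)%:C ^ x.1) (f r) &
      exists2 E, exppoly E & forall r, r != 0 -> (cexp r%:C - 1) ^+ t * f r = E r].
Proof.
move=> ua hu.
have [N [aa [mm [nn [t [t0 H]]]]]] := YW_duality w (vgr_parity ua) (vgr_parity vb) (single_wdual hw').
exists (fun r => dual_branch aa mm nn t 0 (expR r)%:C 1), t.
have n1 : normc (1 : C) = 1 by rewrite normc1.
have nr r : normc ((expR r)%:C : C) = expR r by rewrite normc_real ger0_norm ?expR_ge0.
have er r : ((expR r)%:C - 1 : C) = (expR r - 1)%:C by rewrite rmorphB rmorph1.
split.
- move=> r r0; have [H1 _ _ _] := H 0 (expR r)%:C 1; have [|h1 h2] := H1.
    by rewrite n1 nr ltr01 expR_gt1.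
  pose T (x : C * C) := cexp (x.1 * r%:C) * (logpoly w' u (YW v w x.2 0) x.1).[r%:C].
  have TE x : w' (subst_term (YW u (subst_term (YW v w) 0 1 x.2)) 0 (expR r)%:C x.1) = T x.
    by rewrite subst_term_logpoly subst_term_at1 lp0_expR.
  have T0 x : (forall n : int, x <> h n) -> T x = 0.
    move=> /(off_antidiagonal ua hu)[hx _]; rewrite /T.
    rewrite (_ : logpoly _ _ _ _ = 0) ?horner0 ?mulr0 //.
    by apply/polyP => j; rewrite coef_logpoly hx coef0.
  split; first exact: (iffLR (abs_conv_preim antidiagonal_inj T0) (abs_conv_ext TE h1)).
  exact: (iffLR (sums_to_preim _ antidiagonal_inj T0) (sums_to_ext TE h2)).
- move=> r r0; have [_ H1 _ _] := H 0 (expR r)%:C 1; have [|h1 h2] := H1.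
    by rewrite n1 nr expR_gt0 expR_lt1.
  pose T (x : C * C) := cexp (x.1 * r%:C) * (swapped_logpoly sg w' u v w x.1 x.2).[r%:C].
  have TE x : (-1) ^+ (~~ (2 %| a)%Z && ~~ (2 %| b)%Z) *
     w' (subst_term (YW v (subst_term (YW u w) 0 (expR r)%:C x.1)) 0 1 x.2) = T x.
    exact: swapped_subst.
  have T0 x : (forall n : int, x <> h n) -> T x = 0.
    move=> /(off_antidiagonal ua hu)[_ hx]; rewrite /T.
    rewrite (_ : swapped_logpoly _ _ _ _ _ _ _ = 0) ?horner0 ?mulr0 //.
    by apply/polyP => j; rewrite coef_swapped_logpoly hx coef0 mulr0.
  split; first exact: (iffLR (abs_conv_preim antidiagonal_inj T0) (abs_conv_ext TE h1)).
  exact: (iffLR (sums_to_preim _ antidiagonal_inj T0) (sums_to_ext TE h2)).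
- move=> r /andP[r1 r2]; have [_ _ h1 h2] := H 0 (expR r)%:C 1.
  have reg : 0 < normc ((expR r)%:C - 1 : C) < normc (1 : C).
    by rewrite er normc_real n1 gtr0_norm // r1.
  have TE x : w' (subst_term (YW (YV u v x.1) w) 0 1 x.2) * ((expR r)%:C - 1) ^ x.1 =
      w' (YW (YV u v x.1) w x.2 0) * (expR r - 1)%:C ^ x.1.
    by rewrite subst_term_at1 er.
  split; first exact: abs_conv_ext TE (h1 reg).
  apply: sums_to_ext TE (h2 reg _).
  rewrite carg_pos ?expR_gt0 // (@carg_pos R 1) // subrr normr0 divr_gt0 // pi_gt0 //.
exists (fun r => \sum_i \sum_j \sum_k \sum_l
   aa i j k l * cexp (mm i * r%:C) * cexp (nn j * 0) * r%:C ^+ k * 0 ^+ l).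
  do 4![apply: exppoly_sum => ?].
  apply: exppolyM (exppolyC _); apply: exppolyM (exppolyX _ (exppoly_var _)).
  by apply: exppolyM (exppolyC _); apply: exppolyM (exppolyC _) (exppoly_exp _).
move=> r r0; rewrite /dual_branch lp0_expR lp0_1 cexp_real mulr_sumr; apply: eq_bigr => i _.
rewrite mulr_sumr; apply: eq_bigr => j _; rewrite mulr_sumr; apply: eq_bigr => k _.
rewrite mulr_sumr; apply: eq_bigr => l _; rewrite mulrC divfK // expf_neq0 //.
rewrite er eq_complex /= eqxx andbT subr_eq0.
by apply: contra r0 => /eqP; rewrite -expR0 => /expR_inj ->.
Qed.

Lemma power_monotone (e e0 : R) (M : nat) (x : int) (y : C) : 0 < e < e0 -> - M%:Z <= x ->
  normc (e%:C ^+ M * (y * e%:C ^ x)) <= e0 ^+ M * normc (y * e0%:C ^ x).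
Proof.
move=> /andP[h1 h2] Mx; have h0 : 0 < e0 by lra.
have gen (p q r : C) : normc (p * (q * r)) = normc p * (normc q * normc r) by rewrite !normcM.
have nX (k : R) (n : nat) : 0 < k -> normc (k%:C ^+ n : C) = k ^+ n.
  by move=> k0; apply: (etrans (normcX _ _)); rewrite normc_real gtr0_norm.
have nXz (k : R) : 0 < k -> normc (k%:C ^ x : C) = k ^ x.
  by move=> k0; apply: (etrans (normcXz _ _)); rewrite normc_real gtr0_norm.
apply: (@le_trans _ _ (e ^+ M * (normc y * e ^ x))).
  by rewrite -(nX _ _ h1) -(nXz _ h1); rewrite le_eqVlt; apply/orP; left; apply/eqP; exact: gen.
apply: (@le_trans _ _ (e0 ^+ M * (normc y * e0 ^ x))); last first.
  by rewrite -(nXz _ h0); rewrite le_eqVlt; apply/orP; left; apply/eqP; congr (_ * _); apply/esym; exact: normcM.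
rewrite mulrCA [leRHS]mulrCA; apply: ler_wpM2l; first exact: normc_ge0.
rewrite (exprnP e M) (exprnP e0 M) -!expfzDr ?gt_eqF //.
have -> : M%:Z + x = (absz (M%:Z + x))%:Z by lia.
move: (absz _) => k; rewrite -[leLHS]/(e ^+ k) -[leRHS]/(e0 ^+ k).
by rewrite lerXn2r ?nnegrE ?ltW.
Qed.

(** By truncation (z_1 - z_2)^M turns the expansion of the iterate into a series of
nonnegative powers of e^r - 1, bounded by its values at e^r - 1 = 1/2. *)
Lemma diagonal_bound u (f : R -> C) M : (forall n : int, n < - M%:Z -> YV u v n = 0) ->
  (forall r, 0 < expR r - 1 < 1 -> abs_sums_to (fun x : int * C =>
        w' (YW (YV u v x.1) w x.2 0) * (expR r - 1)%:C ^ x.1) (f r)) ->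
  exists B, forall r, 0 < r < ln (3 / 2) -> normc ((cexp r%:C - 1) ^+ M * f r) <= B.
Proof.
move=> trunc H; pose r0 : R := ln (3 / 2).
have e0 : expR r0 = 3 / 2 by rewrite lnK // posrE.
have [|/abs_convP[K hK] _] := H r0; first by rewrite e0; lra.
exists ((expR r0 - 1) ^+ M * K) => r /andP[rp rr].
have er1 : 0 < expR r - 1 by rewrite subr_gt0 expR_gt1.
have er2 : expR r - 1 < expR r0 - 1 by rewrite ltrD2r ltr_expR.
have [|_ hs] := H r; first by rewrite e0 in er2; apply/andP; split => //; lra.
apply: (sums_to_bound (sums_toZ _ hs)) => A.
apply: (@le_trans _ _ (\sum_(x <- A) (expR r0 - 1) ^+ M *
   normc (w' (YW (YV u v x.1) w x.2 0) * (expR r0 - 1)%:C ^ x.1))); last first.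
  rewrite -mulr_sumr ler_wpM2l ?exprn_ge0 //; lra.
apply: ler_sum => x _; rewrite cexp_realB1; have [/trunc tr|ge] := ltP x.1 (- M%:Z).
  rewrite tr (lin0 (YWl w x.2 0)) linear0; move: (_ ^ x.1) (_ ^ x.1) => p q.
  by rewrite !mul0r mulr0 normc0 mulr0.
by apply: power_monotone; rewrite // er1.
Qed.

Hypothesis hW : lower_bounded W.

(** By [log_mode] and the Taylor formula at log z_1 = r evaluated at 0, the modes of u
without logarithm are the combinations of the series for the u_k with coefficients
(-r)^k.  The same combination G of the dual functions satisfies the assumptions of
[expansion_comparison]. *)
Lemma zero_mode_commutation u M : vgr a u -> vgweight g alpha u ->
  (forall u' (n : int), vgr a u' -> n < - M%:Z -> YV u' v n = 0) ->
  iter M (@mul1 R) (fun n : int => w' (YW u (YW v w (h n).2 0) (h n).1 0)) =1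
  iter M (@mul1 R) (fun n : int => sg * w' (YW v (YW u w (h n).1 0) (h n).2 0)).
Proof.
move=> ua hu trunc.
have [uk huk] := choice (fun k => log_mode W k hu).
have uka k : vgr a (uk k) by have [_ + _] := huk k; apply.
have ukal k : vgweight g alpha (uk k) by have [] := huk k.
have ukE k (w1 : W) n j : YW (uk k) w1 n j = YW u w1 n (j + k) *+ 'C(j + k, k).
  by have [_ _ e] := huk k; exact: e.
have [f hf] := choice (fun k => dual_series (uka k) (ukal k)).
have {hf}[t hf] := choice hf.
have [d hd] := YW_logdeg W hu.
pose Gf r := cexp (alpha * r%:C) * \sum_(k < d) (- r%:C) ^+ k * f k r.
have taylor (P : {poly C}) (Q : nat -> {poly C}) r : (forall j, (d <= j)%N -> P`_j = 0) ->
    (forall k j, (Q k)`_j = P`_(j + k) *+ 'C(j + k, k)) ->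
    \sum_(k < d) (- r%:C) ^+ k * (Q k).[r%:C] = P`_0.
  move=> Pd PQ; have Psz : (size P <= d)%N by apply/leq_sizeP.
  have -> : P`_0 = P.[r%:C - r%:C] by rewrite subrr horner_coef0.
  rewrite (@nderiv_taylor_wide _ d) //; last exact: mulrC.
  apply: eq_bigr => k _; rewrite mulrC; congr (_.[_] * _).
  by apply/polyP => j; rewrite PQ coef_nderivn addnC.
have expE (n : int) r : cexp (n%:~R * r%:C) = cexp (alpha * r%:C) * cexp ((n%:~R - alpha) * r%:C) :> C.
  by rewrite -cexpD; congr cexp; ring.
have [bv hbv] := YW_trunc hW v w; have [bu hbu] := YW_trunc hW u w.
have ReI (n : int) : complex.Re (n%:~R - alpha) = n%:~R - complex.Re alpha.
  have -> : (n%:~R : C) = (n%:~R : R)%:C by rewrite rmorph_int.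
  by case: (alpha).
pose n1 := Num.floor (complex.Re kap + complex.Re alpha - bv%:~R) + 1.
pose n0 := Num.floor (bu%:~R + complex.Re alpha) - 1.
apply: (@expansion_comparison _ _ _ Gf n0 n1).
- move=> n hn; rewrite hbv ?(lin0 (YWr u _ _)) ?linear0 //.
  rewrite /h /= raddfB /= ReI.
  have := Num.Theory.floor_itv (complex.Re kap + complex.Re alpha - bv%:~R).
  have : (n1%:~R : R) <= n%:~R by rewrite ler_int.
  rewrite /n1 !rmorphD /=; lra.
- move=> n hn; rewrite hbu ?(lin0 (YWr v _ _)) ?linear0 ?mulr0 //.
  rewrite /h /= ReI.
  have := Num.Theory.floor_itv (bu%:~R + complex.Re alpha).
  have : (n%:~R : R) <= n0%:~R by rewrite ler_int.
  rewrite /n0 !rmorphD /=; lra.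
- move=> r r0.
  have TE (n : int) : cexp (alpha * r%:C) * \sum_(k < d) (- r%:C) ^+ k *
     (cexp ((n%:~R - alpha) * r%:C) * (logpoly w' (uk k) (YW v w (h n).2 0) (h n).1).[r%:C]) =
     zterm (fun n : int => w' (YW u (YW v w (h n).2 0) (h n).1 0)) r n.
    rewrite /zterm expE -(coef_logpoly w').
    rewrite -(@taylor _ (fun k => logpoly w' (uk k) (YW v w (h n).2 0) (h n).1) r).
    - rewrite [RHS]mulrCA; congr (_ * _); rewrite mulr_suml.
      by apply: eq_bigr => k _; ring.
    - by move=> j dj; rewrite coef_logpoly hd // linear0.
    by move=> k j; rewrite !coef_logpoly ukE linearMn.
  split.
    apply: (abs_conv_ext TE); apply: abs_convZ; apply: abs_conv_sum => k _; apply: abs_convZ.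
    by have [/(_ r r0)[]] := hf k.
  apply: (sums_to_ext TE); apply: sums_toZ; apply: sums_to_sum => k _; apply: sums_toZ.
  by have [/(_ r r0)[]] := hf k.
- move=> r r0.
  have TE (n : int) : cexp (alpha * r%:C) * \sum_(k < d) (- r%:C) ^+ k *
     (cexp ((n%:~R - alpha) * r%:C) * (swapped_logpoly sg w' (uk k) v w (h n).1 (h n).2).[r%:C]) =
     zterm (fun n : int => sg * w' (YW v (YW u w (h n).1 0) (h n).2 0)) r n.
    rewrite /zterm expE -coef_swapped_logpoly.
    rewrite -(@taylor _ (fun k => swapped_logpoly sg w' (uk k) v w (h n).1 (h n).2) r).
    - rewrite [RHS]mulrCA; congr (_ * _); rewrite mulr_suml.
      by apply: eq_bigr => k _; ring.
    - by move=> j dj; rewrite coef_swapped_logpoly hd // (lin0 (YWr v _ _)) linear0 mulr0.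
    move=> k j; rewrite !coef_swapped_logpoly ukE -mulrnAr -linearMn; congr (_ * w' _).
    by rewrite (linMn (YWr v _ _)).
  split.
    apply: (abs_conv_ext TE); apply: abs_convZ; apply: abs_conv_sum => k _; apply: abs_convZ.
    by have [_ /(_ r r0)[]] := hf k.
  apply: (sums_to_ext TE); apply: sums_toZ; apply: sums_to_sum => k _; apply: sums_toZ.
  by have [_ /(_ r r0)[]] := hf k.
- pose T := (\max_(k < d) t k)%N.
  have hE0 k : exists E, exppoly E /\
      forall r, r != 0 -> (cexp r%:C - 1) ^+ t k * f k r = E r.
    by have [_ _ _ [E e1 e2]] := hf k; exists E.
  have [E hE] := choice hE0.
  exists T, (fun r => cexp (alpha * r%:C) * \sum_(k < d) (- r%:C) ^+ k *
     ((cexp r%:C - 1) ^+ (T - t k) * E k r)); split.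
    apply: exppolyM (exppoly_exp _) _; apply: exppoly_sum => k.
    apply: exppolyM.
      apply: exppoly_ext (exppolyX k (exppolyM (exppolyC (-1)) (exppoly_var _))) => r.
      by rewrite mulN1r.
    have [hEk _] := hE k; apply: exppolyM hEk; apply: exppolyX.
    apply: exppolyD (exppolyC _).
    by apply: exppoly_ext (exppoly_exp 1) => r; rewrite mul1r.
  move=> r r0; rewrite /Gf mulrCA mulr_sumr; congr (_ * _); apply: eq_bigr => k _.
  have [_ hEk] := hE k; rewrite -hEk // mulrCA; congr (_ * _).
  by rewrite mulrA -exprD subnK // (leq_bigmax k).
have hB0 k : exists B, forall r, 0 < r < ln (3 / 2) ->
    normc ((cexp r%:C - 1) ^+ M * f k r) <= B.
  by have [_ _ e _] := hf k; apply: (diagonal_bound _ e) => n; apply: trunc.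
have [B hB] := choice hB0.
have l0 : 0 < ln (3 / 2) :> R by rewrite ln_gt0 //; lra.
have l1 : ln (3 / 2) < 1 :> R.
  have := @le_ln1Dx R (1 / 2); have -> : 1 + 1 / 2 = 3 / 2 :> R by field.
  by move=> /(_ _) h3; have : -1 < 1 / 2 :> R; [lra|move=> /h3; lra].
exists (ln (3 / 2)), (expR `|complex.Re alpha| * \sum_(k < d) B k); split=> // r /andP[r0 r1].
rewrite /Gf mulrCA normcM ler_pM ?normc_ge0 //.
  rewrite normc_cexp ler_expR; have -> : complex.Re (alpha * r%:C) = complex.Re alpha * r.
    by case: (alpha) => x y /=; rewrite mulr0 subr0.
  have := ler_norm (complex.Re alpha); have := normr_ge0 (complex.Re alpha); nra.
rewrite mulr_sumr; apply: (le_trans (normc_sum _ _ _)); apply: ler_sum => k _.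
have hBk : normc ((cexp r%:C - 1) ^+ M * f k r) <= B k by apply: hB; rewrite r0.
rewrite mulrCA normcM; apply: le_trans hBk; rewrite ler_piMl ?normc_ge0 //.
rewrite normcX normcN normc_real gtr0_norm // exprn_ile1 //; lra.
Qed.

End OneAntidiagonal.
End WeakCommutativity.

Section TwoVariableSeries.
Variables (U : zmodType).
Implicit Types (F : int -> int -> U).

(** The coefficients of (x_1 - x_2) F(x_1,x_2). *)
Definition mul2 F (n1 n2 : int) : U := F (n1 - 1) n2 - F n1 (n2 - 1).

Lemma iter_mul2_sum (T : Type) (s : seq T) (F : T -> int -> int -> U) M n1 n2 :
  iter M mul2 (fun n1 n2 => \sum_(t <- s) F t n1 n2) n1 n2 = \sum_(t <- s) iter M mul2 (F t) n1 n2.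
Proof. by elim: M n1 n2 => // M IH n1 n2; rewrite iterS /mul2 !IH -sumrB. Qed.

End TwoVariableSeries.

(** Reduces identities between series in two variables to series in one variable, one
antidiagonal at a time. *)
Lemma iter_mul2_mul1 (R : realType) (U : lmodType R[i]) (phi : {scalar U}) (F : int -> int -> U) S M n :
  phi (iter M (@mul2 U) F n (S + M%:Z - n)) = iter M (@mul1 R) (fun k => phi (F k (S - k))) n.
Proof.
elim: M n => [|M IH] n; first by rewrite addr0.
rewrite !iterS /mul2 /mul1 linearB -!IH.
rewrite (_ : S + M.+1%:Z - n - 1 = S + M%:Z - n); last by lia.
by rewrite (_ : S + M.+1%:Z - n = S + M%:Z - (n - 1)); last by lia.
Qed.

Section Exchange.
Variables (R : realType) (V : gr_vertex_superalgebra R) (g : vautomorphism V)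
  (W : gtwisted_module g).
Hypothesis hW : lower_bounded W.
Local Notation C := (R[i]).
Implicit Types (u v : V).
Local Notation YWl := (@YW_linearl R V g W).
Local Notation YWr := (@YW_linearr R V g W).

(** Powers of logarithms are absorbed into u and v by [log_mode].  For w of definite
weight both sides have definite weight, and it suffices to test them on functionals
supported on one graded piece, where [zero_mode_commutation] applies. *)
Lemma weak_commutation (alpha beta : C) (a b : int) u v M :
  vgr a u -> vgr b v -> vgweight g alpha u -> vgweight g beta v ->
  (forall u' v' (n : int), vgr a u' -> vgr b v' -> n < - M%:Z -> YV u' v' n = 0) ->
  forall (w : W) j1 j2,
  iter M (@mul2 W) (fun n1 n2 => YW u (YW v w (n2%:~R - beta) j2) (n1%:~R - alpha) j1) =
  iter M (@mul2 W) (fun n1 n2 =>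
     parity_sign R a b *: YW v (YW u w (n1%:~R - alpha) j1) (n2%:~R - beta) j2).
Proof.
move=> ua vb hu hv trunc w j1 j2.
have [u' [hu' /(_ a ua) ua' uE]] := log_mode W j1 hu.
have [v' [hv' /(_ b vb) vb' vE]] := log_mode W j2 hv.
have {}uE (x : W) n : YW u x n j1 = YW u' x n 0 by rewrite uE add0n binn.
have {}vE (x : W) n : YW v x n j2 = YW v' x n 0 by rewrite vE add0n binn.
apply/funext => n1; apply/funext => n2.
have [s [x [us hx wE]]] := grading_decomp (wgr_grading W) w.
pose F (y : W) (n1 n2 : int) := YW u' (YW v' y (n2%:~R - beta) 0) (n1%:~R - alpha) 0.
pose F' (y : W) (n1 n2 : int) := parity_sign R a b *: YW v' (YW u' y (n1%:~R - alpha) 0) (n2%:~R - beta) 0.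
have -> : (fun n1 n2 : int => YW u (YW v w (n2%:~R - beta) j2) (n1%:~R - alpha) j1) =
    (fun n1 n2 => \sum_(i <- s) F (x i) n1 n2).
  apply/funext => k1; apply/funext => k2; rewrite uE vE wE.
  by rewrite (lin_sum (YWr v' _ 0)) (lin_sum (YWr u' _ 0)).
have -> : (fun n1 n2 : int => parity_sign R a b *: YW v (YW u w (n1%:~R - alpha) j1) (n2%:~R - beta) j2) =
    (fun n1 n2 => \sum_(i <- s) F' (x i) n1 n2).
  apply/funext => k1; apply/funext => k2; rewrite vE uE wE.
  by rewrite (lin_sum (YWr u' _ 0)) (lin_sum (YWr v' _ 0)) scaler_sumr.
rewrite !iter_mul2_sum; apply: eq_bigr => i _.
have hm := wgr_geneig (hx i); set m := i.1.1 in hm; move: (x i) hm => y hm.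
apply/eqP; rewrite -subr_eq0; apply/eqP; apply: separation => i0 w' hw'.
apply/eqP; rewrite linearB subr_eq0; apply/eqP.
pose S := n1 + n2 - M%:Z; have -> : n2 = S + M%:Z - n1 by rewrite /S; lia.
rewrite !iter_mul2_mul1.
pose kap : C := i0.1.1 - m - a%:~R / 2 - b%:~R / 2.
have SE n : (n%:~R - alpha) + ((S - n)%:~R - beta) = S%:~R - alpha - beta :> C.
  by rewrite rmorphB /=; ring.
have [e|ne] := eqVneq (S%:~R - alpha - beta) kap.
  have eE (n : int) : (S - n)%:~R - beta = kap - (n%:~R - alpha) by rewrite -e rmorphB /=; ring.
  have := zero_mode_commutation vb' hm hw' hW ua' hu' (fun u1 n h1 h2 => trunc u1 v' n h1 vb' h2) n1.
  rewrite /= -/kap => h.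
  rewrite (_ : (fun k => w' (F y k (S - k))) = (fun n : int =>
      w' (YW u' (YW v' y (kap - (n%:~R - alpha)) 0) (n%:~R - alpha) 0))); last first.
    by apply/funext => n; rewrite /F eE.
  rewrite h; congr (iter _ _ _ _); apply/funext => n.
  by rewrite /F' eE linearZ.
rewrite (_ : (fun k => w' (F y k (S - k))) = (fun k => w' (F' y k (S - k)))) //.
apply/funext => n.
have [h1 h2] := wt_zero (n1 := n%:~R - alpha) (n2 := (S - n)%:~R - beta) vb' hm hw' 0 0 ua' ltac:(by rewrite SE).
by rewrite /F /F' linearZ /= h1 h2 mulr0.
Qed.

(** A fixed choice, so that bounds found on the components are functions of u. *)
Definition wt_index u : seq int := projT1 (cid (grading_decomp (vgr_grading V) u)).
Definition wt_part u : int -> V :=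
  projT1 (cid (projT2 (cid (grading_decomp (vgr_grading V) u)))).

Lemma wt_partP u : [/\ uniq (wt_index u), forall i, vgr i (wt_part u i) &
  u = \sum_(i <- wt_index u) wt_part u i].
Proof. exact: (projT2 (cid (projT2 (cid (grading_decomp (vgr_grading V) u))))). Qed.

Lemma wt_part_weight (alpha : C) u i : vgweight g alpha u -> i \in wt_index u ->
  vgweight g alpha (wt_part u i).
Proof.
by move=> hu; have [us hx uE] := wt_partP u; exact: (geneig_component hu us hx uE).
Qed.

(** The vector v' is v with the signs of the exchange put on its components. *)
Definition exchangeable (alpha beta : C) u v j1 j2 M := exists v', forall w : W,
  iter M (@mul2 W) (fun n1 n2 => YW u (YW v w (n2%:~R - beta) j2) (n1%:~R - alpha) j1) =
  iter M (@mul2 W) (fun n1 n2 => YW v' (YW u w (n1%:~R - alpha) j1) (n2%:~R - beta) j2).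

Lemma exchange_bound u v : exists M : nat, forall (alpha beta : C),
  vgweight g alpha u -> vgweight g beta v ->
  forall i j1 j2, i \in wt_index u -> exchangeable alpha beta (wt_part u i) v j1 j2 M.
Proof.
have [B hB] := YV_trunc V.
have bnd (s : seq int) k : k \in s -> (absz k <= \sum_(k <- s) absz k)%N.
  by move=> ks; rewrite (big_rem k) //= leq_addr.
pose M := (absz B + \sum_(k <- wt_index u) absz k + \sum_(k <- wt_index v) absz k)%N.
exists M => alpha beta hu hv i j1 j2 iu.
have [uu uw uE] := wt_partP u; have [vu vw vE] := wt_partP v.
exists (\sum_(k <- wt_index v) parity_sign R i k *: wt_part v k) => w.
have -> : (fun n1 n2 : int => YW (wt_part u i) (YW v w (n2%:~R - beta) j2) (n1%:~R - alpha) j1) =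
   (fun n1 n2 : int => \sum_(k <- wt_index v)
     YW (wt_part u i) (YW (wt_part v k) w (n2%:~R - beta) j2) (n1%:~R - alpha) j1).
  apply/funext => n1; apply/funext => n2.
  by rewrite {1}vE (lin_sum (YWl w _ j2)) (lin_sum (YWr _ _ j1)).
have -> : (fun n1 n2 : int => YW (\sum_(k <- wt_index v) parity_sign R i k *: wt_part v k)
     (YW (wt_part u i) w (n1%:~R - alpha) j1) (n2%:~R - beta) j2) =
   (fun n1 n2 : int => \sum_(k <- wt_index v) parity_sign R i k *: YW (wt_part v k)
     (YW (wt_part u i) w (n1%:~R - alpha) j1) (n2%:~R - beta) j2).
  apply/funext => n1; apply/funext => n2; rewrite (lin_sum (YWl _ _ j2)).
  by apply: eq_bigr => k _; rewrite (linZ (YWl _ _ j2)).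
apply/funext => n1; apply/funext => n2; rewrite !iter_mul2_sum.
rewrite big_seq [RHS]big_seq; apply: eq_bigr => k kv.
rewrite (weak_commutation (uw i) (vw k) (wt_part_weight hu iu) (wt_part_weight hv kv)) //.
move=> u' v' n hu' hv' nM; apply: (hB _ _ _ _ _ hu' hv').
have := bnd _ _ iu; have := bnd _ _ kv; rewrite /M in nM; lia.
Qed.

End Exchange.

(** * Products of several twisted fields as formal series *)

Section MultiVariableSeries.
Variables (I : finType).
Implicit Types (a b c : I) (n : {ffun I -> int}).

Definition dec a n : {ffun I -> int} := [ffun i => if i == a then n i - 1 else n i].
Definition inc a n : {ffun I -> int} := [ffun i => if i == a then n i + 1 else n i].

Lemma decK a : cancel (dec a) (inc a).
Proof. by move=> n; apply/ffunP => i; rewrite !ffunE; case: eqP => // _; rewrite subrK. Qed.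

Lemma incK a : cancel (inc a) (dec a).
Proof. by move=> n; apply/ffunP => i; rewrite !ffunE; case: eqP => // _; rewrite addrK. Qed.

Lemma decC a b n : dec a (dec b n) = dec b (dec a n).
Proof. by apply/ffunP => i; rewrite !ffunE; do 2!case: eqP. Qed.

Lemma inc_decC a b n : inc a (dec b n) = dec b (inc a n).
Proof. by apply/ffunP => i; rewrite !ffunE; do 2!case: eqP => //; move=> *; lia. Qed.

Lemma dec_eq a n : dec a n a = n a - 1. Proof. by rewrite ffunE eqxx. Qed.
Lemma dec_neq a c n : c != a -> dec a n c = n c. Proof. by rewrite ffunE => /negPf ->. Qed.

Section Multiplication.
Variable U : zmodType.
Implicit Types (F : {ffun I -> int} -> U) (l : seq (I * I)).

(** The coefficients of (x_a - x_b) F(x). *)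
Definition mulX a b F n : U := F (dec a n) - F (dec b n).

Definition foldmul l F := foldr (fun p : I * I => mulX p.1 p.2) F l.

Lemma mulXC a b c d F : mulX a b (mulX c d F) = mulX c d (mulX a b F).
Proof.
apply/funext => n; rewrite /mulX !(decC c) !(decC d).
by rewrite !opprB [LHS]addrACA [- _ + _]addrC [RHS]addrACA; congr (_ + _); rewrite addrC.
Qed.

Lemma foldmul_cat l1 l2 F : foldmul (l1 ++ l2) F = foldmul l1 (foldmul l2 F).
Proof. exact: foldr_cat. Qed.

Lemma foldmulX a b l F : foldmul l (mulX a b F) = mulX a b (foldmul l F).
Proof. by elim: l => //= p l ->; rewrite mulXC. Qed.

Lemma foldmulC l1 l2 F : foldmul l1 (foldmul l2 F) = foldmul l2 (foldmul l1 F).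
Proof. by elim: l1 => //= p l1 ->; rewrite foldmulX. Qed.

Lemma foldmul_nseq N a b F : foldmul (nseq N (a, b)) F = iter N (mulX a b) F.
Proof. by elim: N => //= N ->. Qed.

Lemma foldmul_sum (T : Type) (s : seq T) (F : T -> {ffun I -> int} -> U) l n :
  foldmul l (fun n => \sum_(t <- s) F t n) n = \sum_(t <- s) foldmul l (F t) n.
Proof. by elim: l n => // p l IH n; rewrite /= /mulX !IH -sumrB. Qed.

Definition lowb a (B : int) F : Prop := forall n, n a < B -> F n = 0.

Lemma lowb_foldmul a B l F : lowb a B F -> lowb a B (foldmul l F).
Proof.
move=> h; elim: l => //= p l IH n nB.
by rewrite /mulX !IH ?subrr // ffunE; case: ifP => // _; lia.
Qed.

(** Multiplication by x_a - x_b only moves the exponents of x_a and x_b, so the part P n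
that does not depend on them can be frozen. *)
Lemma iter_mulX_mul2 N a b F (P : {ffun I -> int} -> int -> int -> U) : a != b ->
  (forall n, P (dec a n) = P n) -> (forall n, P (dec b n) = P n) ->
  (forall n, F n = P n (n a) (n b)) ->
  forall n, iter N (mulX a b) F n = iter N (@mul2 U) (P n) (n a) (n b).
Proof.
move=> ab Pa Pb FP; elim: N => // N IH n.
by rewrite !iterS /mulX /mul2 !IH Pa Pb !dec_eq !dec_neq // eq_sym.
Qed.

Variable N : I -> I -> nat.

Definition pairs_from a (s : seq I) : seq (I * I) := flatten [seq nseq (N a b) (a, b) | b <- s].

Fixpoint all_pairs (s : seq I) : seq (I * I) :=
  if s is a :: s' then pairs_from a s' ++ all_pairs s' else [::].

Lemma pairs_fromP a s p : p \in pairs_from a s -> p.1 = a /\ p.2 \in s.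
Proof. by move=> /flattenP[_ /mapP[b bs ->]]; rewrite mem_nseq => /andP[_ /eqP ->]. Qed.

(** The factors x_a - x_b with b after a are applied first; the others preserve lower
bounds. *)
Lemma lowb_all_pairs s1 a s2 F B : lowb a B (foldmul (pairs_from a s2) F) ->
  lowb a B (foldmul (all_pairs (s1 ++ a :: s2)) F).
Proof.
move=> h; elim: s1 => [|c s1 IH] /=; rewrite foldmul_cat.
  by rewrite foldmulC; apply: lowb_foldmul.
exact: lowb_foldmul.
Qed.

End Multiplication.

Lemma foldmul_map (U U' : zmodType) (phi : U -> U') F (l : seq (I * I)) n :
  (forall x y, phi (x - y) = phi x - phi y) ->
  phi (foldmul l F n) = foldmul l (fun n => phi (F n)) n.
Proof. by move=> hp; elim: l n => //= p l IH n; rewrite /mulX hp !IH. Qed.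

End MultiVariableSeries.

Section ProductSeries.
Variables (R : realType) (V : gr_vertex_superalgebra R) (g : vautomorphism V)
  (W : gtwisted_module g).
Local Notation C := (R[i]).
Local Notation YWl := (@YW_linearl R V g W).
Local Notation YWr := (@YW_linearr R V g W).
Variables (I : finType) (v : I -> V) (alpha : I -> C) (j : I -> nat).
Implicit Types (n : {ffun I -> int}) (s : seq I).

Definition Ymode (x : V) (i : I) n (y : W) : W := YW x y ((n i)%:~R - alpha i) (j i).

Definition Yprod s (w : W) n : W := foldr (fun i => Ymode (v i) i n) w s.

Lemma Ymode_lin x i n : linear (Ymode x i n).
Proof. exact: YWr. Qed.

Lemma Yprod_dec s w a n : a \notin s -> Yprod s w (dec a n) = Yprod s w n.
Proof.
elim: s => //= b s IH; rewrite inE negb_or => /andP[ab /IH ->].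
by rewrite /Ymode dec_neq // eq_sym.
Qed.

Lemma foldmul_Ymode x c F l n : (forall p, p \in l -> p.1 != c /\ p.2 != c) ->
  foldmul l (fun n => Ymode x c n (F n)) n = Ymode x c n (foldmul l F n).
Proof.
elim: l n => //= p l IH n hl.
have [p1 p2] := hl p (mem_head _ _).
have {}IH m := IH m (fun q ql => hl q (mem_behead (s := p :: l) ql)).
rewrite /mulX !IH (linB (Ymode_lin x c n)) /Ymode !dec_neq // eq_sym //.
Qed.

(** After multiplication by the power of x_i - x_b, the field of u can be moved past that
of v b, which then acts from the left without affecting the exponent of x_i.  When
all of s has been passed, the field of u acts on w itself. *)
Lemma lowb_move_right N i u w B s : i \notin s -> uniq s ->
  (forall b, b \in s -> exchangeable W (alpha i) (alpha b) u (v b) (j i) (j b) (N i b)) ->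
  (forall n, n i < B -> Ymode u i n w = 0) ->
  lowb i B (foldmul (pairs_from N i s) (fun n => Ymode u i n (Yprod s w n))).
Proof.
move=> + + + hB; elim: s => [|b s IH] //; rewrite inE negb_or /= => /andP[ib iS] /andP[bs us] hex.
have {}IH := IH iS us (fun c cs => hex c (mem_behead (s := b :: s) cs)).
have [v' hv'] := hex b (mem_head _ _).
rewrite /pairs_from /= foldmul_cat foldmulC foldmul_nseq.
have -> : iter (N i b) (mulX i b) (fun n => Ymode u i n (Ymode (v b) b n (Yprod s w n))) =
    iter (N i b) (mulX i b) (fun n => Ymode v' b n (Ymode u i n (Yprod s w n))).
  apply/funext => n.
  rewrite (@iter_mulX_mul2 _ _ _ _ _ _ (fun (n : {ffun I -> int}) (n1 n2 : int) =>
    YW u (YW (v b) (Yprod s w n) (n2%:~R - alpha b) (j b)) (n1%:~R - alpha i) (j i))) //; last 2 first.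
  - by move=> m; rewrite Yprod_dec.
  - by move=> m; rewrite Yprod_dec.
  rewrite hv'.
  rewrite (@iter_mulX_mul2 _ _ _ _ _ _ (fun (n : {ffun I -> int}) (n1 n2 : int) =>
    YW v' (YW u (Yprod s w n) (n1%:~R - alpha i) (j i)) (n2%:~R - alpha b) (j b))) //.
  - by move=> m; rewrite Yprod_dec.
  by move=> m; rewrite Yprod_dec.
rewrite -foldmul_nseq foldmulC; apply: lowb_foldmul => n nB.
rewrite foldmul_Ymode; last first.
  move=> p /pairs_fromP[-> p2]; split => //.
  by apply: contra bs => /eqP <-.
rewrite (IH n nB); exact: (lin0 (Ymode_lin _ _ _)).
Qed.

Hypothesis hW : lower_bounded W.

Lemma lowb_Yprod N i w B s1 s2 : uniq (s1 ++ i :: s2) ->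
  (forall b t, t \in wt_index (v i) ->
     exchangeable W (alpha i) (alpha b) (wt_part (v i) t) (v b) (j i) (j b) (N i b)) ->
  (forall n t, t \in wt_index (v i) -> n i < B -> Ymode (wt_part (v i) t) i n w = 0) ->
  lowb i B (foldmul (all_pairs N (s1 ++ i :: s2)) (Yprod (s1 ++ i :: s2) w)).
Proof.
move=> us hex hB; apply: lowb_all_pairs.
have [us1 us2 dis] : [/\ i \notin s2, uniq s2 & forall c, c \in s1 -> c != i /\ c \notin s2].
  move: us; rewrite cat_uniq => /and3P[_ /hasPn h /= /andP[h1 h2]]; split => // c cs.
  split; first by apply: contraTneq cs => ->; apply: h; exact: mem_head.
  by apply/negP => cs2; have := h c; rewrite inE cs2 orbT => /(_ isT); rewrite /= cs.
have base : lowb i B (foldmul (pairs_from N i s2) (Yprod (i :: s2) w)).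
  have [_ _ vE] := wt_partP (v i) => n nB.
  have -> : Yprod (i :: s2) w = (fun n => \sum_(t <- wt_index (v i))
      Ymode (wt_part (v i) t) i n (Yprod s2 w n)).
    apply/funext => m; rewrite /= {1}vE /Ymode; exact: (lin_sum (YWl _ _ _)).
  rewrite foldmul_sum big_seq big1 // => t ti.
  apply: (lowb_move_right us1 us2 _ _ nB) => [b bs|m]; first exact: hex.
  exact: hB.
elim: s1 dis {us} => //= c s1 IH dis n nB.
have [ci cs2] := dis c (mem_head _ _).
rewrite foldmul_Ymode; last first.
  move=> p /pairs_fromP[-> p2]; rewrite eq_sym; split => //.
  by apply: contraNneq cs2 => <-.
rewrite (IH (fun d ds => dis d (mem_behead (s := c :: s1) ds)) n nB).
exact: (lin0 (Ymode_lin _ _ _)).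
Qed.

(** The shift lowers the exponent of x_b indefinitely.  The field of v b acts on a vector
that involves neither x_a nor x_b, and its modes of low exponent kill this vector. *)
Lemma Yprod_trunc s1 a b s2 w n : b \in s2 -> uniq (s1 ++ a :: s2) ->
  exists m0, forall m, (m0 <= m)%N ->
    Yprod (s1 ++ a :: s2) w (iter m (fun n => inc a (dec b n)) n) = 0.
Proof.
move=> bs2 us.
have [t1 [t2 [e bt1 bt2]]] : exists t1 t2, [/\ s1 ++ a :: s2 = t1 ++ b :: t2, a \in t1 & b \notin t2].
  case/splitPr: bs2 us => t1 t2 us; exists (s1 ++ a :: t1), t2; split.
  - by rewrite -catA.
  - by rewrite mem_cat mem_head orbT.
  by move: us; rewrite cat_uniq /= cat_uniq /= => /and3P[_ _ /andP[_ /and3P[_ _ /andP[]]]].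
have at2 : a \notin b :: t2.
  move: us; rewrite e cat_uniq => /and3P[_ /hasPn h _]; apply/negP => /h.
  by rewrite /= bt1.
rewrite e; set sh := fun n => inc a (dec b n).
have inv (m : nat) : Yprod t2 w (iter m sh n) = Yprod t2 w n.
  elim: m => //= m <-; set k := iter m sh n.
  have incP c k' : c \notin t2 -> Yprod t2 w (inc c k') = Yprod t2 w k'.
    by move=> ct; rewrite -(Yprod_dec _ _ ct) incK.
  rewrite /sh incP ?Yprod_dec //; apply: contra at2; rewrite inE => ->; exact: orbT.
have nb (m : nat) : iter m sh n b = n b - m%:Z.
  elim: m => [|m IH]; first by rewrite subr0.
  have ba : b != a by apply: contraNneq at2 => <-; exact: mem_head.
  rewrite iterS /sh ffunE (negPf ba) dec_eq IH; lia.
have [q hq] := YW_trunc hW (v b) (Yprod t2 w n).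
exists (absz (n b - q) + absz (Num.floor (complex.Re (alpha b))) + 2)%N => m mm.
have Z : Yprod (b :: t2) w (iter m sh n) = 0.
  rewrite /= inv /Ymode nb hq //.
  have -> : complex.Re ((n b - m%:Z)%:~R - alpha b) = (n b - m%:Z)%:~R - complex.Re (alpha b).
    have -> : ((n b - m%:Z)%:~R : C) = ((n b - m%:Z)%:~R : R)%:C by rewrite rmorph_int.
    by case: (alpha b).
  have h1 := Num.Theory.floor_le (complex.Re (alpha b)).
  have : (n b - m%:Z)%:~R < (q + Num.floor (complex.Re (alpha b)))%:~R :> R by rewrite ltr_int; lia.
  rewrite (rmorphD _ q) /=; lra.
rewrite /Yprod foldr_cat -/(Yprod (b :: t2) w _) Z.
by elim: t1 {e bt1} => //= c t1 ->; exact: (lin0 (Ymode_lin _ _ _)).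
Qed.

Lemma Yprod_filt s w : exists K : R, forall n,
  filt (\sum_(i <- s) (n i)%:~R - K) (\sum_(i <- s) (n i)%:~R + K) (Yprod s w n).
Proof.
elim: s => [|i s [K hK]].
  by have [K hK] := filt_exists w; exists K => n; rewrite !big_nil sub0r add0r.
have [L hL] := filt_YW W (v i).
exists (K + L + `|complex.Re (alpha i)|) => n; rewrite !big_cons.
have [l e hl] := hL _ _ _ ((n i)%:~R - alpha i) (j i) (hK n).
exists l => // t /hl[tG]; split => //.
have ReE : complex.Re ((n i)%:~R - alpha i) = (n i)%:~R - complex.Re (alpha i).
  have -> : ((n i)%:~R : C) = ((n i)%:~R : R)%:C by rewrite rmorph_int.
  by case: (alpha i).
move: b; rewrite ReE => /andP[b1 b2].
have h1 := ler_norm (complex.Re (alpha i)); have h2 := ler_norm (- complex.Re (alpha i)).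
rewrite normrN in h2; lra.
Qed.

End ProductSeries.

(** * Dividing series by differences of variables *)

Section SeriesDivision.
Variables (R : realType) (I : finType) (z : I -> R[i]).
Local Notation C := (R[i]).
Hypothesis z0 : forall i, z i != 0.
Implicit Types (a b : I) (n : {ffun I -> int}) (F : {ffun I -> int} -> C).

Definition mono n : C := \prod_i z i ^ n i.

Lemma mono_dec a n : mono n = z a * mono (dec a n).
Proof.
rewrite /mono (bigD1 a) //= [in RHS](bigD1 a) //= mulrA dec_eq; congr (_ * _).
  by rewrite -{2}[z a]expr1z -expfzDr //; congr (_ ^ _); lia.
by apply: eq_bigr => i ia; rewrite dec_neq.
Qed.

Lemma sums_mulX a b F S : sums_to (fun n => F n * mono n) S ->
  sums_to (fun n => mulX a b F n * mono n) ((z a - z b) * S).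
Proof.
move=> h.
have sh c : sums_to (fun n => F (dec c n) * mono n) (z c * S).
  apply: sums_to_ext (sums_toZ (z c) (sums_to_shift (@decK _ c) (@incK _ c) h)) => n /=.
  by rewrite (mono_dec c n); ring.
rewrite mulrBl -mulN1r; apply: sums_to_ext (sums_toD (sh a) (sums_toZ (-1) (sh b))) => n.
by rewrite /mulX; ring.
Qed.

Definition shift_back a b n : {ffun I -> int} := inc a (dec b n).

Definition eventually0 a b F : Prop := forall n, exists m0, forall m, (m0 <= m)%N ->
  F (iter m (shift_back a b) n) = 0.

Lemma shift_backK a b : cancel (shift_back a b) (shift_back b a).
Proof. by move=> n; rewrite /shift_back incK decK. Qed.

Lemma iter_shift_back_inj a b m : injective (iter m (shift_back a b)).
Proof. by elim: m => //= m IH x y /(can_inj (@shift_backK a b))/IH. Qed.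

Lemma iter_shift_backC a b c m n :
  dec c (iter m (shift_back a b) n) = iter m (shift_back a b) (dec c n).
Proof. by elim: m => //= m <-; rewrite /shift_back -inc_decC decC. Qed.

Lemma eventually0_mulX a b c d F : eventually0 a b F -> eventually0 a b (mulX c d F).
Proof.
move=> h n; have [m1 h1] := h (dec c n); have [m2 h2] := h (dec d n).
exists (maxn m1 m2) => m; rewrite geq_max => /andP[? ?].
by rewrite /mulX !iter_shift_backC h1 // h2 // subrr.
Qed.

Lemma eventually0_foldmul a b l F : eventually0 a b F -> eventually0 a b (foldmul l F).
Proof. by move=> h; elim: l => //= p l IH; apply: eventually0_mulX. Qed.

(** The geometric expansion of 1 / (x_a - x_b) in powers of x_b / x_a, cut after M terms. *)
Lemma telescope_mulX a b F M n : F n =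
  \sum_(m < M) mulX a b F (inc a (iter m (shift_back a b) n)) + F (iter M (shift_back a b) n).
Proof.
elim: M => [|M IH]; first by rewrite big_ord0 add0r.
rewrite big_ord_recr /= [LHS]IH -addrA; congr (_ + _).
by rewrite /mulX incK -inc_decC -/(shift_back a b _) subrK.
Qed.

Lemma geometric_sum_le (rho : R) M : 0 <= rho < 1 -> \sum_(m < M) rho ^+ m <= (1 - rho)^-1.
Proof.
move=> /andP[r0 r1]; have h : 0 < 1 - rho by lra.
rewrite -[leRHS]mul1r ler_pdivlMr //.
have -> : (\sum_(m < M) rho ^+ m) * (1 - rho) = 1 - rho ^+ M.
  elim: M => [|M IH]; first by rewrite big_ord0 mul0r expr0 subrr.
  by rewrite big_ord_recr mulrDl IH exprS /=; ring.
by have := exprn_ge0 M r0; lra.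
Qed.

(** The coefficients of F are finite sums of those of (x_a - x_b) F along the shifts of
[telescope_mulX], and at z each shift contributes a factor |z b| / |z a| < 1. *)
Lemma abs_conv_div a b F : normc (z b) < normc (z a) -> eventually0 a b F ->
  abs_convergent (fun n => mulX a b F n * mono n) ->
  abs_convergent (fun n => F n * mono n).
Proof.
move=> zba ev /abs_convP[K hK]; apply/abs_convP.
have za0 : 0 < normc (z a) by rewrite normc_gt0.
have zb0 : 0 < normc (z b) by rewrite normc_gt0.
pose rho := normc (z b) / normc (z a).
have rho1 : 0 <= rho < 1 by rewrite divr_ge0 ?ltW //= ltr_pdivrMr // mul1r.
have K0 : 0 <= K.
  by apply: le_trans (hK fset0); rewrite sumr_ge0 // => i _; exact: normc_ge0.
exists ((normc (z a))^-1 * (1 - rho)^-1 * K) => A.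
have [m0 hm0] := choice ev.
pose M := (\sum_(n <- A) m0 n)%N.
have FM n : n \in A -> F (iter M (shift_back a b) n) = 0.
  by move=> nA; apply: hm0; rewrite /M (big_rem n) //= leq_addr.
pose T n := normc (mulX a b F n * mono n).
have monoE m n : normc (mono n) =
    (normc (z a))^-1 * rho ^+ m * normc (mono (inc a (iter m (shift_back a b) n))).
  rewrite (mono_dec a (inc a _)) incK normcM.
  have -> : normc (mono n) = rho ^+ m * normc (mono (iter m (shift_back a b) n)).
    elim: m => [|m ->]; first by rewrite mul1r.
    rewrite exprS iterS; set k := iter m _ n.
    have e1 : mono k = z b * mono (dec b k) := mono_dec b k.
    have e2 : mono (shift_back a b k) = z a * mono (dec b k).
      by rewrite (mono_dec a) /shift_back incK.
    rewrite e1 e2 !normcM /rho; field; exact: lt0r_neq0.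
  by field; exact: lt0r_neq0.
apply: (@le_trans _ _ (\sum_(n <- A) \sum_(m < M) (normc (z a))^-1 * rho ^+ m *
    T (inc a (iter m (shift_back a b) n)))).
  rewrite big_seq [leRHS]big_seq; apply: ler_sum => n nA.
  rewrite (telescope_mulX a b F M n) FM // addr0 mulr_suml.
  apply: (le_trans (normc_sum _ _ _)); apply: ler_sum => m _.
  by rewrite normcM (monoE m n) /T normcM mulrCA mulrA.
rewrite exchange_big /=.
apply: (@le_trans _ _ (\sum_(m < M) (normc (z a))^-1 * rho ^+ m * K)); last first.
  rewrite -mulr_suml ler_wpM2r // -mulr_sumr ler_wpM2l ?invr_ge0 ?(ltW za0) //.
  exact: geometric_sum_le.
apply: ler_sum => m _; rewrite -mulr_sumr ler_wpM2l //.
  apply: mulr_ge0; first by rewrite invr_ge0 ltW.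
  by apply: exprn_ge0; case/andP: rho1.
apply: le_trans (hK [fset inc a (iter m (shift_back a b) n) | n in A]%fset).
rewrite big_imfset //= => x y _ _ /(can_inj (@incK _ a)); exact: iter_shift_back_inj.
Qed.

Lemma abs_conv_foldmul l F : (forall p, p \in l -> normc (z p.2) < normc (z p.1)) ->
  (forall p, p \in l -> eventually0 p.1 p.2 F) ->
  abs_convergent (fun n => foldmul l F n * mono n) -> abs_convergent (fun n => F n * mono n).
Proof.
elim: l => //= p l IH hz ev h; apply: IH => [q ql|q ql|].
- by apply: hz; rewrite inE ql orbT.
- by apply: ev; rewrite inE ql orbT.
apply: abs_conv_div h; first by apply: hz; rewrite mem_head.
by apply: eventually0_foldmul; apply: ev; rewrite mem_head.
Qed.

Lemma sums_foldmul l F S : sums_to (fun n => F n * mono n) S ->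
  sums_to (fun n => foldmul l F n * mono n) ((\prod_(p <- l) (z p.1 - z p.2)) * S).
Proof.
move=> h; elim: l => [|p l IH]; first by rewrite big_nil mul1r.
by rewrite big_cons -mulrA; apply: sums_mulX.
Qed.

End SeriesDivision.

Section PairProducts.
Variables (T : comNzRingType) (k : nat) (N : 'I_k -> 'I_k -> nat) (x : 'I_k -> T).

Lemma prod_all_pairs_list (s : seq 'I_k) : pairwise (fun a b : 'I_k => (a < b)%N) s ->
  \prod_(p <- all_pairs N s) (x p.1 - x p.2) =
  \prod_(a <- s) \prod_(b <- s | (a < b)%N) (x a - x b) ^+ N a b.
Proof.
elim: s => [|a s IH] /=; first by rewrite !big_nil.
move=> /andP[/allP as_ ps]; rewrite big_cat big_cons IH //=; congr (_ * _).
  rewrite big_cons ltnn big_flatten big_map /= big_seq [RHS]big_seq_cond.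
  apply: eq_big => [b|b bs]; first by have [/as_ ->|//] := boolP (b \in s).
  by rewrite big_nseq iter_mulr_1.
rewrite big_seq [RHS]big_seq; apply: eq_bigr => b bs.
by rewrite [RHS]big_cons ltnNge (ltnW (as_ b bs)).
Qed.

Lemma pairwise_enum_ord : pairwise (fun a b : 'I_k => (a < b)%N) (enum 'I_k).
Proof.
have := iota_ltn_sorted 0 k; rewrite -val_enum_ord sorted_map sorted_pairwise //.
by move=> b a c; exact: ltn_trans.
Qed.

Lemma prod_all_pairs : \prod_(p <- all_pairs N (enum 'I_k)) (x p.1 - x p.2) =
  \prod_(i < k) \prod_(j < k | (i < j)%N) (x i - x j) ^+ N i j.
Proof.
rewrite prod_all_pairs_list ?pairwise_enum_ord // big_enum; apply: eq_bigr => a _.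
by rewrite big_enum_cond.
Qed.

End PairProducts.

(** * Orders of rational functions *)

Lemma congruence_mul (T : comNzRingType) (p q p' q' d b1 b2 : T) :
  p = p' + d * b1 -> q = q' + d * b2 -> p * q = p' * q' + d * (b1 * q + p' * b2).
Proof. by move=> -> ->; ring. Qed.

Lemma frac_cancel (K : fieldType) (x n a b d : K) (c s e : nat) (m : int) :
  x != 0 -> b != 0 -> d != 0 -> c%:Z = s%:Z + e%:Z + m ->
  x ^+ c * n / (x ^+ e * d) = x ^ m * (a / b) -> x ^+ s * n * b = a * d.
Proof.
move=> x0 b0 d0 cE h.
have e1 : x ^+ c = x ^+ s * x ^+ e * x ^ m by rewrite !exprnP cE !expfzDr.
have u0 : x ^ m != 0 by rewrite expfz_neq0.
have w0 : x ^+ e != 0 by rewrite expf_neq0.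
move: h; rewrite e1; move: (x ^ m) (x ^+ e) (x ^+ s) u0 w0 => u w y u0 w0 h.
apply: (mulfI u0).
have -> : u * (y * n * b) = (y * w * u * n / (w * d)) * d * b.
  by field; rewrite d0.
by rewrite h; field.
Qed.

Section Orders.
Variables (R : realType) (k : nat).
Local Notation C := (R[i]).
Local Notation P := (mpoly.mpoly k C).
Local Notation X l := (mpoly.mpolyX C (mpoly.mnm1 l) : P).

Definition subst_at (i : 'I_k) (t : P) : P -> P :=
  mpoly.comp_mpoly [tuple (if l == i then t else X l) | l < k].

Lemma subst_atX i t l : subst_at i t (X l) = if l == i then t else X l.
Proof. by rewrite /subst_at mpoly.comp_mpolyXU -tnth_nth tnth_mktuple. Qed.

Lemma subst_atM i t : {morph subst_at i t : a b / a * b}.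
Proof. exact: rmorphM. Qed.

Lemma subst_atB i t : {morph subst_at i t : a b / a - b}.
Proof. exact: rmorphB. Qed.

Lemma subst_at1 i t : subst_at i t 1 = 1.
Proof. exact: rmorph1. Qed.

(** The polynomials with this property contain the variables and are closed under linear
combinations and products. *)
Lemma subst_at_cong i t (a : P) : exists b : P, a = subst_at i t a + (X i - t) * b.
Proof.
have lin c (p q : P) : (exists b, p = subst_at i t p + (X i - t) * b) ->
    (exists b, q = subst_at i t q + (X i - t) * b) ->
    exists b, c *: p + q = subst_at i t (c *: p + q) + (X i - t) * b.
  move=> [b1 e1] [b2 e2]; exists (c *: b1 + b2).
  have -> : subst_at i t (c *: p + q) = c *: subst_at i t p + subst_at i t q.
    by rewrite /subst_at mpoly.comp_mpolyD mpoly.comp_mpolyZ.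
  by rewrite {1}e1 {1}e2 scalerDr mulrDr -scalerAr addrACA.
have mul (p q : P) : (exists b, p = subst_at i t p + (X i - t) * b) ->
    (exists b, q = subst_at i t q + (X i - t) * b) ->
    exists b, p * q = subst_at i t (p * q) + (X i - t) * b.
  move=> [b1 e1] [b2 e2]; rewrite subst_atM.
  by exists (b1 * q + subst_at i t p * b2); exact: congruence_mul.
have one : exists b, 1 = subst_at i t 1 + (X i - t) * b.
  by exists 0; rewrite subst_at1 mulr0 addr0.
have var l : exists b, X l = subst_at i t (X l) + (X i - t) * b.
  rewrite subst_atX; case: eqP => [->|_]; last by exists 0; rewrite mulr0 addr0.
  by exists 1; rewrite mulr1 addrC subrK.
rewrite [a]mpoly.mpolyE; elim/big_rec: _ => [|m y _ hy].
  by exists 0; rewrite /subst_at mpoly.comp_mpoly0 mulr0 addr0.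
apply: (lin _ _ _ _ hy); rewrite (mpoly.mpolyXE_id _ m).
elim/big_rec: _ => [|l y' _ hy']; first exact: one.
apply: (mul _ _ _ hy'); move: (m l) => e.
by elim: e => [|e IH]; [exact: one|rewrite exprS; exact: mul (var l) IH].
Qed.

Lemma subst_at0 i t : subst_at i t 0 = 0.
Proof. exact: rmorph0. Qed.

Lemma subst_atN1 i t : subst_at i t (- 1) = - 1.
Proof. exact: rmorphN1. Qed.

Opaque subst_at.

Section OneDivisor.
Variables (i : 'I_k) (t : P).
Hypothesis tt : subst_at i t t = t.
Let q : P := X i - t.
Let sg := subst_at i t.
Hypothesis q0 : q != 0.

(** The multiples of q are the kernel of a ring morphism to an integral domain; hence q
is prime. *)
Lemma pdividesP (a : P) : pdivides q a <-> sg a = 0.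
Proof.
split=> [[b ->]|h]; first by rewrite /sg /q subst_atM subst_atB subst_atX eqxx tt subrr mul0r.
by have [b e] := subst_at_cong i t a; exists b; rewrite {1}e -/sg h add0r.
Qed.

(** The condition on d' says that q does not divide it, so e is the exact multiplicity of
q in d. *)
Definition mult_in e (d : P) : Prop := exists2 d', d = q ^+ e * d' & sg d' != 0.

Lemma mult_in1 : mult_in 0 1.
Proof. by exists 1; rewrite ?mulr1 // /sg subst_at1 oner_neq0. Qed.

Lemma mult_inM e1 e2 d1 d2 : mult_in e1 d1 -> mult_in e2 d2 -> mult_in (e1 + e2) (d1 * d2).
Proof.
move=> [a -> ha] [b -> hb]; exists (a * b); first by rewrite exprD mulrACA.
by rewrite /sg subst_atM; exact: mulf_neq0 ha hb.
Qed.

Lemma mult_inX n e d : mult_in e d -> mult_in (n * e) (d ^+ n).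
Proof.
move=> h; elim: n => [|n IH]; first exact: mult_in1.
by rewrite mulSn exprS; apply: mult_inM.
Qed.

Lemma mult_in_prod (T : finType) (Q : pred T) (e : T -> nat) (d : T -> P) :
  (forall l, Q l -> mult_in (e l) (d l)) ->
  mult_in (\sum_(l | Q l) e l) (\prod_(l | Q l) d l).
Proof.
move=> h; elim/big_rec2: _ => [|l y1 y2 Ql hy]; first exact: mult_in1.
by apply: mult_inM => //; apply: h.
Qed.

Lemma mult_in0 d : sg d != 0 -> mult_in 0 d.
Proof. by move=> h; exists d; rewrite ?mul1r. Qed.

(** Were the order smaller, clearing denominators would make q divide the product of two
polynomials on which sg does not vanish. *)
Lemma order_ge_fraction (f : ratfun R k) c e num' (m : int) :
  rf_num f = q ^+ c * num' -> mult_in e (rf_den f) -> m <= c%:Z - e%:Z ->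
  order_ge q f m.
Proof.
move=> numE [D' denE sD'] mce m' [A [B [nA nB hE]]].
rewrite (le_trans mce) // leNgt; apply/negP => lt.
have sA : sg A != 0 by apply/eqP => /pdividesP.
have sB : sg B != 0 by apply/eqP => /pdividesP.
have s0 : sg 0 = 0 := subst_at0 i t.
have B0 : B != 0 by apply: contraNneq sB => ->; rewrite s0.
have D0 : D' != 0 by apply: contraNneq sD' => ->; rewrite s0.
have tq0 : tofrac q != 0 by rewrite tofrac_eq0.
pose s := absz (c%:Z - e%:Z - m')%R.
have sE : c%:Z = s%:Z + e%:Z + m' by rewrite /s; lia.
have spos : (0 < s)%N by rewrite /s; lia.
have key : q ^+ s * num' * B = A * D'.
  apply/eqP; rewrite -tofrac_eq !tofracM tofracXn; apply/eqP.
  move: hE; rewrite /rf_frac numE denE !tofracM !tofracXn => hE.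
  have tB : tofrac B != 0 by rewrite tofrac_eq0.
  have tD : tofrac D' != 0 by rewrite tofrac_eq0.
  exact: frac_cancel tq0 tB tD sE hE.
have : sg (q ^+ s * num' * B) = 0.
  apply/pdividesP; exists (q ^+ s.-1 * num' * B).
  by rewrite -{1}(prednK spos) exprS !mulrA.
rewrite key => sAD; have := mulf_neq0 sA sD'.
have -> : sg A * sg D' = 0 := etrans (esym (subst_atM i t A D')) sAD.
by rewrite eqxx.
Qed.

End OneDivisor.

Lemma X_neq0 l : X l != 0.
Proof.
apply/eqP => /(congr1 (mpoly.mcoeff (mpoly.mnm1 l))).
by rewrite mpoly.mcoeffXU mpoly.mcoeff0 eqxx => /eqP; rewrite oner_eq0.
Qed.

Lemma X_inj a b : X a = X b -> a = b.
Proof.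
move=> /(congr1 (mpoly.mcoeff (mpoly.mnm1 b))); rewrite !mpoly.mcoeffXU eqxx.
by case: eqP => // _ /eqP; rewrite eq_sym oner_eq0.
Qed.

Lemma XB_neq0 a b : a != b -> X a - X b != 0.
Proof. by move=> ab; rewrite subr_eq0; apply: contra ab => /eqP/X_inj ->. Qed.

Lemma rf_den_mult0 (f : ratfun R k) i : mult_in i 0 (rf_exp0 f i) (rf_den f).
Proof.
rewrite /rf_den -[rf_exp0 f i]addn0; apply: mult_inM.
  have -> : rf_exp0 f i = (\sum_(l < k) rf_exp0 f l * (l == i))%N.
    rewrite (bigD1 i) //= eqxx muln1 big1 ?addn0 // => l /negPf ->; exact: muln0.
  apply: mult_in_prod => l _; apply: mult_inX; case: eqP => [->|/eqP li].
    by exists 1; rewrite ?mulr1 ?subr0 ?expr1 // subst_at1 oner_neq0.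
  by apply: mult_in0; rewrite subst_atX (negPf li) X_neq0.
have -> : 0%N = (\sum_(a < k) \sum_(b < k | (a < b)%N) (rf_exp f a b * 0))%N.
  by rewrite big1 // => a _; rewrite big1 // => b _; rewrite muln0.
apply: mult_in_prod => a _; apply: mult_in_prod => b ab; apply: mult_inX; apply: mult_in0.
rewrite subst_atB !subst_atX; have ab' : a != b by rewrite neq_ltn ab.
have [ai|ai] := eqVneq a i; have [bi|bi] := eqVneq b i.
- by rewrite ai bi eqxx in ab'.
- by rewrite sub0r oppr_eq0 X_neq0.
- by rewrite subr0 X_neq0.
exact: XB_neq0.
Qed.

(** Only the factors X_i - X_j and X_j - X_i, of which one occurs, vanish for X_i = X_j. *)
Lemma rf_den_mult_diag (f : ratfun R k) i j : i != j -> exists2 e,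
  (e <= rf_exp f i j + rf_exp f j i)%N & mult_in i (X j) e (rf_den f).
Proof.
move=> ij; pose d1 a b := ((a == i) && (b == j)); pose d2 a b := ((a == j) && (b == i)).
exists (0 + \sum_(a < k) \sum_(b < k | (a < b)%N) rf_exp f a b * (d1 a b || d2 a b))%N.
  rewrite add0n.
  apply: (@leq_trans (\sum_(a < k) \sum_(b < k) (rf_exp f a b * d1 a b + rf_exp f a b * d2 a b))%N).
    apply: leq_sum => a _; rewrite big_mkcond; apply: leq_sum => b _.
    case: ifP => // _; rewrite -mulnDr leq_mul2l; apply/orP; right.
    by case: (d1 a b); case: (d2 a b).
  have delta (h : 'I_k -> 'I_k -> nat) (c d : 'I_k) :
      (\sum_(a < k) \sum_(b < k) h a b * ((a == c) && (b == d)) = h c d)%N.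
    rewrite (bigD1 c) //= [Z in (_ + Z)%N]big1 => [|a ac]; last first.
      by rewrite big1 // => b _; rewrite (negPf ac) muln0.
    rewrite (bigD1 d) //= !eqxx muln1 big1 ?addn0 // => b bd.
    by rewrite (negPf bd) muln0.
  under eq_bigr do rewrite big_split.
  by rewrite big_split /= !delta.
have sgX l : subst_at i (X j) (X l) = X (if l == i then j else l).
  by rewrite subst_atX; case: eqP.
rewrite /rf_den; apply: mult_inM.
  have -> : 0%N = (\sum_(l < k) rf_exp0 f l * 0)%N by rewrite big1 // => l _; rewrite muln0.
  apply: mult_in_prod => l _; apply: mult_inX; apply: mult_in0.
  by rewrite sgX X_neq0.
apply: mult_in_prod => a _; apply: mult_in_prod => b ab; apply: mult_inX.
have ab' : a != b by rewrite neq_ltn ab.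
have [/andP[/eqP -> /eqP ->]|n1] := boolP (d1 a b).
  by exists 1; rewrite ?mulr1 ?expr1 // subst_at1 oner_neq0.
have [/andP[/eqP -> /eqP ->]|n2] := boolP (d2 a b).
  exists (- 1); first by rewrite expr1 mulrN1 opprB.
  by rewrite subst_atN1 oppr_eq0 oner_neq0.
apply: mult_in0; rewrite subst_atB !sgX; apply: XB_neq0.
move: n1 n2 ab'; rewrite /d1 /d2.
have [->|ai] := eqVneq a i; have [->|bi] := eqVneq b i => //=.
  by rewrite eq_sym.
by rewrite andbT.
Qed.

End Orders.

Section LaurentPolynomials.
Variables (R : realType) (k : nat).
Local Notation C := (R[i]).
Local Notation P := (mpoly.mpoly k C).
Local Notation X l := (mpoly.mpolyX C (mpoly.mnm1 l) : P).
Variables (B : 'I_k -> int) (p : {ffun 'I_k -> int} -> C) (c0 : int).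
Hypothesis hB : forall i, lowb i (B i) p.
Hypothesis hp : forall n : {ffun 'I_k -> int}, c0 < \sum_i n i -> p n = 0.

(** Large enough for the support of p: each n_i is at least B i, hence at most c0 minus
the sum of the other lower bounds. *)
Definition box_size : nat := (absz c0 + 2 * \sum_i absz (B i))%N.+1.

Definition box_exp (m : {ffun 'I_k -> 'I_box_size}) : {ffun 'I_k -> int} :=
  [ffun i => (m i)%:Z - (absz (B i))%:Z].

Definition laurent_num : P := \sum_m p (box_exp m) *: \prod_i X i ^+ m i.

Definition laurent_ratfun (N : 'I_k -> 'I_k -> nat) : ratfun R k :=
  RatFun laurent_num (fun i => absz (B i)) N.

Lemma box_exp_inj : injective box_exp.
Proof.
move=> m m' /ffunP e; apply/ffunP => i; apply: val_inj; have := e i.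
by rewrite !ffunE => /addIr[].
Qed.

Lemma off_box n : (forall m, n <> box_exp m) -> p n = 0.
Proof.
move=> hn; have [/existsP[i /hB //]|/existsPn lo] := boolP [exists i, n i < B i].
have {}lo i : B i <= n i by rewrite leNgt.
have [/hp //|up] := ltP c0 (\sum_i n i).
have bnd i : 0 <= n i + (absz (B i))%:Z < box_size%:Z.
  have h1 := lo i.
  have h2 : \sum_(l < k | l != i) - (absz (B l))%:Z <= \sum_(l < k | l != i) n l.
    by apply: ler_sum => l _; have := lo l; lia.
  move: up; rewrite (bigD1 i) //= => up.
  have h3 : \sum_(l < k | l != i) - (absz (B l))%:Z = - (\sum_(l < k | l != i) absz (B l))%N%:Z.
    by rewrite sumrN (big_morph Posz PoszD (erefl _)).
  have h4 : (\sum_l absz (B l) = absz (B i) + \sum_(l < k | l != i) absz (B l))%N.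
    by rewrite (bigD1 i).
  rewrite /box_size h4; rewrite h3 in h2; move: h1 h2 up.
  move: (\sum_(l < k | l != i) n l) (\sum_(l < k | l != i) absz (B l))%N (n i) (B i) => s t x y.
  lia.
have lt i : (absz (n i + (absz (B i))%:Z)%R < box_size)%N.
  by have /andP[b1 b2] := bnd i; rewrite -ltz_nat gez0_abs.
case: (hn [ffun i => Ordinal (lt i)]); apply/ffunP => i; rewrite !ffunE /=.
by have /andP[b1 _] := bnd i; rewrite gez0_abs // addrK.
Qed.

Variable z : 'I_k -> C.
Hypothesis z0 : forall i, z i != 0.

Lemma laurent_sums : abs_sums_to (fun n => p n * mono z n)
  (\sum_m p (box_exp m) * mono z (box_exp m)).
Proof.
pose A : {fset {ffun 'I_k -> 'I_box_size}} := [fset m in enum {: {ffun 'I_k -> 'I_box_size}}]%fset.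
have A1 m : m \in A by rewrite inE mem_enum.
have off n : (forall m, n <> box_exp m) -> p n * mono z n = 0.
  by move=> /off_box ->; rewrite mul0r.
split.
  apply/(abs_conv_preim box_exp_inj off); apply: (@fin_abs_conv _ _ _ A) => m.
  by rewrite A1.
apply/(sums_to_preim _ box_exp_inj off).
have -> : \sum_m p (box_exp m) * mono z (box_exp m) =
    \sum_(m <- A) p (box_exp m) * mono z (box_exp m).
  rewrite -big_enum; apply: perm_big; apply: uniq_perm; rewrite ?enum_uniq ?fset_uniq // => m.
  by rewrite A1 mem_enum.
by apply: fin_sums_to => m; rewrite A1.
Qed.

Lemma laurent_eval N : rf_eval (laurent_ratfun N) z =
  (\sum_m p (box_exp m) * mono z (box_exp m)) /
  \prod_(i < k) \prod_(j < k | (i < j)%N) (z i - z j) ^+ N i j.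
Proof.
pose E0 := \prod_i z i ^+ absz (B i).
have E00 : E0 != 0 by apply/prodf_neq0 => i _; rewrite expf_neq0.
have numE : mpoly.meval z laurent_num = (\sum_m p (box_exp m) * mono z (box_exp m)) * E0.
  rewrite /laurent_num raddf_sum mulr_suml; apply: eq_bigr => m _.
  rewrite /= mpoly.mevalZ rmorph_prod -mulrA; congr (_ * _).
  rewrite /mono /E0 -big_split; apply: eq_bigr => i _ /=.
  rewrite rmorphXn /= mpoly.mevalXU ffunE !exprnP -expfzDr //; congr (_ ^ _); lia.
have denE : mpoly.meval z (rf_den (laurent_ratfun N)) =
    E0 * \prod_(i < k) \prod_(j < k | (i < j)%N) (z i - z j) ^+ N i j.
  rewrite /rf_den /= mpoly.mevalM !rmorph_prod; congr (_ * _); apply: eq_bigr => i _.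
    by rewrite /= rmorphXn /= mpoly.mevalXU.
  rewrite rmorph_prod; apply: eq_bigr => j _.
  by rewrite /= rmorphXn /= mpoly.mevalB !mpoly.mevalXU.
by rewrite /rf_eval numE denE invfM mulrA mulfK.
Qed.

Lemma laurent_order0 N i : order_ge_at0 i (laurent_ratfun N) (B i).
Proof.
pose c := absz (B i + (absz (B i))%:Z)%R.
pose num' : P := \sum_m p (box_exp m) *:
  (X i ^+ (m i - c) * \prod_(l < k | l != i) X l ^+ m l).
have q0 : X i - 0 != 0 by rewrite subr0 X_neq0.
have numE : rf_num (laurent_ratfun N) = (X i - 0) ^+ c * num'.
  rewrite subr0 /= /laurent_num mulr_sumr; apply: eq_bigr => m _.
  have [lt|ge] := ltP (box_exp m i) (B i).
    by rewrite (hB lt) !scale0r mulr0.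
  rewrite -scalerAr; congr (_ *: _); rewrite (bigD1 i) //= mulrA -exprD subnKC //.
  by move: ge; rewrite ffunE /c; lia.
have := @order_ge_fraction R k i 0 (subst_at0 i 0) q0 (laurent_ratfun N) c (absz (B i)) num' (B i)
  numE (rf_den_mult0 (laurent_ratfun N) i).
rewrite subr0; apply; rewrite /c; lia.
Qed.

Lemma laurent_order_diag N i j : i != j ->
  order_ge_at_diag i j (laurent_ratfun N) (- ((N i j)%:Z + (N j i)%:Z)).
Proof.
move=> ij; have [e eN hd] := rf_den_mult_diag (laurent_ratfun N) ij.
have tt : subst_at i (X j) (X j) = X j by rewrite subst_atX eq_sym (negPf ij).
apply: (order_ge_fraction tt (XB_neq0 R ij) (c := 0) (num' := laurent_num) _ hd).
  by rewrite mul1r.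
by rewrite /= in eN; lia.
Qed.

End LaurentPolynomials.

(** * Expansion of a product of twisted fields *)

Section Assembly.
Variables (R : realType) (V : gr_vertex_superalgebra R) (g : vautomorphism V)
  (W : gtwisted_module g).
Hypothesis hW : lower_bounded W.
Local Notation C := (R[i]).
Local Notation YWl := (@YW_linearl R V g W).
Local Notation YWr := (@YW_linearr R V g W).

Lemma all_pairs_mem (I : finType) (N : I -> I -> nat) s p : p \in all_pairs N s ->
  exists s1 s2, s = s1 ++ p.1 :: s2 /\ p.2 \in s2.
Proof.
elim: s => //= a s IH; rewrite mem_cat => /orP[/pairs_fromP[-> ps]|/IH[s1 [s2 [-> ps]]]].
  by exists [::], s.
by exists (a :: s1), s2.
Qed.

Lemma foldmul_top (I : finType) (F : {ffun I -> int} -> C) (c0 : int) l :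
  (forall n : {ffun I -> int}, c0 < \sum_i n i -> F n = 0) ->
  forall n : {ffun I -> int}, c0 + (size l)%:Z < \sum_i n i -> foldmul l F n = 0.
Proof.
move=> h; elim: l => [|p l IH] n hn; first by apply: h; rewrite addr0 in hn.
have decS a : \sum_i dec a n i = \sum_i n i - 1.
  rewrite (bigD1 a) //= [in RHS](bigD1 a) //= dec_eq [RHS]addrAC; congr (_ + _).
  by apply: eq_bigr => i ia; rewrite dec_neq.
have IH' a : foldmul l F (dec a n) = 0.
  by apply: IH; rewrite decS; move: hn => /=; move: (\sum_i n i) (size l) => s t; lia.
by rewrite /= /mulX !IH' subrr.
Qed.

Section Expansion.
Variables (k D : nat) (v : 'I_k -> V) (w : W) (p : int) (z : 'I_k -> C) (n : {ffun 'I_k -> C}).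
Hypothesis hD : forall i (x : W) m j, (D.+1 <= j)%N -> YW (v i) x m j = 0.
Let J := {ffun 'I_k -> 'I_D.+1}.

Definition mode_prod (jj : J) (s : seq 'I_k) : W :=
  foldr (fun i u => YW (v i) u (n i) (jj i)) w s.

Definition log_coef (jj : J) i : C := cexp (n i * lp p (z i)) * lp p (z i) ^+ jj i.

Definition upd (jj : J) i x : J := [ffun l => if l == i then x else jj l].

(** Selects one choice of powers of logarithms for each choice at the positions in s. *)
Definition supported (s : seq 'I_k) (jj : J) := [forall l, (l \notin s) ==> (jj l == ord0)].

Lemma mode_prod_upd jj i x s : i \notin s -> mode_prod (upd jj i x) s = mode_prod jj s.
Proof.
elim: s => //= a s IH; rewrite inE negb_or => /andP[ia /IH ->].
by rewrite ffunE eq_sym (negPf ia).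
Qed.

Lemma expand_product s : uniq s ->
  foldr (fun i u => subst_term (YW (v i) u) p (z i) (n i)) w s =
  \sum_(jj | supported s jj) (\prod_(i <- s) log_coef jj i) *: mode_prod jj s.
Proof.
elim: s => [|i s IH] /=.
  move=> _; rewrite (big_pred1 [ffun=> ord0]) ?big_nil ?scale1r // => jj.
  apply/forallP/eqP => [h|-> l]; last by rewrite ffunE eqxx.
  by apply/ffunP => l; rewrite ffunE; apply/eqP; exact: h.
move=> /andP[iS us]; rewrite IH //.
rewrite (@subst_termE _ _ _ _ _ _ D.+1); last by move=> j; exact: hD.
transitivity (\sum_(x < D.+1) \sum_(jj | supported s jj) (cexp (n i * lp p (z i)) * lp p (z i) ^+ x) *:
    ((\prod_(l <- s) log_coef jj l) *: YW (v i) (mode_prod jj s) (n i) x)).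
  apply: eq_bigr => x _; rewrite (lin_sum (YWr (v i) (n i) x)) scaler_sumr.
  by apply: eq_bigr => jj _; rewrite (linZ (YWr (v i) (n i) x)).
rewrite pair_big /=.
rewrite [RHS](reindex_onto (fun q : 'I_D.+1 * J => upd q.2 i q.1)
   (fun jj => (jj i, upd jj i ord0))) /=; last first.
  by move=> jj _; apply/ffunP => l; rewrite !ffunE; case: eqP => // ->.
apply: eq_big => [[x jj]|[x jj] _] /=.
  apply/forallP/andP => [h|[/forallP h1 /eqP[_ e]] l].
    have ji : jj i = ord0 by apply/eqP; have := h i; rewrite iS.
    split.
      apply/forallP => l; apply/implyP; rewrite inE negb_or => /andP[li ls].
      by rewrite ffunE (negPf li); have := h l; rewrite ls.
    rewrite ffunE eqxx; apply/eqP; congr (_, _); apply/ffunP => l; rewrite !ffunE.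
    by case: eqP => [->|_]; rewrite ?ji.
  apply/implyP => ls; have := h1 l; rewrite inE negb_or ls andbT.
  have [li _|li /=] := eqVneq l i; last by rewrite ffunE (negPf li).
  by rewrite -e ffunE li eqxx.
rewrite scalerA big_cons mode_prod_upd //.
have -> : log_coef (upd jj i x) i = cexp (n i * lp p (z i)) * lp p (z i) ^+ x.
  by rewrite /log_coef ffunE eqxx.
rewrite ffunE eqxx; congr (_ * _ *: _).
rewrite big_seq [RHS]big_seq; apply: eq_bigr => l ls; rewrite /log_coef ffunE.
by case: eqP => // li; move: iS; rewrite -li ls.
Qed.

Lemma product_termE (w' : {scalar W}) : product_term w' p v z w n =
  \sum_(jj : J) (\prod_i log_coef jj i) * w' (mode_prod jj (enum 'I_k)).
Proof.
rewrite /product_term expand_product ?enum_uniq // linear_sum.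
apply: eq_big => [jj|jj _]; last by rewrite linearZ /= big_enum.
by apply/forallP => l; rewrite mem_enum.
Qed.

End Expansion.

(** The bound does not depend on alpha because 0 <= Re alpha. *)
Lemma lower_exponent u (w : W) : exists b : int, forall (alpha : C), alpha_range alpha ->
  forall t (n : int) j, t \in wt_index u -> n < b -> YW (wt_part u t) w (n%:~R - alpha) j = 0.
Proof.
have [bt hbt] := choice (fun t => YW_trunc hW (wt_part u t) w).
exists (- (\sum_(t <- wt_index u) absz (bt t))%N%:Z) => alpha /andP[a0 _] t n j tu nb.
apply: hbt.
have h : (absz (bt t) <= \sum_(t <- wt_index u) absz (bt t))%N.
  by rewrite (big_rem t) //= leq_addr.
have -> : complex.Re (n%:~R - alpha) = n%:~R - complex.Re alpha.
  have -> : (n%:~R : C) = (n%:~R : R)%:C by rewrite rmorph_int.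
  by case: (alpha).
have : (n%:~R : R) < (bt t)%:~R by rewrite ltr_int; lia.
lra.
Qed.

Variables (k : nat) (Nf : V -> V -> nat) (bf : V -> W -> int).
Hypothesis hNf : forall u v (alpha beta : C), vgweight g alpha u -> vgweight g beta v ->
  forall t j1 j2, t \in wt_index u -> exchangeable W alpha beta (wt_part u t) v j1 j2 (Nf u v).
Hypothesis hbf : forall u w (alpha : C), alpha_range alpha ->
  forall t (n : int) j, t \in wt_index u -> n < bf u w -> YW (wt_part u t) w (n%:~R - alpha) j = 0.
Variables (alpha : 'I_k -> C) (v : 'I_k -> V) (w : W) (w' : {scalar W}).
Hypothesis hv : forall i, alpha_range (alpha i) /\ vgweight g (alpha i) (v i).
Hypothesis hw' : wdual w'.

Let N i j := Nf (v i) (v j).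
Let L := all_pairs N (enum 'I_k).

Definition coef (j : 'I_k -> nat) (n : {ffun 'I_k -> int}) : C :=
  w' (Yprod v alpha j (enum 'I_k) w n).

(** The multiplied series is a Laurent polynomial: lower bounds come from moving factors
to the right, the bound on the total degree from the finitely many weights that w'
sees. *)
Lemma coef_laurent (j : 'I_k -> nat) : exists c0 : int,
  (forall i, lowb i (bf (v i) w) (foldmul L (coef j))) /\
  (forall n : {ffun 'I_k -> int}, c0 < \sum_i n i -> foldmul L (coef j) n = 0).
Proof.
have [K hK] := Yprod_filt v alpha j (enum 'I_k) w; have [K' hK'] := wdual_filt hw'.
exists (Num.floor (K + K') + 1 + (size L)%:Z); split.
  move=> i n ni; rewrite /coef -(foldmul_map _ _ _ (linearB w')).
  have ienum : i \in enum 'I_k by rewrite mem_enum.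
  have [s1 [s2 e]] : exists s1 s2, enum 'I_k = s1 ++ i :: s2.
    by case/splitPr: ienum => s1 s2; exists s1, s2.
  rewrite /L e (lowb_Yprod (B := bf (v i) w)) ?linear0 //.
  - by rewrite -e enum_uniq.
  - by move=> b t ti; apply: hNf => //; have [] := hv b; have [] := hv i.
  by move=> m t ti mb; apply: (hbf (hv i).1).
apply: foldmul_top => n hn; rewrite /coef.
apply: (hK' _ _ _ (hK n)); left.
rewrite big_enum /=.
have -> : \sum_i (n i)%:~R = (\sum_i n i)%:~R :> R by rewrite rmorph_sum.
have h1 := Num.Theory.floor_itv (K + K').
have : (Num.floor (K + K') + 1)%:~R < (\sum_i n i)%:~R :> R by rewrite ltr_int.
lra.
Qed.

(** The function f does not depend on the point z: it is the Laurent polynomial divided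
by the product of the (z_a - z_b)^{N a b}. *)
Lemma coef_sums (j : 'I_k -> nat) : exists f : ratfun R k,
  [/\ forall z, product_region z ->
        abs_sums_to (fun n => coef j n * mono z n) (rf_eval f z),
      forall i, order_ge_at0 i f (bf (v i) w) &
      forall i l, i != l -> order_ge_at_diag i l f (- ((N i l)%:Z + (N l i)%:Z))].
Proof.
have [c0 [lo hi]] := coef_laurent j.
exists (laurent_ratfun (fun i => bf (v i) w) (foldmul L (coef j)) c0 N); split.
- move=> z [z0 zlt].
  have [labs lsum] := laurent_sums lo hi z.
  have zL q : q \in L -> normc (z q.2) < normc (z q.1).
    move=> /all_pairs_mem[s1 [s2 [e q2]]]; apply: zlt.
    have := pairwise_enum_ord k; rewrite e pairwise_cat /= => /and3P[_ _ /andP[/allP h _]].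
    exact: h.
  have ev q : q \in L -> eventually0 q.1 q.2 (coef j).
    move=> /all_pairs_mem[s1 [s2 [e q2]]] n.
    have us : uniq (s1 ++ q.1 :: s2) by rewrite -e enum_uniq.
    have [m0 hm0] := Yprod_trunc v alpha j hW w n q2 us; exists m0 => m mm.
    by rewrite /coef e hm0 // linear0.
  have ab := abs_conv_foldmul z0 zL ev labs.
  have [S hS] := abs_conv_sums_to ab.
  suff -> : rf_eval (laurent_ratfun (fun i => bf (v i) w) (foldmul L (coef j)) c0 N) z = S by [].
  rewrite laurent_eval // -(sums_to_uniq (sums_foldmul z0 L hS) lsum) -/L prod_all_pairs mulrC mulKf //.
  rewrite -(prod_all_pairs N z) prodf_seq_neq0; apply/allP => q /zL lt; apply/implyP => _.
  by rewrite subr_eq0; apply: contraTneq lt => ->; rewrite ltxx.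
- by move=> i; exact: laurent_order0.
by move=> i l il; exact: laurent_order_diag.
Qed.

Lemma product_expansion : exists (D : nat) (f : {ffun 'I_k -> 'I_D.+1} -> ratfun R k),
  [/\ forall (p : int) z, product_region z ->
        abs_sums_to (product_term w' p v z w) (product_branch f alpha p z),
      forall n i, order_ge_at0 i (f n) (bf (v i) w) &
      forall n i l, i != l ->
        order_ge_at_diag i l (f n) (- ((Nf (v i) (v l))%:Z + (Nf (v l) (v i))%:Z))].
Proof.
have [d hd] := choice (fun i => YW_logdeg W (hv i).2).
pose D := (\sum_i d i)%N.
have hD i (x : W) m j : (D.+1 <= j)%N -> YW (v i) x m j = 0.
  move=> Dj; apply: hd; apply: leq_trans Dj; rewrite /D (bigD1 i) //= ltnW // ltnS leq_addr //.
have [f hf] := choice (fun jj : {ffun 'I_k -> 'I_D.+1} => coef_sums (fun i => jj i)).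
exists D, f; split=> [p z hz|n i|n i l il]; last 2 first.
- by have [_ h _] := hf n; exact: h.
- by have [_ _ h] := hf n; exact: h.
have [z0 _] := hz.
pose h (n : {ffun 'I_k -> int}) : {ffun 'I_k -> C} := [ffun i => (n i)%:~R - alpha i].
have hinj : injective h.
  move=> n n' /ffunP e; apply/ffunP => i; have := e i; rewrite !ffunE => /addIr/eqP.
  by rewrite eqr_int => /eqP.
have off n : (forall m, n <> h m) -> product_term w' p v z w n = 0.
  move=> hn; rewrite (product_termE w p z n hD) big1 // => jj _.
  have /existsNP[i hi] : ~ forall i, exists q : int, n i = q%:~R - alpha i.
    move=> /choice[q hq]; apply: (hn [ffun i => q i]).
    by apply/ffunP => i; rewrite !ffunE.
  have hi' (q : int) : n i != q%:~R - alpha i by apply/eqP => e; apply: hi; exists q.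
  rewrite (_ : mode_prod _ _ _ _ _ = 0) ?linear0 ?mulr0 //.
  have : i \in enum 'I_k by rewrite mem_enum.
  elim: (enum _) => //= a s IH; rewrite inE => /orP[/eqP <-|/IH ->].
    by rewrite (YW_class _ _ (hv i).2).
  exact: (lin0 (YWr _ _ _)).
have termE n : product_term w' p v z w (h n) =
    \sum_(jj : {ffun 'I_k -> 'I_D.+1}) ((\prod_(i < k) cexp (- alpha i * lp p (z i))) *
      \prod_(i < k) lp p (z i) ^+ jj i) * (coef (fun i => jj i) n * mono z n).
  rewrite (product_termE w p z (h n) hD); apply: eq_bigr => jj _.
  have -> : w' (mode_prod v w (h n) jj (enum 'I_k)) = coef (fun i => jj i) n.
    rewrite /coef; congr (w' _); elim: (enum _) => //= a s ->.
    by rewrite /Ymode ffunE.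
  have -> : \prod_i log_coef p z (h n) jj i = (\prod_(i < k) cexp (- alpha i * lp p (z i))) *
      \prod_(i < k) lp p (z i) ^+ jj i * mono z n; last by ring.
  rewrite /mono -!big_split; apply: eq_bigr => i _ /=.
  rewrite /log_coef ffunE.
  have -> : z i ^ n i = cexp ((n i)%:~R * lp p (z i)) by rewrite cexpMz cexp_lp.
  rewrite mulrBl cexpD mulNr; ring.
split.
  apply/(abs_conv_preim hinj off).
  apply: (@abs_conv_ext _ _ _ _ (fun n => esym (termE n))).
  apply: abs_conv_sum => jj _; apply: abs_convZ.
  by have [hs _ _] := hf jj; have [] := hs z hz.
apply/(sums_to_preim _ hinj off).
apply: (@sums_to_ext _ _ _ _ _ (fun n => esym (termE n))).
rewrite /product_branch.
have -> : \sum_(n : {ffun 'I_k -> 'I_D.+1}) rf_eval (f n) z *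
     (\prod_(i < k) cexp (- alpha i * lp p (z i))) * \prod_(i < k) lp p (z i) ^+ n i =
   \sum_(n : {ffun 'I_k -> 'I_D.+1}) ((\prod_(i < k) cexp (- alpha i * lp p (z i))) *
      \prod_(i < k) lp p (z i) ^+ n i) * rf_eval (f n) z.
  by apply: eq_bigr => n _; ring.
apply: sums_to_sum => jj _; apply: sums_toZ.
by have [hs _ _] := hf jj; have [] := hs z hz.
Qed.

End Assembly.

Theorem theorem3p10 (R : realType) (V : gr_vertex_superalgebra R)
    (g : vautomorphism V) (W : gtwisted_module g) (hW : lower_bounded W)
    (k : nat) :
  (forall (alpha : 'I_k -> R[i]) (v : 'I_k -> V) (w : W) (w' : {scalar W}),
    (forall i, alpha_range (alpha i) /\ vgweight g (alpha i) (v i)) ->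
    wdual w' ->
    forall (p : int) (z : 'I_k -> R[i]), product_region z ->
      abs_convergent (product_term w' p v z w))
  /\
  exists (b : 'I_k -> V -> W -> int) (c : 'I_k -> 'I_k -> V -> V -> int),
  forall (alpha : 'I_k -> R[i]) (v : 'I_k -> V) (w : W) (w' : {scalar W}),
    (forall i, alpha_range (alpha i) /\ vgweight g (alpha i) (v i)) ->
    wdual w' ->
    exists (N : nat) (f : {ffun 'I_k -> 'I_N.+1} -> ratfun R k),
      [/\ forall (p : int) (z : 'I_k -> R[i]), product_region z ->
            sums_to (product_term w' p v z w) (product_branch f alpha p z),
          forall n (i : 'I_k), order_ge_at0 i (f n) (b i (v i) w) &
          forall n (i j : 'I_k), i != j ->
            order_ge_at_diag i j (f n) (c i j (v i) (v j))].
Proof.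
have [Nf hNf] := choice (fun q : V * V => exchange_bound hW q.1 q.2).
have [bf hbf] := choice (fun q : V * W => lower_exponent hW q.1 q.2).
have core := @product_expansion _ _ _ _ hW k (fun u v => Nf (u, v)) (fun u w => bf (u, w))
  (fun u v => hNf (u, v)) (fun u w => hbf (u, w)).
split=> [alpha v w w' hv hw' p z hz|].
  by have [D [f [h _ _]]] := core alpha v w w' hv hw'; have [] := h p z hz.
exists (fun _ u w => bf (u, w)), (fun _ _ u u' => - ((Nf (u, u'))%:Z + (Nf (u', u))%:Z)).
move=> alpha v w w' hv hw'; have [D [f [h1 h2 h3]]] := core alpha v w w' hv hw'.
by exists D, f; split=> // p z hz; have [] := h1 p z hz.
Qed.
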